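(* Let $\theta_1 \in (0,\pi/2]$, $\theta_2 \in [0,\pi/2]$, $p \in\mathcal{C}^2([0,1])$ with $p > 0$, and $\tilde{q} \in\mathcal{C}^0([0,1])$. Let $q \in\mathcal{C}^0([0,1])$ and $q_c \in\mathbb{R}$ be such that $\tilde q(x) = q(x) - q_c$ and $q(x)>0$ for all $x\in[0,1]$. Let $\delta > 0$ and $N_0 \geq 1$ be such that $-\lambda_n + q_c < - \delta$ for all $n \geq N_0 + 1$. Let $K\in\mathbb{R}^{1 \times N_0}$ and $L\in\mathbb{R}^{N_0}$ be such that $A_0 + \mathfrak{B}_0 K$ and $A_0 - L C_0$ are Hurwitz with eigenvalues that have a real part strictly less than $-\delta<0$. For a given $N \geq N_0 +1$, assume that there exist a symmetric matrix $P\in\mathbb{R}^{2N\times 2N}$ with $P \succ 0$ and $\alpha,\beta,\gamma > 0$ such that $$\Theta_1 \preceq 0 ,\qquad \Theta_2 \leq 0 ,\qquad \Theta_3 \geq 0 \qquad (\ast)$$ where $$\Theta_1 = \begin{bmatrix} F^\top P + P F + 2 \delta P + \alpha\gamma \Vert \mathcal{R}_N a \Vert_{L^2}^2 \tilde{K}^\top \tilde{K} & P\mathcal{L} \\ \mathcal{L}^\top P & - \beta \end{bmatrix} + \alpha\gamma \Vert \mathcal{R}_N b \Vert_{L^2}^2 E^\top E ,$$ $$\Theta_2 = 2\gamma\left\{ -\lambda_{N+1}+q_c + \delta + \frac{1}{\alpha} \right\} + \beta M_\phi \lambda_{N+1}^{3/4},\qquad \Theta_3 = 2\gamma - \frac{\beta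 M_\phi}{\lambda_{N+1}^{1/4}},$$ with $M_\phi = \sum_{n \geq N+1} \frac{\vert \phi_n(0) \vert^2}{\lambda_n^{3/4}} < +\infty$. Then there exists a constant $M > 0$ such that for any initial conditions $z_0 \in H^2(0,1)$ and $\hat{z}_n(0)\in\mathbb{R}$ ($1\le n\le N$) such that $\cos(\theta_1) z_0(0) - \sin(\theta_1) z_0'(0) = 0$ and $\cos(\theta_2) z_0(1) + \sin(\theta_2) z_0'(1) = K \hat{Z}^{N_0}(0)$, where $\hat Z^{N_0}=[\hat z_1,\ldots,\hat z_{N_0}]^\top$, the trajectories of the closed-loop system composed of the plant (P) and the controller (C) described in the context satisfy $$\Vert z(t,\cdot) \Vert_{L^2}^2 + \sum_{n = 1}^{N} \hat{z}_n(t)^2 \leq M e^{-2\delta t} \left( \Vert z_0 \Vert_{L^2}^2 + \sum_{n = 1}^{N} \hat{z}_n(0)^2 \right)$$ for all $t \geq 0$. Moreover, the constraints $(\ast)$ are always feasible (i.e. such $P,\alpha,\beta,\gamma$ exist) for $N$ selected large enough.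
   Context: All functions are real valued. $\langle f,g\rangle=\int_0^1 fg\,dx$ is the inner product of $L^2(0,1)$. For symmetric matrices, $P\succ0$ (resp. $\succeq 0$, $\preceq 0$) means positive definite (resp. positive semi-definite, negative semi-definite). Sturm-Liouville operator: $\mathcal{A}f=-(pf')'+qf$ on $D(\mathcal{A})=\{f\in H^2(0,1): \cos(\theta_1)f(0)-\sin(\theta_1)f'(0)=0,\ \cos(\theta_2)f(1)+\sin(\theta_2)f'(1)=0\}$. Its eigenvalues $\lambda_1<\lambda_2<\cdots$ are simple, positive (as $q>0$) and tend to $+\infty$; $\phi_n$ are associated unit-norm eigenvectors, forming a Hilbert basis of $L^2(0,1)$. For $f\in L^2(0,1)$, $\mathcal{R}_Nf=\sum_{n\ge N+1}\langle f,\phi_n\rangle\phi_n$. Plant (P): for $t>0$, $x\in(0,1)$, $z_t=(p(x)z_x)_x-\tilde q(x)z$, $\ \cos(\theta_1)z(t,0)-\sin(\theta_1)z_x(t,0)=0$, $\ \cos(\theta_2)z(t,1)+\sin(\theta_2)z_x(t,1)=u(t)$, $\ y(t)=z(t,0)$, $\ z(0,x)=z_0(x)$, with input $u$ and measurement $y$. Let $a(x)=\frac{2p(x)+2xp'(x)-x^2\tilde q(x)}{\cos(\theta_2)+2\sin(\theta_2)}$, $b(x)=-\frac{x^2}{\cos(\theta_2)+2\sin(\theta_2)}$, $a_n=\langle a,\phi_n\rangle$, $b_n=\langle b,\phi_n\rangle$, and $\beta_n=a_n+(-\lambda_n+q_c)b_n=p(1)\{-\cos(\theta_2)\phi_n'(1)+\sin(\theta_2)\phi_n(1)\}$.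 Controller (C), with $K=[k_1,\ldots,k_{N_0}]$ and $L=[l_1,\ldots,l_{N_0}]^\top$: $\hat w_n=\hat z_n+b_nu$ for $1\le n\le N$; $\dot{\hat z}_n=(-\lambda_n+q_c)\hat z_n+\beta_nu-l_n\{\sum_{k=1}^N\hat w_k\phi_k(0)-y\}$ for $1\le n\le N_0$; $\dot{\hat z}_n=(-\lambda_n+q_c)\hat z_n+\beta_nu$ for $N_0+1\le n\le N$; $u=\sum_{k=1}^{N_0}k_k\hat z_k$. Trajectories are understood as classical solutions: with $w(t,x)=z(t,x)+b(x)u(t)$ (so that $w_t=(pw_x)_x-\tilde qw+a\,u+b\,\dot u$ with homogeneous boundary conditions, $y(t)=w(t,0)$, and $w(0,\cdot)\in D(\mathcal A)$) and $\hat z=(\hat z_1,\ldots,\hat z_N)$, one has $(w,\hat z)\in\mathcal{C}^0([0,\infty);L^2(0,1)\times\mathbb{R}^N)\cap\mathcal{C}^1((0,\infty);L^2(0,1)\times\mathbb{R}^N)$, $w(t,\cdot)\in D(\mathcal{A})$ for all $t>0$, $\mathcal{A}w\in\mathcal{C}^0((0,\infty);L^2(0,1))$ and $\mathcal{A}^{1/2}w\in\mathcal{C}^0([0,\infty);L^2(0,1))$. Such solutions exist for the initial conditions considered, by standard semigroup theory. Matrices: $A_0=\mathrm{diag}(-\lambda_1+q_c,\ldots,-\lambda_{N_0}+q_c)$, $A_1=\mathrm{diag}(-\lambda_{N_0+1}+q_c,\ldots,-\lambda_N+q_c)$, $\mathfrak{B}_0=[\beta_1,\ldots,\beta_{N_0}]^\top$,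 $\tilde{\mathfrak{B}}_1=\left[\frac{\beta_{N_0+1}}{\lambda_{N_0+1}},\ldots,\frac{\beta_N}{\lambda_N}\right]^\top$, $C_0=[\phi_1(0),\ldots,\phi_{N_0}(0)]$, $\tilde C_1=\left[\frac{\phi_{N_0+1}(0)}{\sqrt{\lambda_{N_0+1}}},\ldots,\frac{\phi_N(0)}{\sqrt{\lambda_N}}\right]$, $$F=\begin{bmatrix}A_0+\mathfrak{B}_0K&LC_0&0&L\tilde C_1\\0&A_0-LC_0&0&-L\tilde C_1\\\tilde{\mathfrak{B}}_1K&0&A_1&0\\0&0&0&A_1\end{bmatrix},\quad\mathcal{L}=\begin{bmatrix}L\\-L\\0\\0\end{bmatrix},$$ $\tilde K=[K\ 0\ 0\ 0]\in\mathbb{R}^{1\times 2N}$, and $E=K\,[A_0+\mathfrak{B}_0K\ \ LC_0\ \ 0\ \ L\tilde C_1\ \ L]\in\mathbb{R}^{1\times(2N+1)}$, with block sizes $N_0,N_0,N-N_0,N-N_0$ (and a last block of size $1$ for $E$). *)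

(* Defs.v *)
From HB Require Import structures.
From mathcomp Require Import all_boot all_order all_algebra.
From mathcomp Require Import all_classical all_reals all_analysis.
From mathcomp.real_closed Require Import complex.

Set Implicit Arguments.
Unset Strict Implicit.
Unset Printing Implicit Defensive.
Import Order.TTheory GRing.Theory Num.Theory.
Import numFieldNormedType.Exports.

Local Open Scope classical_set_scope.
Local Open Scope ring_scope.

(* Conventions.
   - Functions on [0,1] are total functions R -> R of which only the values on
     [0,1] matter.  Elements of L^2(0,1) are such functions, compared through
     the L^2 distance.
   - Modes are indexed from 0: [lam n] and [phi n] stand for lambda_{n+1} and
     phi_{n+1}, and likewise for beta_n, zhat_n, k_n, l_n.  Thus
     "1 <= n <= N" reads n < N, "n >= N + 1" reads N <= n, and lambda_{N+1}
     is [lam N]. *)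

Section Functions.
Context {R : realType}.
Implicit Types f g : R -> R.

Definition ip f g : R := \int[lebesgue_measure]_(x in `[0, 1]) (f x * g x).

Definition L2norm f : R := Num.sqrt (ip f f).

Definition in_L2 f := f \_ `[0, 1] \in Lfun (@lebesgue_measure R) 2%:E.

Definition is_L2sum (u : nat -> R -> R) g :=
  in_L2 g /\
  (fun m : nat => L2norm (fun x => \sum_(n < m) u n x - g x)) @ \oo --> (0 : R).

(* 0 if the series does not converge in L^2. *)
Definition L2sum (u : nat -> R -> R) : R -> R := xget (cst 0) (is_L2sum u).

(* Derivative relative to [0,1]: one-sided at the end points. *)
Definition dquot01 f (x y : R) : R := (f y - f x) / (y - x).
Definition derivable01 f (x : R) :=
  cvg (dquot01 f x y @[y --> within `[0, 1] x^']).
Definition der01 f (x : R) : R :=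
  lim (dquot01 f x y @[y --> within `[0, 1] x^']).

Definition C0_01 f := {within `[0, 1], continuous f}.
Definition C1_01 f :=
  (forall x, x \in `[0, 1] -> derivable01 f x) /\ C0_01 (der01 f).
Definition C2_01 f := C1_01 f /\ C1_01 (der01 f).

(* f is the continuous representative of an element of H^1(0,1) whose weak
   derivative is g. *)
Definition H1_deriv f g :=
  in_L2 g /\
  forall x, x \in `[0, 1] ->
    f x = f 0 + \int[lebesgue_measure]_(s in `[0, x]) g s.

Definition in_H2 f := exists g, H1_deriv f (der01 f) /\ H1_deriv (der01 f) g.

Definition L2_continuous (D : set R) (w : R -> R -> R) :=
  forall t, D t ->
    in_L2 (w t) /\
    L2norm (fun x => w s x - w t x) @[s --> within D (nbhs t)] --> (0 : R).

Definition L2_is_deriv (w : R -> R -> R) (t : R) g :=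
  in_L2 g /\
  L2norm (fun x => (w (t + h) x - w t x) / h - g x) @[h --> 0^'] --> (0 : R).

Definition left_bc (theta1 : R) f : R :=
  cos theta1 * f 0 - sin theta1 * der01 f 0.
Definition right_bc (theta2 : R) f : R :=
  cos theta2 * f 1 + sin theta2 * der01 f 1.

End Functions.

Section SturmLiouville.
Context {R : realType} (p q : R -> R) (theta1 theta2 : R).

(* f \in D(A) and A f = g in L^2(0,1), the equation -(p f')' + q f = g being
   read as: p f' \in H^1(0,1) with derivative q f - g. *)
Definition sl_op (f g : R -> R) :=
  [/\ in_H2 f, left_bc theta1 f = 0, right_bc theta2 f = 0 &
      H1_deriv (fun x => p x * der01 f x) (fun x => q x * f x - g x)].

Definition sl_eigenvalue (mu : R) :=
  exists f, sl_op f (fun x => mu * f x) /\ L2norm f != 0.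

Definition hilbert_basis (phi : nat -> R -> R) :=
  [/\ forall n, in_L2 (phi n),
      forall m n, ip (phi m) (phi n) = (m == n)%:R &
      forall f, in_L2 f -> is_L2sum (fun n x => ip f (phi n) * phi n x) f].

Record sl_eigensystem (lam : nat -> R) (phi : nat -> R -> R) : Prop := {
  sl_lam_spectrum : forall mu, sl_eigenvalue mu <-> exists n, mu = lam n;
  sl_lam_increasing : forall n, lam n < lam n.+1;
  sl_lam_gt0 : forall n, 0 < lam n;
  sl_lam_pinfty : lam n @[n --> \oo] --> +oo;
  sl_phi_eigen : forall n, sl_op (phi n) (fun x => lam n * phi n x);
  sl_phi_basis : hilbert_basis phi
}.

End SturmLiouville.

Section Spectral.
Context {R : realType} (lam : nat -> R) (phi : nat -> R -> R).

(* f \in D(A^{1/2}) and A^{1/2} f = g, by the spectral definition of A^{1/2}. *)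
Definition sl_sqrt_op (f g : R -> R) :=
  is_L2sum (fun n x => Num.sqrt (lam n) * ip f (phi n) * phi n x) g.

Definition remainder (N : nat) (f : R -> R) : R -> R :=
  L2sum (fun n x => ip f (phi (N + n)%N) * phi (N + n)%N x).

Definition Mphi_ereal (N : nat) : \bar R :=
  (\sum_(N <= n <oo) (`|phi n 0| ^+ 2 / lam n `^ (3 / 4))%:E)%E.

Definition Mphi (N : nat) : R := fine (Mphi_ereal N).

End Spectral.

Section Coefficients.
Context {R : realType} (p qt : R -> R) (qc theta2 : R).
Context (lam : nat -> R) (phi : nat -> R -> R).

Definition afun (x : R) : R :=
  (2 * p x + 2 * x * der01 p x - x ^+ 2 * qt x) / (cos theta2 + 2 * sin theta2).

(* cos theta2 b(1) + sin theta2 b'(1) = -1, so w = z + b u satisfies the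
   homogeneous boundary conditions. *)
Definition bfun (x : R) : R := - (x ^+ 2 / (cos theta2 + 2 * sin theta2)).

Definition acoef (n : nat) : R := ip afun (phi n).
Definition bcoef (n : nat) : R := ip bfun (phi n).
Definition betacoef (n : nat) : R := acoef n + (- lam n + qc) * bcoef n.

End Coefficients.

Section Matrices.
Context {R : realType}.

(* Only used on symmetric matrices. *)
Definition posdef n (M : 'M[R]_n) :=
  forall v : 'cV[R]_n, v != 0 -> 0 < (v^T *m M *m v) 0 0.

Definition negsemidef n (M : 'M[R]_n) :=
  forall v : 'cV[R]_n, (v^T *m M *m v) 0 0 <= 0.

(* All complex eigenvalues of M have real part < - delta. *)
Definition hurwitz_lt (delta : R) n (M : 'M[R]_n) :=
  forall c : R[i], eigenvalue (map_mx (real_complex R) M) c ->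
    complex.Re c < - delta.

Context (p qt : R -> R) (qc theta2 : R).
Context (lam : nat -> R) (phi : nat -> R -> R).
Local Notation betac := (betacoef p qt qc theta2 lam phi).

Section Sizes.
Context (N0 N : nat).

Definition A0mx : 'M[R]_N0 := diag_mx (\row_i (- lam i + qc)).
Definition A1mx : 'M[R]_(N - N0) := diag_mx (\row_i (- lam (N0 + i)%N + qc)).
Definition B0mx : 'cV[R]_N0 := \col_i betac i.
Definition B1tmx : 'cV[R]_(N - N0) := \col_i (betac (N0 + i)%N / lam (N0 + i)%N).
Definition C0mx : 'rV[R]_N0 := \row_i phi i 0.
Definition C1tmx : 'rV[R]_(N - N0) :=
  \row_i (phi (N0 + i)%N 0 / Num.sqrt (lam (N0 + i)%N)).

End Sizes.

Context (N0 N : nat) (K : 'rV[R]_N0) (L : 'cV[R]_N0).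

(* Equal to 2 N as soon as N0 <= N. *)
Local Notation dimX := (N0 + (N0 + ((N - N0) + (N - N0))))%N.

Definition Fmx : 'M[R]_dimX :=
  let A0 := A0mx N0 in let A1 := A1mx N0 N in
  let B0 := B0mx N0 in let B1t := B1tmx N0 N in
  let C0 := C0mx N0 in let C1t := C1tmx N0 N in
  col_mx (row_mx (A0 + B0 *m K) (row_mx (L *m C0) (row_mx 0 (L *m C1t))))
 (col_mx (row_mx 0 (row_mx (A0 - L *m C0) (row_mx 0 (- (L *m C1t)))))
 (col_mx (row_mx (B1t *m K) (row_mx 0 (row_mx A1 0)))
         (row_mx 0 (row_mx 0 (row_mx 0 A1))))).

Definition Lmx : 'cV[R]_dimX := col_mx L (col_mx (- L) (col_mx 0 0)).

Definition Kmx : 'rV[R]_dimX := row_mx K (row_mx 0 (row_mx 0 0)).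

Definition Emx : 'rV[R]_(dimX + 1) :=
  let A0 := A0mx N0 in let B0 := B0mx N0 in
  let C0 := C0mx N0 in let C1t := C1tmx N0 N in
  K *m row_mx
    (row_mx (A0 + B0 *m K) (row_mx (L *m C0) (row_mx 0 (L *m C1t)))) L.

Context (delta : R) (P : 'M[R]_dimX) (alpha beta gamma : R).

Definition Theta1 : 'M[R]_(dimX + 1) :=
  block_mx
    (Fmx^T *m P + P *m Fmx + (2 * delta) *: P
       + (alpha * gamma * L2norm (remainder phi N (afun p qt theta2)) ^+ 2)
           *: (Kmx^T *m Kmx))
    (P *m Lmx)
    (Lmx^T *m P)
    (- beta)%:M
  + (alpha * gamma * L2norm (remainder phi N (bfun theta2)) ^+ 2)
      *: (Emx^T *m Emx).

Definition Theta2 : R :=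
  2 * gamma * (- lam N + qc + delta + alpha^-1)
  + beta * Mphi lam phi N * lam N `^ (3 / 4).

Definition Theta3 : R :=
  2 * gamma - beta * Mphi lam phi N / lam N `^ (1 / 4).

Definition lmi_constraints :=
  [/\ P^T = P, posdef P, [/\ 0 < alpha, 0 < beta & 0 < gamma] &
      [/\ negsemidef Theta1, Theta2 <= 0 & 0 <= Theta3]].

End Matrices.

Section ClosedLoop.
Context {R : realType} (p q qt : R -> R) (qc theta1 theta2 : R).
Context (lam : nat -> R) (phi : nat -> R -> R).

Record plant (z : R -> R -> R) (u y : R -> R) (z0 : R -> R) : Prop := {
  (* z_t is an L^2-valued derivative, and z_t = (p z_x)_x - qt z is read as:
     p z_x \in H^1(0,1) with derivative z_t + qt z. *)
  plant_pde : forall t : R, 0 < t ->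
    in_H2 (z t) /\
    exists zt, L2_is_deriv z t zt /\
      H1_deriv (fun x => p x * der01 (z t) x) (fun x => zt x + qt x * z t x);
  plant_left : forall t : R, 0 < t -> left_bc theta1 (z t) = 0;
  plant_right : forall t : R, 0 < t -> right_bc theta2 (z t) = u t;
  plant_output : forall t : R, 0 <= t -> y t = z t 0;
  plant_init : forall x, x \in `[0, 1] -> z 0 x = z0 x
}.

(* Only the components zhat n, n < N, are meaningful. *)
Record controller (N0 N : nat) (K : 'rV[R]_N0) (L : 'cV[R]_N0)
    (zhat : nat -> R -> R) (u y : R -> R) (zhat0 : nat -> R) : Prop := {
  controller_obs : forall (t : R) (n : 'I_N0), 0 < t ->
    is_derive t 1 (zhat n)
      ((- lam n + qc) * zhat n t + betacoef p qt qc theta2 lam phi n * u t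
       - L n 0 * (\sum_(k < N) (zhat k t + bcoef theta2 phi k * u t) * phi k 0
                  - y t));
  controller_open : forall (t : R) n, 0 < t -> (N0 <= n < N)%N ->
    is_derive t 1 (zhat n)
      ((- lam n + qc) * zhat n t + betacoef p qt qc theta2 lam phi n * u t);
  controller_input : forall t : R, 0 <= t -> u t = \sum_(k < N0) K 0 k * zhat k t;
  controller_init : forall n, (n < N)%N -> zhat n 0 = zhat0 n
}.

Definition wfun (z : R -> R -> R) (u : R -> R) (t x : R) : R :=
  z t x + bfun theta2 x * u t.

Record classical (N : nat) (w : R -> R -> R) (zhat : nat -> R -> R)
    : Prop := {
  classical_C0 : L2_continuous [set t | 0 <= t] w;
  classical_C1 : exists wt,
    (forall t : R, 0 < t -> L2_is_deriv w t (wt t)) /\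
    L2_continuous [set t | 0 < t] wt;
  classical_dom : exists Aw,
    (forall t : R, 0 < t -> sl_op p q theta1 theta2 (w t) (Aw t)) /\
    L2_continuous [set t | 0 < t] Aw;
  classical_sqrt : exists Sw,
    (forall t : R, 0 <= t -> sl_sqrt_op lam phi (w t) (Sw t)) /\
    L2_continuous [set t | 0 <= t] Sw;
  classical_zhat_C0 : forall n, (n < N)%N ->
    {within [set t | 0 <= t], continuous (zhat n)};
  classical_zhat_C1 : forall n (t : R), (n < N)%N -> 0 < t ->
    derivable (zhat n) t 1 /\ {for t, continuous (derive1 (zhat n))}
}.

Definition closed_loop_trajectory (N0 N : nat)
    (K : 'rV[R]_N0) (L : 'cV[R]_N0) (z0 : R -> R) (zhat0 : nat -> R)
    (z : R -> R -> R) (zhat : nat -> R -> R) :=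
  exists u y : R -> R,
    [/\ plant z u y z0, controller N K L zhat u y zhat0 &
        classical N (wfun z u) zhat].

End ClosedLoop.

(* Main.v *)
(** The Lyapunov function is [V = X^T P X + gamma |R_N w|^2], where [X] stacks
    the observer coordinates, the estimation errors of the first [N] modes and
    their rescalings. Bounding the cross terms of the tail with [a u + b u'] by
    Young's inequality and the measurement residue
    [zeta = \sum_(n > N) w_n phi_n(0)] by Cauchy-Schwarz with the weights
    [lambda_n^(3/4)], one gets
    [V' + 2 delta V <= [X; zeta]^T Theta1 [X; zeta] + \sum_(n > N) Gamma_n w_n^2],
    where [Gamma_n <= Theta2 <= 0] because [Theta3 >= 0]. Only the finite sums
    [N < n <= m] are estimated, and then [m] tends to infinity.

    Finiteness of [M_phi] uses no eigenvalue asymptotics: the inequality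
    [f(0)^2 <= |f|^2 + C |f| <A f, f>^(1/2)], tested on
    [\sum_(k <= n) phi_k(0) phi_k], gives
    [1 + \sum_(k <= n) phi_k(0)^2 = O(lambda_n^(1/2))], and then the series
    telescopes.

    For feasibility, [P] is block diagonal with Lyapunov matrices of the two
    Hurwitz blocks, the weights following the cascade structure of [F]. All
    constants are uniform in [N], so one may take [alpha = 1], [beta] fixed and
    [gamma = beta (M_phi + 1) / lambda_(N+1)^(1/4)], which tends to 0. *)
Require Import Defs.
From HB Require Import structures.
From mathcomp Require Import all_boot all_order all_algebra.
From mathcomp Require Import all_classical all_reals all_analysis.
From mathcomp.real_closed Require Import complex.
From mathcomp Require Import ring lra measurable_realfun.
Set Implicit Arguments.
Unset Strict Implicit.
Unset Printing Implicit Defensive.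
Import Order.TTheory GRing.Theory Num.Theory.
Import numFieldNormedType.Exports.
Local Open Scope classical_set_scope.
Local Open Scope ring_scope.

(** * The space L^2(0,1) *)

Section L2.
Context {R : realType}.
Implicit Types f g h : R -> R.
Local Notation mu := (@lebesgue_measure R).
Local Notation I01 := (`[0%R : R, 1%R]%classic).

(** The control enters through the boundary, so two sets of coordinates coexist. The finite part of
    [V] uses the coefficients of [z]: by Green's formula they are driven by [u] alone, through
    [betacoef], with no time derivative of [u]. The tail uses [w = z + b u], which satisfies
    homogeneous boundary conditions, so that its eigenfunction expansion converges at the point 0
    and zeta is the tail of that expansion. The price is [u'], but [u'] is linear in [X] and zeta:
    it is the row [Emx]. The scalings in [X] exist for the sake of feasibility. The numbers
    [beta_n / lambda_n] and [phi_n(0) / lambda_n^(1/2)] are square summable, so the coupling blocks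
    of [F] have norms bounded independently of [N]. The tail energy is written as [|w|^2] minus
    finitely many squares. Differentiating [V] thus never requires differentiating a series, and
    regularity in time is needed only for [w] as an L^2-valued map. *)

Lemma integrable_restrict01 f :
  mu.-integrable I01 (EFin \o f) <-> mu.-integrable setT (EFin \o (f \_ I01)).
Proof.
rewrite -restrict_EFin; split=> H.
  by apply/integrable_restrict => //=; rewrite setTI.
by move/integrable_restrict : H => /=; rewrite setTI; apply.
Qed.

Lemma in_L2P f : in_L2 f <->
  measurable_fun I01 f /\ mu.-integrable I01 (EFin \o (fun x => f x ^+ 2)).
Proof.
have sqE : ((fun x => (f \_ I01) x ^+ 2) = (fun x => f x ^+ 2) \_ I01).
  apply/funext => x; rewrite /patch; case: ifP => // _.
  by rewrite expr0n.
have iE : mu.-integrable I01 (EFin \o (fun x => f x ^+ 2)) <->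
    mu.-integrable setT (EFin \o (fun x => (f \_ I01) x ^+ 2)).
  by rewrite sqE; exact: integrable_restrict01.
split=> [Lf|[mf If]].
  split; last by apply/iE; exact: Lfun2_integrable_sqr.
  apply/(measurable_restrictT _ (measurable_itv _)).
  by move: Lf => /sub_Lfun_mfun; rewrite inE.
rewrite /in_L2; apply/andP; split.
  by rewrite inE /=; apply/(measurable_restrictT _ (measurable_itv _)).
rewrite inE /= /finite_norm unlock /=.
apply: poweR_lty.
move/iE : If => /integrableP[_]; apply: le_lt_trans.
rewrite le_eqVlt; apply/orP; left; apply/eqP; apply: eq_integral => x _ /=.
by rewrite normrX powR_mulrn.
Qed.

Lemma in_L2_mul f g : in_L2 f -> in_L2 g ->
  mu.-integrable I01 (EFin \o (fun x => f x * g x)).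
Proof.
move=> Lf Lg; have := Lfun2_mul_Lfun1 Lf Lg.
move/Lfun1_integrable => Ifg; apply/integrable_restrict01.
apply: eq_integrable Ifg => // x _ /=.
rewrite /patch /=; case: ifP => // _; by rewrite mulr0.
Qed.

Lemma le_integrable01 f g : measurable_fun I01 f ->
  (forall x, x \in `[0, 1] -> `|f x| <= g x) ->
  mu.-integrable I01 (EFin \o g) -> mu.-integrable I01 (EFin \o f).
Proof.
move=> mf fg; apply: le_integrable; first exact: measurable_itv.
  exact/measurable_EFinP.
move=> x Ix /=; rewrite lee_fin; apply: (le_trans (fg x Ix)); exact: ler_norm.
Qed.

Lemma integrable01_cst c : mu.-integrable I01 (EFin \o (fun=> c)).
Proof.
apply: continuous_compact_integrable; first exact: segment_compact.
by move=> x; exact: cvg_cst.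
Qed.

Lemma integrable01Z a f : mu.-integrable I01 (EFin \o f) ->
  mu.-integrable I01 (EFin \o (fun x => a * f x)).
Proof.
by move=> If; apply: eq_integrable (integrableZl _ a If) => //; exact: measurable_itv.
Qed.

Lemma integrable01D f g : mu.-integrable I01 (EFin \o f) -> mu.-integrable I01 (EFin \o g) ->
  mu.-integrable I01 (EFin \o (fun x => f x + g x)).
Proof.
by move=> If Ig; apply: eq_integrable (integrableD _ If Ig) => //; exact: measurable_itv.
Qed.

Lemma in_L2_bounded f M : measurable_fun I01 f ->
  (forall x, x \in `[0, 1] -> `|f x| <= M) -> in_L2 f.
Proof.
move=> mf fM; apply/in_L2P; split=> //.
apply: (@le_integrable01 _ (fun=> M ^+ 2)); last exact: integrable01_cst.
  exact: measurable_funX.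
move=> x Ix /=; rewrite ger0_norm ?sqr_ge0//.
by rewrite -real_normK ?num_real// lerXn2r ?nnegrE ?normr_ge0// ?(le_trans _ (fM x Ix)) // fM.
Qed.

Lemma C0_bounded f : C0_01 f -> exists2 M, 0 < M & forall x, x \in `[0, 1] -> `|f x| <= M.
Proof.
move=> cf; have := continuous_compact cf (@segment_compact R 0 1).
move=> /compact_bounded [M [_ /(_ (`|M| + 1))]].
have -> : M < `|M| + 1 by rewrite (le_lt_trans (ler_norm M)) ?ltrDl.
move=> /(_ isT) H; exists (`|M| + 1); first by rewrite ltr_wpDl.
by move=> x Ix; apply: H; exists x.
Qed.

Lemma C0_meas f : C0_01 f -> measurable_fun I01 f.
Proof.
by move=> cf; apply: subspace_continuous_measurable_fun => //; exact: measurable_itv.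
Qed.

Lemma C0_L2 f : C0_01 f -> in_L2 f.
Proof.
by move=> cf; have [M _ fM] := C0_bounded cf; apply: in_L2_bounded fM; exact: C0_meas.
Qed.

Lemma in_L2_mulC0 f h : C0_01 h -> in_L2 f -> in_L2 (fun x => h x * f x).
Proof.
move=> ch /in_L2P[mf If]; have [M M0 hM] := C0_bounded ch; apply/in_L2P.
have mh := C0_meas ch.
split; first exact: measurable_funM.
apply: (@le_integrable01 _ (fun x => M ^+ 2 * f x ^+ 2)).
- by apply: measurable_funX; exact: measurable_funM.
- move=> x Ix /=; rewrite ger0_norm ?sqr_ge0//.
  rewrite exprMn ler_wpM2r ?sqr_ge0//.
  by rewrite -real_normK ?num_real// lerXn2r ?nnegrE ?normr_ge0 ?hM//; exact: ltW.
- exact: integrable01Z.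
Qed.

Lemma in_L2_cst c : in_L2 (fun=> c : R).
Proof. by apply: C0_L2; move=> x; exact: cvg_cst. Qed.

Lemma in_L2Z a f : in_L2 f -> in_L2 (fun x => a * f x).
Proof. by move=> Lf; apply: in_L2_mulC0 => // x; exact: cvg_cst. Qed.

Lemma in_L2D f g : in_L2 f -> in_L2 g -> in_L2 (fun x => f x + g x).
Proof.
move=> Lf Lg; have Ifg := in_L2_mul Lf Lg.
move: Lf Lg => /in_L2P[mf If] /in_L2P[mg Ig]; apply/in_L2P; split.
  exact: measurable_funD.
rewrite (_ : (fun _ => _) = (fun x => (f x ^+ 2 + g x ^+ 2) + 2 * (f x * g x))).
  by apply: integrable01D; [exact: integrable01D|exact: integrable01Z].
by apply/funext => x; ring.
Qed.

Lemma in_L2B f g : in_L2 f -> in_L2 g -> in_L2 (fun x => f x - g x).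
Proof.
move=> Lf Lg; rewrite (_ : (fun _ => _) = (fun x => f x + (-1) * g x)).
  by apply: in_L2D => //; exact: in_L2Z.
by apply/funext => x; rewrite mulN1r.
Qed.

Lemma in_L2_sum (I : Type) (r : seq I) (P : pred I) (F : I -> R -> R) :
  (forall i, P i -> in_L2 (F i)) -> in_L2 (fun x => \sum_(i <- r | P i) F i x).
Proof.
move=> LF; elim: r => [|i r ih].
  by rewrite (_ : (fun _ => _) = fun=> 0); [exact: in_L2_cst|apply/funext => x; rewrite big_nil].
case Pi : (P i); last first.
  by rewrite (_ : (fun _ => _) = fun x => \sum_(i <- r | P i) F i x)//; apply/funext => x;
    rewrite big_cons Pi.
rewrite (_ : (fun _ => _) = fun x => F i x + \sum_(i <- r | P i) F i x).
  by apply: in_L2D => //; exact: LF.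
by apply/funext => x; rewrite big_cons Pi.
Qed.

Lemma eq_ip f1 f2 g1 g2 : (forall x, x \in `[0, 1] -> f1 x * g1 x = f2 x * g2 x) ->
  ip f1 g1 = ip f2 g2.
Proof. by move=> H; apply: eq_Rintegral => x; rewrite inE; exact: H. Qed.

Lemma eq_in_L2 f g : {in `[0, 1], f =1 g} -> in_L2 f -> in_L2 g.
Proof.
move=> fg; rewrite /in_L2 (_ : f \_ _ = g \_ I01)//; apply/funext => x.
rewrite /patch; case: ifPn => //; rewrite inE; exact: fg.
Qed.

Lemma ipC f g : ip f g = ip g f.
Proof. by apply: eq_ip => x _; rewrite mulrC. Qed.

Lemma ipDl f g h : in_L2 f -> in_L2 g -> in_L2 h ->
  ip (fun x => f x + g x) h = ip f h + ip g h.
Proof.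
move=> Lf Lg Lh; rewrite /ip -RintegralD//; try exact: in_L2_mul.
by apply: eq_Rintegral => x _; rewrite mulrDl.
Qed.

Lemma ipZl a f g : in_L2 f -> in_L2 g -> ip (fun x => a * f x) g = a * ip f g.
Proof.
move=> Lf Lg; rewrite /ip -RintegralZl//; try exact: in_L2_mul.
by apply: eq_Rintegral => x _; rewrite mulrA.
Qed.

Lemma ipZr a f g : in_L2 f -> in_L2 g -> ip f (fun x => a * g x) = a * ip f g.
Proof. by move=> Lf Lg; rewrite ipC ipZl// ipC. Qed.

Lemma ipBl f g h : in_L2 f -> in_L2 g -> in_L2 h ->
  ip (fun x => f x - g x) h = ip f h - ip g h.
Proof.
move=> Lf Lg Lh; rewrite /ip -RintegralB//; try exact: in_L2_mul.
by apply: eq_Rintegral => x _; rewrite mulrBl.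
Qed.

Lemma ip_suml (I : Type) (r : seq I) (F : I -> R -> R) g :
  (forall i, in_L2 (F i)) -> in_L2 g ->
  ip (fun x => \sum_(i <- r) F i x) g = \sum_(i <- r) ip (F i) g.
Proof.
move=> LF Lg; elim: r => [|i r ih].
  rewrite big_nil /ip; under eq_Rintegral => x _ do rewrite big_nil mul0r.
  by rewrite Rintegral_cst// mul0r.
rewrite big_cons -ih -ipDl//; last by apply: in_L2_sum.
by congr (ip _ g); apply/funext => x; rewrite big_cons.
Qed.

Lemma ip_ge0 f : 0 <= ip f f.
Proof. by apply: Rintegral_ge0 => x _; rewrite -expr2 sqr_ge0. Qed.

Lemma sqr_L2norm f : L2norm f ^+ 2 = ip f f.
Proof. by rewrite sqr_sqrtr// ip_ge0. Qed.

Lemma L2norm_ge0 f : 0 <= L2norm f.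
Proof. exact: sqrtr_ge0. Qed.

Lemma L2normZ a f : in_L2 f -> L2norm (fun x => a * f x) = `|a| * L2norm f.
Proof.
move=> Lf; rewrite /L2norm ipZl//; last exact: in_L2Z.
by rewrite ipC ipZl// mulrA -expr2 sqrtrM ?sqr_ge0// sqrtr_sqr.
Qed.

Lemma sqr_ip_le f g : in_L2 f -> in_L2 g -> ip f g ^+ 2 <= ip f f * ip g g.
Proof.
move=> Lf Lg.
have H t : 0 <= ip f f - 2 * t * ip f g + t ^+ 2 * ip g g.
  have := ip_ge0 (fun x => f x - t * g x).
  have Ltg := in_L2Z t Lg.
  rewrite ipBl//; last exact: in_L2B.
  rewrite ![ip _ (fun x => f x - _)]ipC !ipBl// [ip f (fun x => t * _)]ipC !ipZl//.
  rewrite [ip g (fun x => t * _)]ipC ipZl// [ip g f]ipC; lra.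
have [g0|g0] := eqVneq (ip g g) 0.
  (* With [ip g g = 0] the quadratic is affine in its parameter, and this value would make it
     [- ip f f - 2], which is negative. *)
  rewrite g0 mulr0; have := H (((ip f f) + 1) / ip f g); rewrite g0 mulr0 addr0.
  have [->|fg0] := eqVneq (ip f g) 0; first by rewrite expr0n.
  rewrite -mulrA mulfVK//; have := ip_ge0 f; lra.
have {}g0 : 0 < ip g g by rewrite lt_neqAle eq_sym g0 ip_ge0.
have := H (ip f g / ip g g).
rewrite -(pmulr_rge0 _ g0).
set a := ip f g; set b := ip g g in g0 *; set c := ip f f.
have -> : b * (c - 2 * (a / b) * a + (a / b) ^+ 2 * b) = c * b - a ^+ 2.
  by field; rewrite gt_eqF.
by rewrite subr_ge0.
Qed.

Lemma normr_ip_le f g : in_L2 f -> in_L2 g -> `|ip f g| <= L2norm f * L2norm g.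
Proof.
move=> Lf Lg; rewrite -(@ler_pXn2r _ 2)//= ?nnegrE ?mulr_ge0 ?L2norm_ge0//.
by rewrite exprMn !sqr_L2norm real_normK ?num_real// sqr_ip_le.
Qed.

Lemma L2normD f g : in_L2 f -> in_L2 g -> L2norm (fun x => f x + g x) <= L2norm f + L2norm g.
Proof.
move=> Lf Lg; rewrite -(@ler_pXn2r _ 2)//= ?nnegrE ?addr_ge0 ?L2norm_ge0//.
rewrite sqr_L2norm ipDl//; last exact: in_L2D.
rewrite ![ip _ (fun x => f x + _)]ipC !ipDl// [ip g f]ipC sqrrD !sqr_L2norm.
have := le_trans (ler_norm _) (normr_ip_le Lf Lg); lra.
Qed.

End L2.

(** * Calculus in H^1(0,1) *)

Section H1.
Context {R : realType}.
Implicit Types f g h u v : R -> R.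
Local Notation mu := (@lebesgue_measure R).
Local Notation I01 := (`[0%R : R, 1%R]%classic).

Lemma integrable_triangle v s : mu.-integrable setT (EFin \o v) ->
  mu.-integrable setT (EFin \o (fun r => v r * (r <= s)%R%:R)).
Proof.
move=> iv; apply: (le_integrable _ _ _ iv) => //.
  apply/measurable_EFinP; apply: measurable_funM.
    by apply/measurable_EFinP; exact: measurable_int iv.
  apply: (measurableT_comp (f := fun b : bool => b%:R : R)) => //.
  by apply: measurable_fun_ler; [exact: measurable_id|exact: measurable_cst].
move=> r _ /=; rewrite lee_fin normrM ler_piMr//.
by case: (r <= s); rewrite ?normr1 ?normr0.
Qed.

Lemma integrable_triangleC u r : mu.-integrable setT (EFin \o u) ->
  mu.-integrable setT (EFin \o (fun s => u s * (r <= s)%R%:R)).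
Proof.
move=> iv; apply: (le_integrable _ _ _ iv) => //.
  apply/measurable_EFinP; apply: measurable_funM.
    by apply/measurable_EFinP; exact: measurable_int iv.
  apply: (measurableT_comp (f := fun b : bool => b%:R : R)) => //.
  by apply: measurable_fun_ler; [exact: measurable_cst|exact: measurable_id].
move=> s _ /=; rewrite lee_fin normrM ler_piMr//.
by case: (r <= s); rewrite ?normr1 ?normr0.
Qed.

(** This is what replaces the classical product rule in [H1_mul], where derivatives exist only in
    L^2. The boolean factor is the indicator of the triangle [r <= s]. *)
Lemma triangle_fubini u v :
  mu.-integrable setT (EFin \o u) -> mu.-integrable setT (EFin \o v) ->
  \int[mu]_s (u s * \int[mu]_r (v r * (r <= s)%R%:R)) =
  \int[mu]_r (v r * \int[mu]_s (u s * (r <= s)%R%:R)).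
Proof.
move=> iu iv.
pose k (z : measurableTypeR R * measurableTypeR R) :=
  (u z.1 * (v z.2 * (z.2 <= z.1)%R%:R))%:E : \bar R.
have mu_ : measurable_fun setT u by apply/measurable_EFinP; exact: measurable_int iu.
have mv_ : measurable_fun setT v by apply/measurable_EFinP; exact: measurable_int iv.
have mnu : measurable_fun setT (EFin \o (fun s => `|u s|)).
  by apply/measurable_EFinP; exact: measurableT_comp.
have mnv : measurable_fun setT (EFin \o (fun s => `|v s|)).
  by apply/measurable_EFinP; exact: measurableT_comp.
have mk : measurable_fun setT k.
  apply/measurable_EFinP; apply: measurable_funM.
    exact: (measurableT_comp mu_ measurable_fst).
  apply: measurable_funM.
    exact: (measurableT_comp mv_ measurable_snd).
  apply: (measurableT_comp (f := fun b : bool => b%:R : R)) => //.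
  by apply: measurable_fun_ler; [exact: measurable_snd|exact: measurable_fst].
(* The kernel is dominated by [|u s| |v r|], whose iterated integral is a product of two finite
   integrals. *)
have ik : (mu \x mu)%E.-integrable setT k.
  apply/integrable12ltyP => //.
  have /integrableP[_ lu] := iu; have /integrableP[_ lv] := iv.
  set Cv := (\int[mu]_r `|v r|%:E)%E.
  have Cvlt : (Cv < +oo)%E by [].
  have Cv0 : (0 <= Cv)%E by apply: integral_ge0 => r _; rewrite lee_fin.
  apply: (@le_lt_trans _ _ (\int[mu]_s (`|u s|%:E * Cv))%E).
    apply: ge0_le_integral => //.
    - by move=> s _; apply: integral_ge0.
    - apply: (measurable_fun_fubini_tonelli_F (abse \o k)) => //=.
      exact: measurableT_comp.
    - exact: (emeasurable_funM mnu (measurable_cst _)).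
    - move=> s _; rewrite -ge0_integralZl//.
      apply: ge0_le_integral => //.
      + apply: measurableT_comp => //.
        exact: (measurableT_comp mk (pair1_measurable s)).
      + exact: (emeasurable_funM (measurable_cst _) mnv).
      + move=> r _ /=; rewrite -EFinM lee_fin normrM ler_wpM2l// normrM ler_piMr//.
        by case: (r <= s); rewrite ?normr1 ?normr0.
  rewrite ge0_integralZr// lte_mul_pinfty//; first exact: integral_ge0.
  by rewrite ge0_fin_numE ?integral_ge0.
have := integral12_prod_meas1 ik; rewrite -(integral21_prod_meas1 ik) => E.
rewrite /Rintegral; congr fine; transitivity (\int[mu]_x fubini_F mu k x)%E.
  apply: eq_integral => s _; rewrite /fubini_F /k /= EFinM.
  under [in RHS]eq_integral do rewrite EFinM.
  rewrite integralZl//; last exact: (integrable_triangle s iv).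
  by rewrite fineK//; apply: integrable_fin_num => //; exact: (integrable_triangle s iv).
rewrite E; apply: eq_integral => r _; rewrite /fubini_G /k /= EFinM.
transitivity (\int[mu]_x ((v r)%:E * (u x * (r <= x)%R%:R)%:E))%E.
  by apply: eq_integral => s _; rewrite -EFinM; congr EFin; ring.
rewrite integralZl//; last exact: (integrable_triangleC r iu).
by rewrite fineK//; apply: integrable_fin_num => //; exact: (integrable_triangleC r iu).
Qed.

Lemma in_L2_int f : in_L2 f -> mu.-integrable I01 (EFin \o f).
Proof.
move=> Lf; have := in_L2_mul Lf (in_L2_cst 1).
by rewrite (_ : (fun _ => _) = f)//; apply/funext => x; rewrite mulr1.
Qed.

Lemma integrable_sub01 f x : x \in `[0, 1] -> mu.-integrable I01 (EFin \o f) ->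
  mu.-integrable `[0, x] (EFin \o f).
Proof.
rewrite in_itv/= => /andP[_ x1]; apply: integrableS => //.
by apply: subset_itvl; rewrite bnd_simp.
Qed.

Lemma H1_C0 f g : H1_deriv f g -> C0_01 f.
Proof.
move=> [Lg fE]; have Ig := in_L2_int Lg.
have cI := parameterized_integral_continuous ler01 Ig.
have : {within I01, continuous (fun x => f 0 + \int[mu]_(s in `[0, x]) g s)}.
  by move=> x; apply: cvgD; [exact: cvg_cst|exact: cI].
apply: subspace_eq_continuous => x; rewrite inE => Ix.
by rewrite /from_subspace -fE.
Qed.

Lemma H1_L2 f g : H1_deriv f g -> in_L2 f.
Proof. by move=> /H1_C0 /C0_L2. Qed.

Lemma H1_int f g : H1_deriv f g -> \int[mu]_(x in I01) g x = f 1 - f 0.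
Proof.
by move=> [_ fE]; rewrite [f 1]fE ?in_itv/= ?ler01 ?lexx// addrAC subrr add0r.
Qed.

(** Integration by parts for weak derivatives, obtained from Fubini on the triangle below the
    diagonal of [[0, x] x [0, x]]. *)
Lemma H1_mul f g f' g' : H1_deriv f f' -> H1_deriv g g' ->
  H1_deriv (fun x => f x * g x) (fun x => f' x * g x + f x * g' x).
Proof.
move=> Hf Hg; have [Lf' fE] := Hf; have [Lg' gE] := Hg.
have cf := H1_C0 Hf; have cg := H1_C0 Hg.
have Lfg' : in_L2 (fun x => f x * g' x) by exact: in_L2_mulC0.
have Lf'g : in_L2 (fun x => f' x * g x).
  by rewrite (_ : (fun _ => _) = (fun x => g x * f' x));
    [exact: in_L2_mulC0|apply/funext => x; rewrite mulrC].
split; first exact: in_L2D.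
move=> x Ix; have [x0 x1] : 0 <= x /\ x <= 1 by move: Ix; rewrite in_itv/= => /andP.
have If' := integrable_sub01 Ix (in_L2_int Lf').
have Ig' := integrable_sub01 Ix (in_L2_int Lg').
have in01 s : s \in `[0, x] -> s \in `[0, 1].
  by rewrite !in_itv/= => /andP[-> sx]; exact: le_trans sx x1.
pose u := f' \_ `[0, x]; pose v := g' \_ `[0, x].
have iu : mu.-integrable setT (EFin \o u).
  by rewrite -restrict_EFin; apply/integrable_restrict => //=; rewrite setTI.
have iv : mu.-integrable setT (EFin \o v).
  by rewrite -restrict_EFin; apply/integrable_restrict => //=; rewrite setTI.
have uE s : u s = if s \in `[0, x] then f' s else 0.
  by rewrite /u /patch; have [|] := boolP (s \in `[0, x]) => H;
    [rewrite mem_set|rewrite memNset//; exact/negP].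
have vE s : v s = if s \in `[0, x] then g' s else 0.
  by rewrite /v /patch; have [|] := boolP (s \in `[0, x]) => H;
    [rewrite mem_set|rewrite memNset//; exact/negP].
(* The left side is the integral of [f' (g - g 0)] over [[0, x]], the right side that of
   [g' (f x - f)]. *)
have := triangle_fubini iu iv.
have -> : \int[mu]_s (u s * \int[mu]_r (v r * (r <= s)%R%:R)) =
          \int[mu]_(s in `[0, x]) (f' s * g s - f' s * g 0).
  rewrite [RHS]Rintegral_mkcond; apply: eq_Rintegral => s _.
  rewrite uE /patch; have [sI|sI] := boolP (s \in `[0, x]); last first.
    by rewrite mul0r memNset//; exact/negP.
  rewrite mem_set// -mulrBr; congr (_ * _).
  rewrite [g s]gE ?in01// addrAC subrr add0r [RHS]Rintegral_mkcond.
  apply: eq_Rintegral => r _; rewrite vE /patch.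
  have [s0 sx] : 0 <= s /\ s <= x by move: sI; rewrite in_itv/= => /andP.
  have [rI|rI] := boolP (r \in `[0, x]); last first.
    rewrite mul0r memNset//= in_itv/= => /andP[r0 rs].
    by move/negP : rI; apply; rewrite in_itv/= r0 (le_trans rs).
  move: rI; rewrite in_itv/= => /andP[r0 rx].
  have [rs|rs] := leP r s; first by rewrite mulr1 mem_set//= in_itv/= r0.
  by rewrite mulr0 memNset//= in_itv/= r0 leNgt rs.
have -> : \int[mu]_r (v r * \int[mu]_s (u s * (r <= s)%R%:R)) =
          \int[mu]_(s in `[0, x]) (g' s * f x - f s * g' s).
  rewrite [RHS]Rintegral_mkcond; apply: eq_Rintegral => r _.
  rewrite vE /patch; have [rI|rI] := boolP (r \in `[0, x]); last first.
    by rewrite mul0r memNset//; exact/negP.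
  rewrite mem_set// [f r * _]mulrC -mulrBr; congr (_ * _).
  have [r0 rx] : 0 <= r /\ r <= x by move: rI; rewrite in_itv/= => /andP.
  transitivity (\int[mu]_(s in `[r, x]) f' s).
    rewrite [RHS]Rintegral_mkcond; apply: eq_Rintegral => s _; rewrite uE /patch.
    have [sI|sI] := boolP (s \in `[0, x]); last first.
      rewrite mul0r memNset//= in_itv/= => /andP[rs sx].
      by move/negP : sI; apply; rewrite in_itv/= (le_trans r0 rs).
    move: sI; rewrite in_itv/= => /andP[s0 sx].
    have [rs|rs] := leP r s; first by rewrite mulr1 mem_set//= in_itv/= rs.
    by rewrite mulr0 memNset//= in_itv/= leNgt rs.
  rewrite [f x]fE// [f r]fE ?in01// opprD addrACA subrr add0r.
  rewrite (@Rintegral_itvB _ f' (BLeft 0) (BRight x) r)//.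
  rewrite Rintegral_itv_obnd_cbnd//.
  by apply: integrableS If' => //; apply: subset_itv; rewrite bnd_simp.
have If'g := integrable_sub01 Ix (in_L2_int Lf'g).
have Ifg' := integrable_sub01 Ix (in_L2_int Lfg').
have Zr k c : mu.-integrable `[0, x] (EFin \o k) ->
    mu.-integrable `[0, x] (EFin \o (fun s => k s * c)).
  move=> Ik; apply: eq_integrable (integrableZl _ c Ik) => //= s _.
  by rewrite -EFinM mulrC.
rewrite !RintegralB//; try exact: Zr.
rewrite !RintegralZr// RintegralD//.
have -> : \int[mu]_(s in `[0, x]) f' s = f x - f 0 by rewrite fE//; ring.
have -> : \int[mu]_(s in `[0, x]) g' s = g x - g 0 by rewrite gE//; ring.
lra.
Qed.

Lemma H1D f g f' g' : H1_deriv f f' -> H1_deriv g g' ->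
  H1_deriv (fun x => f x + g x) (fun x => f' x + g' x).
Proof.
move=> [Lf fE] [Lg gE]; split; first exact: in_L2D.
move=> x Ix; rewrite RintegralD//; try exact: integrable_sub01 (in_L2_int _).
rewrite [in LHS]fE// [in LHS]gE//; ring.
Qed.

Lemma H1Z c f f' : H1_deriv f f' -> H1_deriv (fun x => c * f x) (fun x => c * f' x).
Proof.
move=> [Lf fE]; split; first exact: in_L2Z.
move=> x Ix; rewrite RintegralZl//; try exact: integrable_sub01 (in_L2_int _).
rewrite [in LHS]fE//; ring.
Qed.

Lemma H1_cst c : H1_deriv (fun=> c : R) (fun=> 0).
Proof.
by split; [exact: in_L2_cst|move=> x _; rewrite Rintegral_cst// mul0r addr0].
Qed.

Lemma H1B f g f' g' : H1_deriv f f' -> H1_deriv g g' ->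
  H1_deriv (fun x => f x - g x) (fun x => f' x - g' x).
Proof.
move=> Hf Hg; have := H1D Hf (H1Z (-1) Hg).
by under eq_fun do rewrite mulN1r; under [X in H1_deriv _ X]eq_fun do rewrite mulN1r.
Qed.

Lemma H1_id : H1_deriv (fun x => x : R) (fun=> 1).
Proof.
split; first exact: in_L2_cst.
move=> x; rewrite in_itv/= => /andP[x0 x1].
by rewrite Rintegral_cst//= lebesgue_measure_itv/= lte_fin add0r mul1r; case: ltP => //= ;
  rewrite ?subr0// => x0'; apply/eqP; rewrite eq_le x0 x0'.
Qed.

Lemma eq_H1 f g f' g' : {in `[0, 1], f =1 g} -> {in `[0, 1], f' =1 g'} ->
  H1_deriv f f' -> H1_deriv g g'.
Proof.
move=> fg fg' [Lf fE]; split; first exact: eq_in_L2 Lf.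
move=> x Ix; rewrite -!fg//; last by rewrite in_itv/= lexx ler01.
rewrite fE//; congr (_ + _); apply: eq_Rintegral => s; rewrite inE/= => Is; apply: fg'.
move: Is Ix; rewrite !in_itv/= => /andP[-> sx] /andP[_]; exact: le_trans.
Qed.

Lemma derivable01P f (x : R) : derivable01 f x -> forall e : R, 0 < e ->
  exists2 d, 0 < d & forall y, y \in `[0, 1] -> y != x -> `|y - x| < d ->
    `|dquot01 f x y - der01 f x| < e.
Proof.
move=> dfx e e0; have /cvgrPdist_lt /(_ e e0) : dquot01 f x y @[y --> within `[0, 1] x^'] -->
  der01 f x by exact: dfx.
move=> /nbhs_ballP[d /= d0 H]; exists d => //.
move=> y Iy yx yd; rewrite distrC; apply: H => //.
by rewrite /ball/= distrC.
Qed.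

Lemma C1_der1 (p : R -> R) (x : R) : C1_01 p -> x \in `]0, 1[ -> is_derive x 1 p (der01 p x).
Proof.
move=> [dp _]; rewrite in_itv/= => /andP[x0 x1].
have /(_ x) := dp; rewrite in_itv/= (ltW x0) (ltW x1) => /(_ isT) dpx.
suff H : (h^-1 *: ((p \o shift x) (h *: 1) - p x)) @[h --> 0^'] --> der01 p x.
  by apply: DeriveDef; [exact: cvgP H|exact: cvg_lim H].
apply/cvgrPdist_lt => e e0; have [d d0 H] := derivable01P dpx e0.
near=> h.
have h0 : h != 0 by near: h; exact: nbhs_dnbhs_neq.
have hd : `|h| < d by near: h; exact: dnbhs0_lt.
have hx : `|h| < x by near: h; exact: dnbhs0_lt.
have hx1 : `|h| < 1 - x by near: h; apply: dnbhs0_lt; rewrite subr_gt0.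
have := H (h + x); rewrite /dquot01 addrK => /(_ _ _ hd).
rewrite distrC /= /shift /= [h *: 1]mulr1 [_ *: _]mulrC; apply.
- have := ler_norm h; have := ler_norm (- h); rewrite normrN in_itv/= => ? ?.
  by apply/andP; split; lra.
- by rewrite -subr_eq0 addrK.
Unshelve. all: by end_near. Qed.

Lemma C1_C0 (p : R -> R) : C1_01 p -> C0_01 p.
Proof.
move=> [dp _]; apply/subspace_continuousP => x Ix.
apply/cvgrPdist_lt => e e0; have [d d0 H] := derivable01P (dp x Ix) ltr01.
set C := `|der01 p x| + 1.
have C0 : 0 < C by rewrite ltr_wpDl.
rewrite near_withinE.
near=> y => Iy.
have [->|yx] := eqVneq y x; first by rewrite subrr normr0.
have yd : `|y - x| < d by rewrite distrC; near: y; apply: nbhsx_ballx.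
have ye : `|y - x| < e / C by rewrite distrC; near: y; apply: nbhsx_ballx; rewrite divr_gt0.
rewrite distrC -[_ - _](@mulfVK _ (y - x)) ?subr_eq0// normrM.
have := H y Iy yx yd; rewrite /dquot01 => H1.
have H2 : `|(p y - p x) / (y - x)| < C.
  rewrite -[X in `|X|](subrK (der01 p x)) (le_lt_trans (ler_normD _ _))//.
  by rewrite addrC ltrD2l.
rewrite (lt_le_trans (_ : _ < C * (e / C)))//; last by rewrite mulrC divfK ?gt_eqF.
by rewrite ltr_pM.
Unshelve. all: by end_near. Qed.

Lemma C1_H1 (p : R -> R) : C1_01 p -> H1_deriv p (der01 p).
Proof.
move=> C1p; have [dp cp] := C1p; have cp0 := C1_C0 C1p; split; first exact: C0_L2.
move=> x; rewrite in_itv/= => /andP[]; rewrite le_eqVlt => /predU1P[<- _|x0 x1].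
  by rewrite set_itv1 Rintegral_set1 addr0.
have sub : `[0, x] `<=` I01 by apply: subset_itvl; rewrite bnd_simp.
have H := @continuous_FTC2 _ (der01 p) p 0 x x0.
rewrite /Rintegral H//.
- by rewrite -EFinB/= addrC subrK.
- exact: continuous_subspaceW cp.
- have [] := (continuous_within_itvP p x0).1 (continuous_subspaceW sub cp0).
  move=> _ pL' pR'; split=> // y; rewrite in_itv/= => /andP[y0 yx].
  have : y \in `]0, 1[ by rewrite in_itv/= y0 (lt_le_trans yx).
  by move=> /(C1_der1 C1p)[].
- move=> y; rewrite in_itv/= => /andP[y0 yx]; rewrite derive1E.
  have : y \in `]0, 1[ by rewrite in_itv/= y0 (lt_le_trans yx).
  by move=> /(C1_der1 C1p)[_ ->].
Qed.

End H1.

(** * Expansions in a Hilbert basis *)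

Section HilbertBasis.
Context {R : realType} (phi : nat -> R -> R).
Hypothesis hb : hilbert_basis phi.
Implicit Types f g : R -> R.

Definition partial_sum f m : R -> R := fun x => \sum_(n < m) ip f (phi n) * phi n x.

Lemma basis_L2 n : in_L2 (phi n). Proof. by case: hb. Qed.
Lemma basis_orth m n : ip (phi m) (phi n) = (m == n)%:R. Proof. by case: hb. Qed.

Lemma partial_sum_L2 f m : in_L2 (partial_sum f m).
Proof. by apply: in_L2_sum => n _; apply: in_L2Z; exact: basis_L2. Qed.

Lemma ip_partial_sum f g m : in_L2 g ->
  ip (partial_sum f m) g = \sum_(n < m) ip f (phi n) * ip g (phi n).
Proof.
move=> Lg; rewrite ip_suml//; last by move=> i; apply: in_L2Z; exact: basis_L2.
by apply: eq_bigr => n _; rewrite ipZl//; [congr (_ * _); rewrite ipC|exact: basis_L2].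
Qed.

Lemma ip_partial_sum_phi f k m :
  ip (partial_sum f m) (phi k) = if (k < m)%N then ip f (phi k) else 0.
Proof.
rewrite ip_partial_sum; last exact: basis_L2.
case: ifPn => [km|]; last first.
  rewrite -leqNgt => mk; rewrite big1// => i _; rewrite basis_orth.
  by rewrite gtn_eqF ?mulr0// (leq_trans _ mk).
rewrite (bigD1 (Ordinal km))//= big1 ?addr0 ?basis_orth ?eqxx ?mulr1// => i /eqP ik.
rewrite basis_orth; case: eqP; rewrite ?mulr0// => ki.
by case: ik; apply/val_inj; rewrite /= ki.
Qed.

Lemma ip_residual f m : in_L2 f ->
  ip (fun x => f x - partial_sum f m x) (fun x => f x - partial_sum f m x) =
  ip f f - \sum_(n < m) ip f (phi n) ^+ 2.
Proof.
move=> Lf; have LS := partial_sum_L2 f m.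
rewrite ipBl//; last exact: in_L2B.
rewrite ![ip _ (fun x => f x - _)]ipC !ipBl// [ip f (partial_sum _ _)]ipC.
rewrite !ip_partial_sum//.
have -> : \sum_(n < m) ip f (phi n) * ip (partial_sum f m) (phi n) =
   \sum_(n < m) ip f (phi n) * ip f (phi n).
  by apply: eq_bigr => n _; rewrite ip_partial_sum_phi ltn_ord.
under [in RHS]eq_bigr do rewrite expr2.
by rewrite subrr subr0.
Qed.

Lemma bessel f m : in_L2 f -> \sum_(n < m) ip f (phi n) ^+ 2 <= ip f f.
Proof. by move=> Lf; rewrite -subr_ge0 -ip_residual// ip_ge0. Qed.

Lemma partial_sum_cvg f : in_L2 f ->
  (fun m => L2norm (fun x => f x - partial_sum f m x)) @ \oo --> (0 : R).
Proof.
move=> Lf; case: hb => _ _ /(_ f Lf)[_].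
suff -> : (fun m : nat => L2norm (fun x => \sum_(n < m) ip f (phi n) * phi n x - f x)) =
  (fun m => L2norm (fun x => f x - partial_sum f m x)) by [].
apply/funext => m; congr (Num.sqrt _); apply: eq_ip => x _.
by rewrite -[LHS]mulrNN !opprB.
Qed.

Lemma parseval f g : in_L2 f -> in_L2 g ->
  (fun m => \sum_(n < m) ip f (phi n) * ip g (phi n)) @ \oo --> ip f g.
Proof.
move=> Lf Lg; apply/cvgrPdist_le => e e0.
have /cvgrPdist_lt /(_ (e / (L2norm g + 1))) := partial_sum_cvg Lf.
have g0 : 0 < L2norm g + 1 by rewrite ltr_wpDl ?L2norm_ge0.
move=> /(_ (divr_gt0 e0 g0)); apply: filterS => m.
rewrite sub0r normrN ger0_norm ?L2norm_ge0// => H.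
rewrite -ip_partial_sum// -ipBl//; last exact: partial_sum_L2.
apply: (le_trans (normr_ip_le (in_L2B Lf (partial_sum_L2 f m)) Lg)).
apply: (@le_trans _ _ (e / (L2norm g + 1) * (L2norm g + 1))).
  by rewrite ler_pM ?L2norm_ge0 ?ltW// ltrDl.
by rewrite divfK ?gt_eqF.
Unshelve. all: by end_near. Qed.

Lemma parseval_sqr f : in_L2 f ->
  (fun m => \sum_(n < m) ip f (phi n) ^+ 2) @ \oo --> ip f f.
Proof. by move=> Lf; under eq_fun do under eq_bigr do rewrite expr2; exact: parseval. Qed.

(** [remainder] is an arbitrarily chosen L^2 limit, so it is known only up to functions of norm 0.
    The explicit limit [g = f - partial_sum f N] is compared with it: both are limits of the same
    sums, hence have the same norm. *)
Lemma L2norm_remainder N f : in_L2 f ->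
  L2norm (remainder phi N f) ^+ 2 = ip f f - \sum_(n < N) ip f (phi n) ^+ 2.
Proof.
move=> Lf; pose g x := f x - partial_sum f N x.
have Lg : in_L2 g by apply: in_L2B => //; exact: partial_sum_L2.
rewrite -ip_residual// -sqr_L2norm; congr (_ ^+ 2).
pose S m x := \sum_(n < m) ip f (phi (N + n)%N) * phi (N + n)%N x.
have LS m : in_L2 (S m) by apply: in_L2_sum => n _; apply: in_L2Z; exact: basis_L2.
have Sg m : (fun x => S m x - g x) = (fun x => (-1) * (f x - partial_sum f (N + m) x)).
  by apply/funext => x; rewrite /S /g /partial_sum big_split_ord/=; ring.
have Hg : is_L2sum (fun n x => ip f (phi (N + n)%N) * phi (N + n)%N x) g.
  split=> //.
  have := partial_sum_cvg Lf; rewrite -(cvg_shiftn N) => H.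
  apply: cvg_trans H; apply: near_eq_cvg; near=> m.
  rewrite -/(S m) (_ : (fun x => _) = (fun x => S m x - g x))// Sg L2normZ.
    by rewrite normrN1 mul1r addnC.
  by apply: in_L2B => //; exact: partial_sum_L2.
have [Lr Hr] : is_L2sum (fun n x => ip f (phi (N + n)%N) * phi (N + n)%N x) (remainder phi N f).
  by rewrite /remainder /L2sum; apply: (@xgetPex _ _ (is_L2sum _)); exists g.
set r := remainder phi N f in Lr Hr *.
have Lrg : in_L2 (fun x => r x - g x) by exact: in_L2B.
have rg0 : L2norm (fun x => r x - g x) = 0.
  have H : ((fun m => L2norm (fun x => S m x - g x) + L2norm (fun x => S m x - r x)) @ \oo -->
    (0 : R)).
    by rewrite -[X in _ --> X]addr0; apply: cvgD; [exact: (proj2 Hg)|exact: Hr].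
  apply/eqP; rewrite eq_le L2norm_ge0 andbT.
  apply: (cvgr_to_ge H); near=> m.
  rewrite [X in X <= _](_ : _ = L2norm (fun x => (S m x - g x) + (-1) * (S m x - r x))).
    have LSr : in_L2 (fun x => S m x - r x) by exact: in_L2B.
    apply: le_trans (L2normD _ _) _; first exact: in_L2B.
      exact: in_L2Z.
    by rewrite L2normZ// normrN1 mul1r.
  by congr L2norm; apply/funext => x; ring.
apply/eqP; rewrite eq_le; apply/andP; split.
  rewrite -[leRHS]addr0 -rg0 [leLHS](_ : _ = L2norm (fun x => g x + (r x - g x)));
    first exact: L2normD.
  by congr L2norm; apply/funext => x; ring.
rewrite -[leRHS]addr0 -rg0 [leLHS](_ : _ = L2norm (fun x => r x + (-1) * (r x - g x))).
  by rewrite (le_trans (L2normD _ _))//; [exact: in_L2Z|rewrite L2normZ// normrN1 mul1r].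
by congr L2norm; apply/funext => x; rewrite /g; ring.
Unshelve. all: by end_near. Qed.

End HilbertBasis.

(** * Sturm-Liouville operators *)

Section Sobolev.
Context {R : realType}.
Implicit Types f : R -> R.
Local Notation mu := (@lebesgue_measure R).
Local Notation I01 := (`[0%R : R, 1%R]%classic).

(** Integrate the derivative of [(1 - x) f^2]; the weight removes the value at 1 and only shrinks
    the L^2 norm. *)
Lemma trace0_le f f' : H1_deriv f f' ->
  f 0 ^+ 2 <= ip f f + 2 * (L2norm f * L2norm f').
Proof.
move=> Hf; have Lf := H1_L2 Hf; have Lf' : in_L2 f' by case: Hf.
have H1x : H1_deriv (fun x : R => 1 - x) (fun=> 0 - 1) by apply: H1B; [exact: H1_cst|exact: H1_id].
have := H1_int (H1_mul H1x (H1_mul Hf Hf)).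
have Lg : in_L2 (fun x => (1 - x) * f x) by apply: in_L2_mulC0 Lf; exact: H1_C0 H1x.
have -> : \int[mu]_(x in I01) ((0 - 1) * (f x * f x) + (1 - x) * (f' x * f x + f x * f' x)) =
   \int[mu]_(x in I01) ((-1) * (f x * f x) + 2 * ((1 - x) * f x * f' x)).
  by apply: eq_Rintegral => x _; ring.
rewrite subrr mul0r subr0 mul1r sub0r -expr2.
rewrite RintegralD//; try by apply: integrable01Z; exact: in_L2_mul.
rewrite !RintegralZl//; try exact: in_L2_mul.
rewrite -/(ip f f) -/(ip (fun x => (1 - x) * f x) f') => E.
have H1 := normr_ip_le Lg Lf'.
have H2 : L2norm (fun x => (1 - x) * f x) <= L2norm f.
  rewrite ler_sqrt ?ip_ge0//; apply: le_Rintegral => //; try exact: in_L2_mul.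
  move=> x; rewrite /= in_itv/= => /andP[x0 x1]; rewrite -!expr2 exprMn ler_piMl ?sqr_ge0//.
  by rewrite expr_le1 ?subr_ge0// gerBl.
have H3 : L2norm (fun x => (1 - x) * f x) * L2norm f' <= L2norm f * L2norm f'.
  by rewrite ler_wpM2r// L2norm_ge0.
have := ler_norm (- ip (fun x => (1 - x) * f x) f'); rewrite normrN; lra.
Qed.

End Sobolev.

Lemma cos_sin_ge0 (R : realType) (t : R) :
  0 <= t <= pi / 2 -> 0 <= cos t /\ 0 <= sin t.
Proof.
move=> /andP[t0 t1]; have := pi_gt0 R; split.
  by apply: cos_ge0_pihalf; rewrite t1 andbT; lra.
by apply: sin_ge0_pi; rewrite t0/=; lra.
Qed.

Section SturmLiouvilleTheory.
Context {R : realType} (p q : R -> R) (theta1 theta2 : R).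
Implicit Types f g : R -> R.
Local Notation mu := (@lebesgue_measure R).
Local Notation I01 := (`[0%R : R, 1%R]%classic).

(* [f'] and [g] are explicit, so that these data are stable under linear
   combinations without computing any [der01]. *)
Definition sl_data (r : R) f f' g :=
  [/\ H1_deriv f f', H1_deriv (fun x => p x * f' x) (fun x => q x * f x - g x),
      cos theta1 * f 0 - sin theta1 * f' 0 = 0 &
      cos theta2 * f 1 + sin theta2 * f' 1 = r].

Lemma sl_op_data f g : sl_op p q theta1 theta2 f g -> sl_data 0 f (der01 f) g.
Proof. by case=> -[h [Hf _]] lf rf Hp; split. Qed.

Lemma sl_dataD r s f f' g h h' k : sl_data r f f' g -> sl_data s h h' k ->
  sl_data (r + s) (fun x => f x + h x) (fun x => f' x + h' x) (fun x => g x + k x).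
Proof.
move=> [Hf Hpf lf rf] [Hh Hph lh rh]; split.
- exact: H1D.
- by apply: eq_H1 (H1D Hpf Hph) => x _ /=; ring.
- lra.
- lra.
Qed.

Lemma sl_dataZ c r f f' g : sl_data r f f' g ->
  sl_data (c * r) (fun x => c * f x) (fun x => c * f' x) (fun x => c * g x).
Proof.
move=> [Hf Hpf lf rf]; split.
- exact: H1Z.
- by apply: eq_H1 (H1Z c Hpf) => x _ /=; ring.
- by transitivity (c * (cos theta1 * f 0 - sin theta1 * f' 0)); [ring|rewrite lf mulr0].
- by rewrite -rf; ring.
Qed.

Lemma sl_data_sum (I : Type) (r : seq I) (F F' G : I -> R -> R) :
  (forall i, sl_data 0 (F i) (F' i) (G i)) ->
  sl_data 0 (fun x => \sum_(i <- r) F i x) (fun x => \sum_(i <- r) F' i x)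
    (fun x => \sum_(i <- r) G i x).
Proof.
move=> HF; elim: r => [|i r ih].
  suff E (K : I -> R -> R) : (fun x => \sum_(j <- [::]) K j x) = (fun=> 0).
    rewrite !E; split; rewrite ?mulr0 ?subr0 ?addr0//; first exact: H1_cst.
    by apply: eq_H1 (H1_cst 0) => x _ /=; rewrite ?mulr0 ?subr0.
  by apply/funext => x; rewrite big_nil.
have := sl_dataD (HF i) ih; rewrite addr0.
suff E (K : I -> R -> R) : (fun x => \sum_(j <- i :: r) K j x) =
  (fun x => K i x + \sum_(j <- r) K j x) by rewrite !E.
by apply/funext => x; rewrite big_cons.
Qed.

Lemma sl_dataB f f' g h h' k : sl_data 0 f f' g -> sl_data 0 h h' k ->
  sl_data 0 (fun x => f x - h x) (fun x => f' x - h' x) (fun x => g x - k x).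
Proof.
move=> Hf Hh; have := sl_dataD Hf (sl_dataZ (-1) Hh); rewrite mulr0 addr0.
suff E (u v : R -> R) : (fun x => u x + -1 * v x) = (fun x => u x - v x) by rewrite !E.
by apply/funext => x; rewrite mulN1r.
Qed.

Hypothesis (hq : C0_01 q).

Lemma sl_data_L2 r f f' g : sl_data r f f' g -> in_L2 g.
Proof.
move=> [Hf [Lqg _] _ _].
have := in_L2B (in_L2_mulC0 hq (H1_L2 Hf)) Lqg.
by apply: eq_in_L2 => x _ /=; ring.
Qed.

(** Coordinate of the boundary data at 1 along the direction that the homogeneous right condition
    leaves free: under that condition [f 1 = sin theta2 * kappa] and [f' 1 = - cos theta2 * kappa].
    For [f = phi n], [p 1 * kappa] is the boundary expression of [beta_n]. *)
Definition kappa (f f' : R -> R) := sin theta2 * f 1 - cos theta2 * f' 1.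

(** Green's formula: integrate the derivative of [(p f') h - f (p h')]. The two left conditions
    cancel the contribution of 0; at 1 only the datum [r] survives. *)
Lemma sl_lagrange r f f' g h h' k : sl_data r f f' g -> sl_data 0 h h' k ->
  ip g h = ip f k - p 1 * kappa h h' * r.
Proof.
move=> Df Dh; have Lg := sl_data_L2 Df; have Lk := sl_data_L2 Dh.
move: Df Dh => [Hf Hpf lf rf] [Hh Hph lh rh].
have Lf := H1_L2 Hf; have Lh := H1_L2 Hh.
have := H1_int (H1B (H1_mul Hpf Hh) (H1_mul Hf Hph)).
have -> : \int[mu]_(x in I01) ((q x * f x - g x) * h x + p x * f' x * h' x -
      (f' x * (p x * h' x) + f x * (q x * h x - k x))) =
  \int[mu]_(x in I01) (f x * k x - g x * h x).
  by apply: eq_Rintegral => x _; ring.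
rewrite RintegralB//; try exact: in_L2_mul.
rewrite -/(ip f k) -/(ip g h) => E.
have {}E : ip f k - ip g h = p 1 * (f' 1 * h 1 - f 1 * h' 1) - p 0 * (f' 0 * h 0 - f 0 * h' 0).
  by rewrite E; ring.
(* Multiplying by [cos^2 + sin^2 = 1] avoids dividing by a cosine or a sine that may vanish. The
   same device is used at 1. *)
have E0 : f' 0 * h 0 - f 0 * h' 0 = 0.
  have e1 := cos2Dsin2 theta1.
  have c1 : cos theta1 * f 0 = sin theta1 * f' 0 by apply/eqP; rewrite -subr_eq0 lf.
  have c2 : cos theta1 * h 0 = sin theta1 * h' 0 by apply/eqP; rewrite -subr_eq0 lh.
  transitivity ((cos theta1 ^+ 2 + sin theta1 ^+ 2) * (f' 0 * h 0 - f 0 * h' 0)).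
    by rewrite e1 mul1r.
  transitivity ((cos theta1 * f' 0 * (cos theta1 * h 0) - cos theta1 * h' 0 * (cos theta1 * f 0))
    + (sin theta1 * h 0 * (sin theta1 * f' 0) - sin theta1 * f 0 * (sin theta1 * h' 0)));
      first by ring.
  have -> : cos theta1 * f' 0 * (cos theta1 * h 0) - cos theta1 * h' 0 * (cos theta1 * f 0) = 0.
    by rewrite c1 c2; ring.
  by rewrite -c1 -c2; ring.
have E1 : f' 1 * h 1 - f 1 * h' 1 = kappa h h' * r.
  have e1 := cos2Dsin2 theta2.
  have c2 : sin theta2 * h' 1 = - (cos theta2 * h 1) by apply/eqP; rewrite -addr_eq0 addrC rh.
  have k1 : h 1 = sin theta2 * kappa h h'.
    transitivity (sin theta2 ^+ 2 * h 1 - cos theta2 * (sin theta2 * h' 1));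
      last by rewrite /kappa; ring.
    by rewrite c2; transitivity ((cos theta2 ^+ 2 + sin theta2 ^+ 2) * h 1);
      [rewrite e1 mul1r|ring].
  have k2 : h' 1 = - (cos theta2 * kappa h h').
    transitivity (cos theta2 ^+ 2 * h' 1 + sin theta2 * - (cos theta2 * h 1));
      last by rewrite /kappa; ring.
    by rewrite -c2; transitivity ((cos theta2 ^+ 2 + sin theta2 ^+ 2) * h' 1);
      [rewrite e1 mul1r|ring].
  rewrite {1}k1 {1}k2 -rf; ring.
move: E; rewrite E0 E1; lra.
Qed.

Hypothesis (hp : C1_01 p) (hp_gt0 : forall x, x \in `[0, 1] -> 0 < p x).
Hypothesis (hq_gt0 : forall x, x \in `[0, 1] -> 0 < q x).
Hypothesis (htheta1 : 0 < theta1 <= pi / 2) (htheta2 : 0 <= theta2 <= pi / 2).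

Lemma p_lower : exists2 c, 0 < c & forall x, x \in `[0, 1] -> c <= p x.
Proof.
have [c cI cP] := EVT_min ler01 (C1_C0 hp).
by exists (p c); [exact: hp_gt0|exact: cP].
Qed.

(** Test the equation with [f] itself. The term in [q] is nonnegative, and the range of the angles
    gives both boundary terms the favourable sign. *)
Lemma energy (c : R) f f' g : (forall x, x \in `[0, 1] -> c <= p x) -> sl_data 0 f f' g ->
  c * ip f' f' <= ip g f.
Proof.
move=> cP Df; have Lg := sl_data_L2 Df.
move: Df => [Hf Hpf lf rf].
have Lf := H1_L2 Hf; have Lf' : in_L2 f' by case: Hf.
have Lqf := in_L2_mulC0 hq Lf; have Lpf := in_L2_mulC0 (C1_C0 hp) Lf'.
have := H1_int (H1_mul Hpf Hf).
have -> : \int[mu]_(x in I01) ((q x * f x - g x) * f x + p x * f' x * f' x) =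
  \int[mu]_(x in I01) (((q x * f x) * f x + (p x * f' x) * f' x) - g x * f x).
  by apply: eq_Rintegral => x _; ring.
have iq := in_L2_mul Lqf Lf; have ip_ := in_L2_mul Lpf Lf'.
rewrite RintegralB//; try by [exact: integrable01D|exact: in_L2_mul].
rewrite RintegralD// -/(ip g f).
have q0 : 0 <= \int[mu]_(x in I01) (q x * f x * f x).
  by apply: Rintegral_ge0 => x Ix; rewrite -mulrA -expr2; apply: mulr_ge0;
    [exact/ltW/hq_gt0|exact: sqr_ge0].
have p0 : c * ip f' f' <= \int[mu]_(x in I01) (p x * f' x * f' x).
  rewrite /ip -RintegralZl//; last exact: in_L2_mul.
  apply: le_Rintegral => //; first by apply: integrable01Z; exact: in_L2_mul.
  by move=> x Ix; rewrite -mulrA ler_wpM2r ?cP// -expr2 sqr_ge0.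
have [c1 s1] : 0 <= cos theta1 /\ 0 <= sin theta1.
  by apply: cos_sin_ge0; case/andP: htheta1 => t0 ->; rewrite ltW.
have [c2 s2] := cos_sin_ge0 htheta2.
(* By the boundary condition and [cos^2 + sin^2 = 1], the product equals
   [cos sin (f'(0)^2 + f(0)^2)]. *)
have B0 : 0 <= f' 0 * f 0.
  have e1 := cos2Dsin2 theta1.
  have cf : cos theta1 * f 0 = sin theta1 * f' 0 by apply/eqP; rewrite -subr_eq0 lf.
  suff : 0 <= (cos theta1 ^+ 2 + sin theta1 ^+ 2) * (f' 0 * f 0) by rewrite e1 mul1r.
  rewrite mulrDl.
  have -> : cos theta1 ^+ 2 * (f' 0 * f 0) = cos theta1 * f' 0 * (cos theta1 * f 0) by ring.
  have -> : sin theta1 ^+ 2 * (f' 0 * f 0) = sin theta1 * f 0 * (sin theta1 * f' 0) by ring.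
  rewrite cf -{2}cf.
  have -> : cos theta1 * f' 0 * (sin theta1 * f' 0) + sin theta1 * f 0 * (cos theta1 * f 0) =
    cos theta1 * sin theta1 * (f' 0 ^+ 2 + f 0 ^+ 2) by ring.
  by rewrite !mulr_ge0// addr_ge0 ?sqr_ge0.
have B1 : f' 1 * f 1 <= 0.
  have e1 := cos2Dsin2 theta2.
  have cf : cos theta2 * f 1 = - (sin theta2 * f' 1) by apply/eqP; rewrite -addr_eq0 rf.
  suff : (cos theta2 ^+ 2 + sin theta2 ^+ 2) * (f' 1 * f 1) <= 0 by rewrite e1 mul1r.
  rewrite mulrDl.
  have -> : cos theta2 ^+ 2 * (f' 1 * f 1) = cos theta2 * f' 1 * (cos theta2 * f 1) by ring.
  have -> : sin theta2 ^+ 2 * (f' 1 * f 1) = - (sin theta2 * f 1 * (- (sin theta2 * f' 1))) by ring.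
  rewrite cf -{2}cf.
  have -> : cos theta2 * f' 1 * - (sin theta2 * f' 1) - sin theta2 * f 1 * (cos theta2 * f 1) =
    - (cos theta2 * sin theta2 * (f' 1 ^+ 2 + f 1 ^+ 2)) by ring.
  by rewrite oppr_le0 !mulr_ge0// addr_ge0 ?sqr_ge0.
have P0 : 0 <= p 0 * (f' 0 * f 0) by rewrite mulr_ge0// ltW// hp_gt0// in_itv/= lexx ler01.
have P1 : p 1 * (f' 1 * f 1) <= 0 by rewrite pmulr_rle0// hp_gt0// in_itv/= lexx ler01.
move: q0 p0; move: (\int[mu]_(x in I01) (q x * f x * f x))
  (\int[mu]_(x in I01) (p x * f' x * f' x)).
move=> Iq Ip q0 p0 E; rewrite !mulrA in P0 P1; lra.
Qed.

End SturmLiouvilleTheory.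

(** * Values of the eigenfunctions at 0, and the constant M_phi *)

Section Eigensystem.
Context {R : realType} (p q : R -> R) (theta1 theta2 : R) (lam : nat -> R) (phi : nat -> R -> R).
Hypothesis (hq : C0_01 q) (hp : C1_01 p).
Hypothesis (hp_gt0 : forall x, x \in `[0, 1] -> 0 < p x).
Hypothesis (hq_gt0 : forall x, x \in `[0, 1] -> 0 < q x).
Hypothesis (htheta1 : 0 < theta1 <= pi / 2) (htheta2 : 0 <= theta2 <= pi / 2).
Hypothesis (heig : sl_eigensystem p q theta1 theta2 lam phi).
Implicit Types f g : R -> R.

Let hb := sl_phi_basis heig.

Lemma eigen_data n : sl_data p q theta1 theta2 0 (phi n) (der01 (phi n)) (fun x => lam n * phi n x).
Proof. exact: sl_op_data (sl_phi_eigen heig n). Qed.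

Lemma eigen_dataZ c n : sl_data p q theta1 theta2 0 (fun x => c * phi n x)
  (fun x => c * der01 (phi n) x) (fun x => c * (lam n * phi n x)).
Proof. by have := sl_dataZ c (eigen_data n); rewrite mulr0. Qed.

(** In [trace0_le] the energy estimate replaces [L2norm f'] by [(ip g f / c)^(1/2)], with [c] a
    lower bound of [p]; hence the constant [2 / c^(1/2)]. *)
Lemma trace_bound : exists2 C, 0 < C & forall f f' g, sl_data p q theta1 theta2 0 f f' g ->
  f 0 ^+ 2 <= ip f f + C * (L2norm f * Num.sqrt (ip g f)).
Proof.
have [c c0 cP] := p_lower hp hp_gt0.
have sc0 : 0 < Num.sqrt c by rewrite sqrtr_gt0.
exists (2 / Num.sqrt c); first by rewrite divr_gt0.
move=> f f' g Df; have E := energy hq hp hp_gt0 hq_gt0 htheta1 htheta2 cP Df.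
apply: le_trans (trace0_le _) _; first by case: Df => H _ _ _; exact: H.
rewrite lerD2l -mulrA ler_wpM2l// mulrCA ler_wpM2l ?L2norm_ge0//.
by rewrite ler_pdivlMl// /L2norm -sqrtrM ?(ltW c0)//; exact: ler_wsqrtr.
Qed.

Lemma ip_sum_phi m (a b : nat -> R) :
  ip (fun x => \sum_(n < m) a n * phi n x) (fun x => \sum_(n < m) b n * phi n x) =
  \sum_(n < m) a n * b n.
Proof.
have LZ (c : nat -> R) n : in_L2 (fun x => c n * phi n x) by apply: in_L2Z; exact: (basis_L2 hb).
rewrite ip_suml//; last by apply: in_L2_sum.
apply: eq_bigr => n _; rewrite ipZl//; [|exact: (basis_L2 hb)|exact: in_L2_sum].
congr (_ * _); rewrite ipC ip_suml//; last exact: (basis_L2 hb).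
rewrite (bigD1 n)//= big1 ?addr0 => [|i /negPf ni].
  by rewrite ipZl ?(basis_orth hb) ?eqxx ?mulr1//; exact: (basis_L2 hb).
rewrite ipZl ?(basis_orth hb) ?(inj_eq val_inj) ?ni ?mulr0//; exact: (basis_L2 hb).
Qed.

Lemma lam_le m n : (m <= n)%N -> lam m <= lam n.
Proof.
have /nondecreasing_seqP H i : lam i <= lam i.+1 by exact/ltW/(sl_lam_increasing heig).
exact: H.
Qed.

Lemma lam_gt0 n : 0 < lam n. Proof. exact: sl_lam_gt0 heig n. Qed.

(** The summand 1 keeps the sum away from 0, so that its inverse square root can telescope from
    [m = 0] on. *)
Definition trace_sum m : R := 1 + \sum_(n < m) phi n 0 ^+ 2.

Lemma trace_sum_ge1 m : 1 <= trace_sum m.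
Proof. by rewrite lerDl sumr_ge0// => i _; rewrite sqr_ge0. Qed.

Lemma trace_sumS m : trace_sum m.+1 = trace_sum m + phi m 0 ^+ 2.
Proof. by rewrite /trace_sum big_ord_recr/= addrA. Qed.

(* Apply [trace_bound] to [\sum_(k <= n) phi_k(0) phi_k], whose value at 0 is its
   squared norm. *)
Lemma trace_sum_le : exists2 C, 0 < C & forall n, trace_sum n.+1 <= C * Num.sqrt (lam n).
Proof.
have [C C0 HC] := trace_bound.
have sl0 : 0 < Num.sqrt (lam 0) by rewrite sqrtr_gt0 lam_gt0.
(* The estimate below gives [2 + C lambda_n^(1/2)]; the constant 2 is absorbed because
   [lam 0 <= lam n]. *)
exists (2 / Num.sqrt (lam 0) + C); first by rewrite addr_gt0// divr_gt0.
move=> n; set S := \sum_(k < n.+1) phi k 0 ^+ 2.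
have S0 : 0 <= S by apply: sumr_ge0 => i _; rewrite sqr_ge0.
pose f x := \sum_(k < n.+1) phi k 0 * phi k x.
pose g x := \sum_(k < n.+1) phi k 0 * (lam k * phi k x).
have : f 0 ^+ 2 <= ip f f + C * (L2norm f * Num.sqrt (ip g f)).
  exact: HC (sl_data_sum (index_enum 'I_n.+1) (fun k : 'I_n.+1 => eigen_dataZ (phi k 0) k)).
have fS : f 0 = S by apply: eq_bigr => k _; rewrite expr2.
have ffS : ip f f = S by rewrite /f (ip_sum_phi _ (fun k => phi k 0) (fun k => phi k 0));
  apply: eq_bigr => k _; rewrite expr2.
have gfS : ip g f <= lam n * S.
  have -> : g = fun x => \sum_(k < n.+1) (phi k 0 * lam k) * phi k x.
    by apply/funext => x; rewrite /g; apply: eq_bigr => k _ /=; ring.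
  rewrite (ip_sum_phi _ (fun k => phi k 0 * lam k) (fun k => phi k 0)) mulr_sumr ler_sum// => k _.
  by rewrite mulrAC -expr2 mulrC ler_wpM2r ?sqr_ge0// lam_le// -ltnS.
rewrite /L2norm fS ffS => H.
have H2 : S ^+ 2 <= S * (1 + C * Num.sqrt (lam n)).
  apply: (le_trans H); rewrite mulrDr mulr1 lerD2l [leRHS]mulrCA ler_pM2l//.
  apply: (@le_trans _ _ (Num.sqrt S * Num.sqrt (lam n * S))).
    by rewrite ler_wpM2l ?sqrtr_ge0// ler_wsqrtr.
  by rewrite sqrtrM ?(ltW (lam_gt0 _))// mulrCA -expr2 sqr_sqrtr// mulrC.
have H3 : S <= 1 + C * Num.sqrt (lam n).
  have [->|Sn0] := eqVneq S 0; first by rewrite addr_ge0// mulr_ge0 ?sqrtr_ge0 ?ltW.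
  by rewrite -(@ler_pM2l _ S) -?expr2// lt_neqAle eq_sym Sn0.
have H4 : 2 <= 2 / Num.sqrt (lam 0) * Num.sqrt (lam n).
  by rewrite mulrAC -[leLHS]mulr1 -mulrA ler_pM2l// ler_pdivlMr// mul1r ler_wsqrtr// lam_le.
rewrite /trace_sum -/S mulrDl; lra.
Qed.

(* With [S_m = trace_sum m], each term is at most a constant times
   [(S_(m+1) - S_m) / S_(m+1)^(3/2) <= 2 (S_m^(-1/2) - S_(m+1)^(-1/2))]. *)
Lemma Mphi_partial : exists2 B, 0 < B & forall m, \sum_(n < m) phi n 0 ^+ 2 / lam n `^ (3 / 4) <= B.
Proof.
have [C C0 HC] := trace_sum_le.
set D := Num.sqrt C.
have D0 : 0 < D by rewrite sqrtr_gt0.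
(* The bound [trace_sum (n + 1) <= C lambda_n^(1/2)] reads [b <= D r] with [b] the square root of
   the sum and [r = lambda_n^(1/4)], so [lambda_n^(-3/4) <= D^3 / b^3]. The factor 2 comes from the
   telescoping. *)
exists (2 * D ^+ 3); first by rewrite mulr_gt0// exprn_gt0.
move=> m; apply: (@le_trans _ _ (2 * D ^+ 3 * (1 - (Num.sqrt (trace_sum m))^-1))); last first.
  by rewrite ler_piMr ?mulr_ge0 ?exprn_ge0 ?(ltW D0)// gerBl invr_ge0 sqrtr_ge0.
elim: m => [|m ih]; first by rewrite big_ord0 /trace_sum big_ord0 addr0 sqrtr1 invr1 subrr mulr0.
rewrite big_ord_recr/=; apply: le_trans (lerD ih (lexx _)) _.
rewrite -lerBrDl -mulrBr.
set a := Num.sqrt (trace_sum m); set b := Num.sqrt (trace_sum m.+1).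
have a0 : 0 < a by rewrite sqrtr_gt0 (lt_le_trans ltr01 (trace_sum_ge1 _)).
have b0 : 0 < b by rewrite sqrtr_gt0 (lt_le_trans ltr01 (trace_sum_ge1 _)).
have aE : a ^+ 2 = trace_sum m by rewrite sqr_sqrtr// (le_trans ler01 (trace_sum_ge1 _)).
have bE : b ^+ 2 = trace_sum m.+1 by rewrite sqr_sqrtr// (le_trans ler01 (trace_sum_ge1 _)).
have ab : a <= b by rewrite ler_wsqrtr// trace_sumS lerDl sqr_ge0.
have phiE : phi m 0 ^+ 2 = b ^+ 2 - a ^+ 2 by rewrite aE bE trace_sumS addrAC subrr add0r.
set r := lam m `^ (1 / 4).
have r0 : 0 < r by apply: powR_gt0; exact: lam_gt0.
have r2 : Num.sqrt (lam m) = r ^+ 2.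
  by rewrite -powR12_sqrt ?(ltW (lam_gt0 _))// /r -powR_mulrn ?powR_ge0// -powRrM; congr (_ `^ _);
    lra.
have r3 : lam m `^ (3 / 4) = r ^+ 3.
  by rewrite /r -powR_mulrn ?powR_ge0// -powRrM; congr (_ `^ _); lra.
have br : b <= D * r.
  rewrite -(@ler_pXn2r _ 2)// ?nnegrE ?mulr_ge0 ?(ltW D0) ?(ltW r0) ?(ltW b0)//
    exprMn -r2 bE /D sqr_sqrtr ?(ltW C0)//.
rewrite r3 phiE.
have H : (r ^+ 3)^-1 <= D ^+ 3 / b ^+ 3.
  rewrite -[leLHS]mul1r ler_pdivlMr ?exprn_gt0// mulrAC ler_pdivrMr ?exprn_gt0// mul1r -exprMn.
  by rewrite lerXn2r ?nnegrE ?mulr_ge0// ltW.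
have ba2 : 0 <= b ^+ 2 - a ^+ 2 by rewrite -phiE sqr_ge0.
apply: le_trans (ler_wpM2l ba2 H) _.
rewrite -subr_ge0.
(* The gap in the telescoping inequality, factored so that its sign is visible from [0 < a <= b]. *)
have -> : 2 * D ^+ 3 * (1 - b^-1 - (1 - a^-1)) - (b ^+ 2 - a ^+ 2) * (D ^+ 3 / b ^+ 3) =
   D ^+ 3 * (b - a) * ((b - a) * (2 * b + a)) / (a * b ^+ 3).
  by field; rewrite !gt_eqF.
by rewrite divr_ge0 ?mulr_ge0 ?exprn_ge0 ?subr_ge0 ?addr_ge0 ?mulr_ge0// ltW.
Qed.

(** Crude on purpose: in [trace_cvg] the root is multiplied by a quantity tending to 0, so an upper
    bound that stays bounded suffices. *)
Lemma sqrtr_le1D (y : R) : 0 <= y -> Num.sqrt y <= 1 + y.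
Proof.
move=> y0; have e : Num.sqrt ((1 + y) ^+ 2) = 1 + y.
  by rewrite sqrtr_sqr ger0_norm// addr_ge0.
rewrite -[leRHS]e; apply: ler_wsqrtr; have := sqr_ge0 y; rewrite sqrrD expr1n mul1r; lra.
Qed.

Let tau n : R := phi n 0 ^+ 2 / lam n `^ (3 / 4).

Lemma tau_ge0 n : 0 <= tau n.
Proof. by rewrite divr_ge0 ?sqr_ge0 ?powR_ge0. Qed.

(** The bound is that of the full series, hence independent of [N]; feasibility relies on this
    uniformity. *)
Lemma Mphi_ereal_le : exists2 B, 0 < B & forall N,
  (Mphi_ereal lam phi N <= B%:E)%E.
Proof.
have [B B0 HB] := Mphi_partial; exists B => // N.
rewrite /Mphi_ereal; apply: lime_le.
  by apply: is_cvg_nneseries => n _ _; rewrite lee_fin real_normK ?num_real// tau_ge0.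
near=> m; rewrite sumEFin lee_fin.
under eq_bigr do rewrite real_normK ?num_real//.
apply: le_trans (HB m); rewrite -(big_mkord xpredT tau).
have [mN|Nm] := leqP m N; first by rewrite big_geq// sumr_ge0// => i _; exact: tau_ge0.
by rewrite [leRHS](big_cat_nat _ (ltnW Nm))//= lerDr sumr_ge0// => i _; exact: tau_ge0.
Unshelve. all: by end_near. Qed.

Lemma Mphi_ereal_ge0 N : (0 <= Mphi_ereal lam phi N)%E.
Proof. by apply: nneseries_ge0 => n _ _; rewrite lee_fin real_normK ?num_real// tau_ge0. Qed.

Lemma Mphi_ereal_lty N : (Mphi_ereal lam phi N < +oo)%E.
Proof. by have [B _ HB] := Mphi_ereal_le; rewrite (le_lt_trans (HB N))// ltry. Qed.

Lemma Mphi_fin N : (Mphi_ereal lam phi N = (Mphi lam phi N)%:E)%E.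
Proof. by rewrite fineK// ge0_fin_numE ?Mphi_ereal_ge0// Mphi_ereal_lty. Qed.

Lemma Mphi_ge0 N : 0 <= Mphi lam phi N.
Proof. by rewrite fine_ge0// Mphi_ereal_ge0. Qed.

Lemma Mphi_le : exists2 B, 0 < B & forall N, Mphi lam phi N <= B.
Proof.
have [B B0 HB] := Mphi_ereal_le; exists B => // N.
by rewrite -lee_fin -Mphi_fin.
Qed.

Lemma Mphi_ge_partial N m :
  \sum_(N <= n < m) phi n 0 ^+ 2 / lam n `^ (3 / 4) <= Mphi lam phi N.
Proof.
rewrite -lee_fin -Mphi_fin -sumEFin.
under eq_bigr do rewrite -[phi _ 0 ^+ 2]real_normK ?num_real//.
by apply: nneseries_lim_ge => n _ _; rewrite lee_fin real_normK ?num_real// tau_ge0.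
Qed.

Lemma sl_data_coef f f' g n : sl_data p q theta1 theta2 0 f f' g ->
  ip g (phi n) = lam n * ip f (phi n).
Proof.
move=> Df; have Lphi := basis_L2 hb n; have [Hf _ _ _] := Df.
rewrite (sl_lagrange hq Df (eigen_data n)) mulr0 subr0 ipC ipZl// 1?ipC//; exact: H1_L2 Hf.
Qed.

(** L^2 convergence says nothing about the point 0. Since the partial sums of [f] are mapped by the
    operator to those of [g], [trace_bound] applies to the residual of [f]: its norm tends to 0
    while the residual of [g] stays bounded by [L2norm g]. *)
Lemma trace_cvg f f' g : sl_data p q theta1 theta2 0 f f' g ->
  (fun m => \sum_(n < m) ip f (phi n) * phi n 0) @ \oo --> f 0.
Proof.
move=> Df; have [C C0 HC] := trace_bound.
have Lf : in_L2 f by case: Df => H _ _ _; exact: H1_L2 H.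
have Lg : in_L2 g := sl_data_L2 hq Df.
pose x m := L2norm (fun y => f y - partial_sum phi f m y).
have x0 m : 0 <= x m by exact: L2norm_ge0.
have xcvg : x @ \oo --> (0 : R) := partial_sum_cvg hb Lf.
set G := L2norm g.
have H m : `|f 0 - \sum_(n < m) ip f (phi n) * phi n 0| <=
    Num.sqrt (x m ^+ 2 + C * (x m * (1 + G * x m))).
  have DS : sl_data p q theta1 theta2 0 (partial_sum phi f m)
      (fun y => \sum_(n < m) ip f (phi n) * der01 (phi n) y) (partial_sum phi g m).
    have := sl_data_sum (index_enum 'I_m) (fun n : 'I_m => eigen_dataZ (ip f (phi n)) n).
    suff -> : (fun y => \sum_(n < m) ip f (phi n) * (lam n * phi n y)) = partial_sum phi g m by [].
    apply/funext => y; apply: eq_bigr => n _.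
    by rewrite (sl_data_coef _ Df); ring.
  pose h y := f y - partial_sum phi f m y.
  pose k y := g y - partial_sum phi g m y.
  have H1 : h 0 ^+ 2 <= ip h h + C * (L2norm h * Num.sqrt (ip k h)) := HC _ _ _ (sl_dataB Df DS).
  have -> : f 0 - \sum_(n < m) ip f (phi n) * phi n 0 = h 0 by [].
  rewrite -sqrtr_sqr; apply: ler_wsqrtr; apply: (le_trans H1).
  rewrite -sqr_L2norm; apply: lerD; first exact: lexx.
  apply: ler_wpM2l; first exact: ltW.
  apply: ler_wpM2l; first exact: L2norm_ge0.
  have Lh : in_L2 h by apply: in_L2B => //; exact: (partial_sum_L2 hb).
  have Lk : in_L2 k by apply: in_L2B => //; exact: (partial_sum_L2 hb).
  have kG : L2norm k <= G.
    rewrite ler_wsqrtr//; rewrite (ip_residual hb)// gerBl.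
    by apply: sumr_ge0 => i _; exact: sqr_ge0.
  have khG : ip k h <= G * x m.
    apply: (le_trans (ler_norm _)); apply: (le_trans (normr_ip_le Lk Lh)).
    by apply: ler_wpM2r => //; exact: L2norm_ge0.
  apply: (le_trans (ler_wsqrtr khG)).
  have y0 : 0 <= G * x m by apply: mulr_ge0; exact: L2norm_ge0.
  move: (G * x m) y0 => y y0; exact: sqrtr_le1D.
have ucvg : (fun m => Num.sqrt (x m ^+ 2 + C * (x m * (1 + G * x m)))) @ \oo --> (0 : R).
  rewrite -[X in _ --> X](@sqrtr0 R); apply: continuous_cvg; first exact: sqrt_continuous.
  rewrite -[X in _ --> X](_ : 0 * 0 + C * (0 * (1 + G * 0)) = 0); last by ring.
  apply: cvgD; first by under eq_fun do rewrite expr2; exact: cvgM.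
  apply: cvgM; first exact: cvg_cst.
  apply: cvgM => //; apply: cvgD; first exact: cvg_cst.
  by apply: cvgM => //; exact: cvg_cst.
apply/cvgrPdist_le => e e0.
have /cvgrPdist_le /(_ e e0) := ucvg; apply: filterS => m.
rewrite sub0r normrN ger0_norm ?sqrtr_ge0//; exact: le_trans (H m).
Qed.

End Eigensystem.

(** * Quadratic forms and Lyapunov matrices *)

Section QuadraticForms.
Context {R : realType}.

Definition bf n (M : 'M[R]_n) (x y : 'cV[R]_n) : R := (x^T *m M *m y) 0 0.

Lemma bfE n (M : 'M[R]_n) x y : bf M x y = \sum_i \sum_j x i 0 * M i j * y j 0.
Proof.
rewrite /bf mxE exchange_big/=; apply: eq_bigr => j _.
by rewrite mxE big_distrl/=; apply: eq_bigr => i _; rewrite mxE.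
Qed.

Lemma bfDl n (M : 'M[R]_n) x y z : bf M (x + y) z = bf M x z + bf M y z.
Proof. by rewrite /bf linearD/= !mulmxDl mxE. Qed.
Lemma bfDr n (M : 'M[R]_n) x y z : bf M z (x + y) = bf M z x + bf M z y.
Proof. by rewrite /bf mulmxDr mxE. Qed.
Lemma bfZl n (M : 'M[R]_n) c x z : bf M (c *: x) z = c * bf M x z.
Proof. by rewrite /bf linearZ/= -!scalemxAl mxE. Qed.
Lemma bfZr n (M : 'M[R]_n) c x z : bf M z (c *: x) = c * bf M z x.
Proof. by rewrite /bf -!scalemxAr mxE. Qed.
Lemma bf_sym n (M : 'M[R]_n) x y : M^T = M -> bf M x y = bf M y x.
Proof.
move=> MT; rewrite /bf -[in LHS](trmxK (x^T *m M *m y)) mxE.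
by rewrite !trmx_mul trmxK MT mulmxA.
Qed.
Lemma bf0l n (M : 'M[R]_n) y : bf M 0 y = 0.
Proof. by rewrite /bf trmx0 !mul0mx mxE. Qed.

Lemma posdef_ge0 n (M : 'M[R]_n) x : posdef M -> 0 <= bf M x x.
Proof. by move=> PM; have [->|/PM/ltW//] := eqVneq x 0; rewrite bf0l. Qed.

Lemma bf_cauchy n (M : 'M[R]_n) x y : M^T = M -> posdef M ->
  bf M x y ^+ 2 <= bf M x x * bf M y y.
Proof.
move=> MT PM; have [->|y0] := eqVneq y 0.
  by rewrite bf_sym// !bf0l mulr0 expr0n.
have My : 0 < bf M y y := PM y y0.
have := posdef_ge0 (x + (- (bf M x y / bf M y y)) *: y) PM.
rewrite !(bfDl, bfDr, bfZl, bfZr) [bf M y x]bf_sym//.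
rewrite -(pmulr_rge0 _ My).
set a := bf M x y; set b := bf M y y in My *; set c := bf M x x.
have -> : b * (c + - (a / b) * a + (- (a / b) * a + - (a / b) * (- (a / b) * b))) = c * b - a ^+ 2.
  by field; rewrite gt_eqF.
by rewrite subr_ge0.
Qed.

Lemma posdef_unitmx n (M : 'M[R]_n) : posdef M -> M \in unitmx.
Proof.
move=> PM; rewrite -row_free_unit -kermx_eq0; apply/negPn/negP => /rowV0Pn[v].
rewrite sub_kermx => /eqP vM v0.
have /PM : v^T != 0 by rewrite -(inj_eq trmx_inj) trmxK trmx0.
by rewrite trmxK vM mul0mx mxE ltxx.
Qed.

(* [x_i] is the [P]-product of [x] with [P^-1 e_i]. *)
Lemma posdef_coord n (M : 'M[R]_n) : M^T = M -> posdef M ->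
  exists2 C, 0 < C & forall (x : 'cV[R]_n) i, x i 0 ^+ 2 <= C * bf M x x.
Proof.
move=> MT PM; have uM := posdef_unitmx PM.
pose e i : 'cV[R]_n := delta_mx i 0; pose h i := invmx M *m e i.
exists (1 + \sum_i bf M (h i) (h i)).
  by rewrite ltr_pwDl// sumr_ge0// => i _; exact: posdef_ge0.
move=> x i; have -> : x i 0 = bf M x (h i).
  by rewrite /bf /h mulmxA mulmxK// -colE !mxE.
rewrite (le_trans (bf_cauchy _ _ MT PM))// mulrC ler_wpM2r ?posdef_ge0//.
rewrite (bigD1 i)//= addrCA lerDl addr_ge0// sumr_ge0// => j _; exact: posdef_ge0.
Qed.

Definition sqn n (x : 'cV[R]_n) : R := \sum_i x i 0 ^+ 2.

Lemma sqn_ge0 n (x : 'cV[R]_n) : 0 <= sqn x.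
Proof. by apply: sumr_ge0 => i _; exact: sqr_ge0. Qed.

Lemma posdef_sqn n (M : 'M[R]_n) : M^T = M -> posdef M ->
  exists2 C, 0 < C & forall x, sqn x <= C * bf M x x.
Proof.
move=> MT PM; have [C C0 HC] := posdef_coord MT PM.
exists (1 + C *+ n); first by rewrite ltr_pwDl// mulrn_wge0// ltW.
move=> x; apply: (@le_trans _ _ (\sum_(i < n) C * bf M x x)); first exact: ler_sum.
rewrite sumr_const card_ord mulrDl mul1r mulrnAl lerDr posdef_ge0//.
Qed.

Lemma bf_le_sqn n (M : 'M[R]_n) : exists2 C, 0 < C & forall x, bf M x x <= C * sqn x.
Proof.
exists (1 + \sum_i \sum_j `|M i j|).
  by rewrite ltr_pwDl// sumr_ge0// => i _; rewrite sumr_ge0.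
move=> x; have xs i : x i 0 ^+ 2 <= sqn x.
  by rewrite /sqn (bigD1 i)//= lerDl sumr_ge0// => j _; exact: sqr_ge0.
rewrite bfE mulrDl mul1r ler_wpDl ?sqn_ge0// mulr_suml ler_sum// => i _.
rewrite mulr_suml ler_sum// => j _.
have -> : x i 0 * M i j * x j 0 = M i j * (x i 0 * x j 0) by ring.
apply: (le_trans (ler_norm _)); rewrite normrM ler_wpM2l//.
have := sqr_ge0 (x i 0 - x j 0); have := sqr_ge0 (x i 0 + x j 0).
have := xs i; have := xs j; rewrite ler_norml !expr2 => h1 h2 h3 h4.
by apply/andP; split; nra.
Qed.

End QuadraticForms.

(** * Lyapunov matrices from the complex Schur form *)

Section Lyapunov.
Context {R : realType}.
Local Notation C := R[i].
Implicit Types z w : C.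

Lemma ReD z w : complex.Re (z + w) = complex.Re z + complex.Re w.
Proof. by case: z w => [a b] [c d]. Qed.
Lemma ImD z w : complex.Im (z + w) = complex.Im z + complex.Im w.
Proof. by case: z w => [a b] [c d]. Qed.
Lemma ReM z w : complex.Re (z * w) = complex.Re z * complex.Re w - complex.Im z * complex.Im w.
Proof. by case: z w => [a b] [c d]. Qed.
Lemma ImM z w : complex.Im (z * w) = complex.Re z * complex.Im w + complex.Im z * complex.Re w.
Proof. by case: z w => [a b] [c d]. Qed.
Lemma Re_sum (I : Type) (r : seq I) (F : I -> C) :
  complex.Re (\sum_(i <- r) F i) = \sum_(i <- r) complex.Re (F i).
Proof. exact: (big_morph (@complex.Re R) ReD). Qed.
Lemma Im_sum (I : Type) (r : seq I) (F : I -> C) :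
  complex.Im (\sum_(i <- r) F i) = \sum_(i <- r) complex.Im (F i).
Proof. exact: (big_morph (@complex.Im R) ImD). Qed.

Definition Remx m n (M : 'M[C]_(m, n)) : 'M[R]_(m, n) := map_mx (@complex.Re R) M.
Definition Immx m n (M : 'M[C]_(m, n)) : 'M[R]_(m, n) := map_mx (@complex.Im R) M.
Definition Cmx m n (M : 'M[R]_(m, n)) : 'M[C]_(m, n) := map_mx (real_complex R) M.

Lemma Remx_mul m n k (M : 'M[C]_(m, n)) (N : 'M[C]_(n, k)) :
  Remx (M *m N) = Remx M *m Remx N - Immx M *m Immx N.
Proof.
apply/matrixP => i j; rewrite !mxE Re_sum -sumrB; apply: eq_bigr => l _.
by rewrite ReM !mxE.
Qed.
Lemma Immx_mul m n k (M : 'M[C]_(m, n)) (N : 'M[C]_(n, k)) :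
  Immx (M *m N) = Remx M *m Immx N + Immx M *m Remx N.
Proof.
apply/matrixP => i j; rewrite !mxE Im_sum -big_split; apply: eq_bigr => l _.
by rewrite ImM !mxE.
Qed.
Lemma Remx_C m n (M : 'M[R]_(m, n)) : Remx (Cmx M) = M.
Proof. by apply/matrixP => i j; rewrite !mxE. Qed.
Lemma Immx_C m n (M : 'M[R]_(m, n)) : Immx (Cmx M) = 0.
Proof. by apply/matrixP => i j; rewrite !mxE. Qed.
Lemma Cmx_eq0 m n (M : 'M[C]_(m, n)) : Remx M = 0 -> Immx M = 0 -> M = 0.
Proof.
move=> /matrixP rM /matrixP iM; apply/matrixP => i j; apply/eqP.
have := rM i j; have := iM i j; rewrite !mxE eq_complex => -> ->.
by rewrite /= !eqxx.
Qed.

Lemma finite_margin (I : finType) (f : I -> R) : (forall i, 0 < f i) ->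
  exists2 m, 0 < m & forall i, m <= f i.
Proof.
move=> f0; have S0 : 0 <= \sum_i (f i)^-1 by apply: sumr_ge0 => i _; rewrite invr_ge0 ltW.
(* Its inverse exceeds every [(f i)^-1]; unlike a minimum, it is also defined when [I] is empty. *)
exists (1 + \sum_i (f i)^-1)^-1; first by rewrite invr_gt0 ltr_pwDl.
move=> i; rewrite -[leRHS]invrK lef_pV2 ?posrE ?invr_gt0 ?ltr_pwDl//.
rewrite (bigD1 i)//= addrCA lerDl addr_ge0// sumr_ge0// => j _.
by rewrite invr_ge0 ltW.
Qed.

(** The Schur form [U A = T U] over the complex numbers, with [T] lower triangular, split into real
    and imaginary parts so that the resulting quadratic form is real. The injectivity clause is the
    invertibility of [U]. *)
Lemma real_schur n (A : 'M[R]_n) (delta : R) : (0 < n)%N -> hurwitz_lt delta A ->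
  exists Ur Ui Tr Ti : 'M[R]_n,
  [/\ Ur *m A = Tr *m Ur - Ti *m Ui /\ Ui *m A = Tr *m Ui + Ti *m Ur,
      forall x : 'cV_n, Ur *m x = 0 -> Ui *m x = 0 -> x = 0,
      forall i j : 'I_n, (i < j)%N -> Tr i j = 0 /\ Ti i j = 0 &
      forall i, Tr i i < - delta].
Proof.
move=> n0 hA; have [U Uu] := spectral.Schur (Cmx A) n0.
have uU := spectral.unitarymx_unit Uu.
rewrite /mxred.similar_to => trigT; set T := mxred.conjmx U (Cmx A) in trigT.
have UA : U *m Cmx A = T *m U.
  by rewrite /T mxred.conjumx// mulmxKV.
(* The characteristic polynomial of a triangular matrix vanishes at its diagonal entries, and [T] is
   similar to [A]. *)
have eigT i : eigenvalue (Cmx A) (T i i).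
  apply: (@mxred.eigenvalue_conjmx _ _ _ U (Cmx A)).
  - by rewrite stablemx_unit.
  - by rewrite row_free_unit.
  rewrite -/T [_ \in _]eigenvalue_root_char char_poly_trig//.
  by apply/rootP; rewrite horner_prod (bigD1 i)//= hornerXsubC subrr mul0r.
clearbody T; exists (Remx U), (Immx U), (Remx T), (Immx T); split.
- have := congr1 (@Remx n n) UA; have := congr1 (@Immx n n) UA.
  rewrite !Remx_mul !Immx_mul Remx_C Immx_C !mulmx0 subr0 add0r => -> ->.
  by split.
- move=> x Rx Ix; have : U *m Cmx x = 0.
    by apply: Cmx_eq0; rewrite ?Remx_mul ?Immx_mul Remx_C Immx_C mulmx0 ?subr0 ?add0r.
  move=> /(congr1 (mulmx (invmx U))); rewrite mulmxA mulVmx// mul1mx mulmx0 => xC.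
  by rewrite -[x]Remx_C xC; apply/matrixP => i j; rewrite !mxE.
- move=> i j ij; have /is_trig_mxP /(_ i j ij) Tij := trigT.
  by rewrite !mxE Tij.
- by move=> i; rewrite mxE; apply: hA; exact: eigT.
Qed.

Lemma bf_diag n (d : 'rV[R]_n) x y : bf (diag_mx d) x y = \sum_i d 0 i * (x i 0 * y i 0).
Proof.
rewrite bfE; apply: eq_bigr => i _; rewrite (bigD1 i)//= big1 ?addr0 => [|j ji].
  by rewrite mxE eqxx mulr1n; ring.
by rewrite mxE eq_sym (negPf ji) mulr0n mulr0 mul0r.
Qed.

Lemma mulmx_colE m n (M : 'M[R]_(m, n)) (v : 'cV_n) i : (M *m v) i 0 = \sum_j M i j * v j 0.
Proof. by rewrite mxE. Qed.

Lemma bf_congr n (M U : 'M[R]_n) x y : bf (U^T *m M *m U) x y = bf M (U *m x) (U *m y).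
Proof. by rewrite /bf trmx_mul !mulmxA. Qed.

Lemma bf_addmx n (M N : 'M[R]_n) x y : bf (M + N) x y = bf M x y + bf N x y.
Proof. by rewrite /bf mulmxDr mulmxDl mxE. Qed.

(** [c a + d b] and [c b - d a] are the real and imaginary parts of the product of [a + i b] with
    the conjugate of [c + i d]; each is at most half the sum of the squared moduli. *)
Lemma rotation_le (r s a b c d : R) :
  r * (c * a + d * b) + s * (c * b - d * a) <=
  (`|r| + `|s|) * ((a ^+ 2 + b ^+ 2 + (c ^+ 2 + d ^+ 2)) / 2).
Proof.
set w := (_ / 2).
have H (u v : R) : `|v| <= w -> u * v <= `|u| * w.
  by move=> vw; rewrite (le_trans (ler_norm _))// normrM ler_wpM2l.
rewrite mulrDl lerD// H// /w ler_norml; apply/andP; split.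
- by have := sqr_ge0 (a + c); have := sqr_ge0 (b + d); lra.
- by have := sqr_ge0 (a - c); have := sqr_ge0 (b - d); lra.
- by have := sqr_ge0 (b + c); have := sqr_ge0 (a - d); lra.
- by have := sqr_ge0 (b - c); have := sqr_ge0 (a + d); lra.
Qed.

(* In Schur coordinates the weights [e^(2i)] make the strictly triangular part
   of the generator a perturbation of size [O(e)]. *)
Lemma lyapunov n (A : 'M[R]_n) (delta : R) : (0 < n)%N -> hurwitz_lt delta A ->
  exists (P : 'M[R]_n) (m : R), [/\ P^T = P, posdef P, 0 < m &
    forall x, 2 * bf P (A *m x) x + 2 * delta * bf P x x <= - (m * bf P x x)].
Proof.
move=> n0 /(real_schur n0)[Ur [Ui [Tr [Ti [[UrA UiA] Uinj Ttrig Tdiag]]]]].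
have [m m0 mP] : exists2 m, 0 < m & forall i, m <= - delta - Tr i i.
  by apply: finite_margin => i; rewrite subr_gt0.
pose M := 1 + \sum_i \sum_j (`|Tr i j| + `|Ti i j|).
have M0 : 0 < M.
  by rewrite ltr_pwDl// sumr_ge0// => i _; apply: sumr_ge0 => j _; rewrite addr_ge0.
have MP i j : `|Tr i j| + `|Ti i j| <= M.
  rewrite /M (bigD1 i)//= (bigD1 j)//=; apply: ler_wpDl => //; apply: ler_wpDr.
    by apply: sumr_ge0 => k _; apply: sumr_ge0 => l _; rewrite addr_ge0.
  by apply: ler_wpDr => //; apply: sumr_ge0 => k _; rewrite addr_ge0.
have nM0 : 0 < n%:R * M by rewrite mulr_gt0// ltr0n.
(* With this choice the entries off the diagonal cost at most [e n M <= m / 2]. The remaining half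
   of the margin [m], doubled by the factor 2 in the derivative, is the decay [m] of the
   statement. *)
pose e := Num.min 1 (m / (2 * (n%:R * M))).
have e0 : 0 < e by rewrite lt_min ltr01 divr_gt0// mulr_gt0.
have e1 : e <= 1 by rewrite ge_min lexx.
have eM : e * (n%:R * M) <= m / 2.
  rewrite -ler_pdivlMr//; have -> : m / 2 / (n%:R * M) = m / (2 * (n%:R * M)).
    by rewrite -mulrA -invfM.
  by rewrite ge_min lexx orbT.
pose d (i : 'I_n) := (e ^+ i) ^+ 2.
have d0 i : 0 < d i by rewrite !exprn_gt0.
pose D := diag_mx (\row_i d i).
pose P := Ur^T *m D *m Ur + Ui^T *m D *m Ui.
have bfP x y : bf P x y = \sum_i d i *
  ((Ur *m x) i 0 * (Ur *m y) i 0 + (Ui *m x) i 0 * (Ui *m y) i 0).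
  rewrite bf_addmx !bf_congr !bf_diag -big_split; apply: eq_bigr => i _.
  by rewrite /= mxE mulrDr.
have P0 x : 0 <= bf P x x.
  by rewrite bfP sumr_ge0// => i _; rewrite mulr_ge0 ?(ltW (d0 i))// -!expr2 addr_ge0 ?sqr_ge0.
exists P, m; split => //.
- by rewrite linearD/= !trmx_mul !trmxK tr_diag_mx !mulmxA.
- move=> x x0; rewrite -/(bf P x x) lt_neqAle P0 andbT eq_sym; apply/negP => /eqP Px0.
  have H i : (Ur *m x) i 0 = 0 /\ (Ui *m x) i 0 = 0.
    move: Px0; rewrite bfP => /psumr_eq0P H.
    have /eqP : d i * ((Ur *m x) i 0 * (Ur *m x) i 0 + (Ui *m x) i 0 * (Ui *m x) i 0) = 0.
      by apply: H => // j _; rewrite mulr_ge0 ?(ltW (d0 j))// -!expr2 addr_ge0 ?sqr_ge0.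
    rewrite mulf_eq0 (gt_eqF (d0 i))/= -!expr2 paddr_eq0 ?sqr_ge0// !sqrf_eq0.
    by move=> /andP[/eqP -> /eqP ->].
  move/negP : x0; apply; apply/eqP; apply: Uinj; apply/matrixP => i j; rewrite ord1 [RHS]mxE.
    by case: (H i).
  by case: (H i).
move=> x; pose a i := (Ur *m x) i 0; pose b i := (Ui *m x) i 0.
pose tau i := d i * (a i ^+ 2 + b i ^+ 2).
have tau0 i : 0 <= tau i by rewrite mulr_ge0 ?(ltW (d0 i))// addr_ge0 ?sqr_ge0.
have PE : bf P x x = \sum_i tau i by rewrite bfP; apply: eq_bigr => i _; rewrite -!expr2.
pose qf i j := d i * (Tr i j * (a j * a i + b j * b i) + Ti i j * (a j * b i - b j * a i)).
have PAE : bf P (A *m x) x = \sum_i \sum_j qf i j.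
  rewrite bfP; apply: eq_bigr => i _; rewrite -mulr_sumr; congr (_ * _).
  have -> : (Ur *m (A *m x)) i 0 = \sum_j (Tr i j * a j - Ti i j * b j).
    rewrite mulmxA UrA mulmxBl -!mulmxA mxE [X in _ + X]mxE.
    by rewrite mulmx_colE mulmx_colE -sumrB.
  have -> : (Ui *m (A *m x)) i 0 = \sum_j (Tr i j * b j + Ti i j * a j).
    rewrite mulmxA UiA mulmxDl -!mulmxA mxE.
    by rewrite mulmx_colE mulmx_colE -big_split.
  rewrite -/(a i) -/(b i) !mulr_suml -big_split.
  by apply: eq_bigr => j _ /=; ring.
have qP i j : qf i j <= (i == j)%:R * (Tr i i * tau i) + e * M * ((tau i + tau j) / 2).
  have eM0 : 0 <= e * M * ((tau i + tau j) / 2).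
    by rewrite mulr_ge0 ?divr_ge0 ?addr_ge0// mulr_ge0// ltW.
  have [ij|ji|/val_inj ij] := ltngtP i j.
  - have -> : (i == j) = false by apply/negbTE/eqP => eij; rewrite eij ltnn in ij.
    by rewrite /qf; have [-> ->] := Ttrig _ _ ij; rewrite !mul0r addr0 mulr0 add0r.
  - have -> : (i == j) = false by apply/negbTE/eqP => ij; rewrite ij ltnn in ji.
    rewrite mul0r add0r.
    (* Below the diagonal the weight [e^(2i)] is shared out as [e^(i-j) e^i e^j]: the last two
       factors go into [tau i] and [tau j], and [j < i] leaves at least one factor [e]. *)
    have -> : qf i j = e ^+ (i - j) *
      (Tr i j * ((e ^+ j * a j) * (e ^+ i * a i) + (e ^+ j * b j) * (e ^+ i * b i))
        + Ti i j * ((e ^+ j * a j) * (e ^+ i * b i) - (e ^+ j * b j) * (e ^+ i * a i))).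
      have Ei : e ^+ i = e ^+ (i - j) * e ^+ j by rewrite -exprD subnK// ltnW.
      by rewrite /qf /d expr2 {1}Ei; ring.
    apply: (@le_trans _ _ (e ^+ (i - j) * (M * ((tau i + tau j) / 2)))).
      rewrite ler_wpM2l ?exprn_ge0 ?(ltW e0)//.
      apply: (le_trans (rotation_le _ _ _ _ _ _)).
      rewrite (_ : (e ^+ i * a i) ^+ 2 + (e ^+ i * b i) ^+ 2 +
        ((e ^+ j * a j) ^+ 2 + (e ^+ j * b j) ^+ 2) = tau i + tau j).
        by rewrite ler_wpM2r ?divr_ge0 ?addr_ge0.
      by rewrite /tau /d; ring.
    rewrite [leLHS]mulrA ler_wpM2r ?divr_ge0 ?addr_ge0// ler_wpM2r ?(ltW M0)//.
    have : (0 < i - j)%N by rewrite subn_gt0.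
    case: (i - j)%N => // k _; rewrite exprS ler_piMr ?(ltW e0)//.
    by rewrite exprn_ile1// ltW.
  - rewrite ij eqxx mul1r; have -> : qf j j = Tr j j * tau j by rewrite /qf /tau; ring.
    by rewrite lerDl -{1}ij.
have : bf P (A *m x) x <= \sum_i (Tr i i * tau i) + e * (n%:R * M) * \sum_i tau i.
  rewrite PAE.
  apply: (@le_trans _ _ (\sum_i \sum_j ((i == j)%:R * (Tr i i * tau i) +
    e * M * ((tau i + tau j) / 2)))).
    by apply: ler_sum => i _; apply: ler_sum.
  have -> : \sum_i \sum_j ((i == j)%:R * (Tr i i * tau i) + e * M * ((tau i + tau j) / 2)) =
     \sum_i (Tr i i * tau i + e * M / 2 * (n%:R * tau i + \sum_j tau j)).
    apply: eq_bigr => i _; rewrite big_split/=; congr (_ + _).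
      rewrite (bigD1 i)//= big1 ?addr0 ?eqxx ?mul1r// => j ji.
      by rewrite eq_sym (negPf ji) mul0r.
    rewrite -mulr_sumr -mulr_suml big_split/= sumr_const card_ord -mulr_natl; ring.
  rewrite big_split/= -mulr_sumr big_split/= -mulr_sumr sumr_const card_ord -mulr_natl lerD2l.
  by rewrite le_eqVlt; apply/orP; left; apply/eqP; field.
rewrite PE; set S := \sum_i tau i => H.
have S0 : 0 <= S by apply: sumr_ge0.
have H1 : \sum_i (Tr i i * tau i) <= (- delta - m) * S.
  rewrite mulr_sumr ler_sum// => i _; rewrite ler_wpM2r//.
  by have := mP i; lra.
have H2 : e * (n%:R * M) * S <= m / 2 * S by rewrite ler_wpM2r.
nra.
Qed.

End Lyapunov.

(** * The linear matrix inequality *)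

Section ThetaForm.
Context {R : realType}.

Lemma bf_block n m (a : 'M[R]_n) (b : 'M[R]_(n, m)) (c : 'M[R]_(m, n)) (d : 'M[R]_m) x s y u :
  bf (block_mx a b c d) (col_mx x s) (col_mx y u) =
  bf a x y + (x^T *m b *m u) 0 0 + ((s^T *m c *m y) 0 0 + bf d s u).
Proof.
rewrite /bf tr_col_mx mul_row_block mul_row_col !mulmxDl.
rewrite [LHS]mxE [X in X + _]mxE [X in _ + X]mxE; ring.
Qed.

Lemma bf_sqr n (r : 'rV[R]_n) (v : 'cV[R]_n) (k : R) :
  bf (k *: (r^T *m r)) v v = k * (r *m v) 0 0 ^+ 2.
Proof.
rewrite /bf -scalemxAr -scalemxAl mxE; congr (_ * _).
rewrite !mulmxA -trmx_mul -mulmxA.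
by move: (r *m v) => w; rewrite mxE big_ord1 mxE expr2.
Qed.

Lemma bf_scale n (M : 'M[R]_n) k x y : bf (k *: M) x y = k * bf M x y.
Proof. by rewrite /bf -scalemxAr -scalemxAl mxE. Qed.

Lemma bf_mulr n (M F : 'M[R]_n) x y : bf (M *m F) x y = bf M x (F *m y).
Proof. by rewrite /bf !mulmxA. Qed.

Lemma bf_mull n (M F : 'M[R]_n) x y : bf (F^T *m M) x y = bf M (F *m x) y.
Proof. by rewrite /bf trmx_mul !mulmxA. Qed.

Lemma mul_scalar1 m (M : 'cV[R]_m) (s : 'M[R]_1) : M *m s = s 0 0 *: M.
Proof. by rewrite {1}[s]mx11_scalar mul_mx_scalar. Qed.

(** With [s] the measurement residue, the first two terms on the right are the contribution of
    [X^T P X] to [V' + 2 delta V]. The entries are abstract, so the block structure of [F] does not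
    enter the expansion. *)
Lemma theta_form n (F P : 'M[R]_n) (k : 'rV[R]_n) (l : 'cV[R]_n) (e : 'rV[R]_(n + 1))
    (d b ka kb : R) (X : 'cV[R]_n) (s : 'M[R]_1) : P^T = P ->
  bf (block_mx (F^T *m P + P *m F + (2 * d) *: P + ka *: (k^T *m k)) (P *m l) (l^T *m P) (- b)%:M
      + kb *: (e^T *m e)) (col_mx X s) (col_mx X s) =
  2 * bf P (F *m X + s 0 0 *: l) X + 2 * d * bf P X X + ka * (k *m X) 0 0 ^+ 2
  - b * s 0 0 ^+ 2 + kb * (e *m col_mx X s) 0 0 ^+ 2.
Proof.
move=> PT; rewrite bf_addmx bf_sqr; congr (_ + _).
rewrite bf_block !bf_addmx bf_sqr bf_scale bf_mull bf_mulr bfDl bfZl.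
have -> : (X^T *m (P *m l) *m s) 0 0 = s 0 0 * bf P l X.
  by rewrite mul_scalar1 mxE bf_sym// /bf mulmxA.
have -> : (s^T *m (l^T *m P) *m X) 0 0 = s 0 0 * bf P l X.
  rewrite [s]mx11_scalar tr_scalar_mx mul_scalar_mx -scalemxAl mxE /bf; congr (_ * _).
  by rewrite mxE eqxx mulr1n.
have -> : bf (- b)%:M s s = - b * s 0 0 ^+ 2.
  by rewrite /bf mul_mx_scalar -scalemxAl mxE [X in _ * X]mxE big_ord1 mxE expr2.
rewrite [bf P X (F *m X)]bf_sym//; ring.
Qed.

End ThetaForm.

Section Matrices.
Context {R : realType} (p qt : R -> R) (qc theta2 : R).
Context (lam : nat -> R) (phi : nat -> R -> R).
Context (N0 N : nat) (K : 'rV[R]_N0) (L : 'cV[R]_N0).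
Local Notation dimX := (N0 + (N0 + ((N - N0) + (N - N0))))%N.
Local Notation A0 := (A0mx qc lam N0).
Local Notation A1 := (A1mx qc lam N0 N).
Local Notation B0 := (B0mx p qt qc theta2 lam phi N0).
Local Notation B1 := (B1tmx p qt qc theta2 lam phi N0 N).
Local Notation C0 := (C0mx phi N0).
Local Notation C1 := (C1tmx lam phi N0 N).
Local Notation F := (Fmx p qt qc theta2 lam phi N K L).
Local Notation E := (Emx p qt qc theta2 lam phi N K L).

Definition col4 (x e : 'cV[R]_N0) (z t : 'cV[R]_(N - N0)) : 'cV[R]_dimX :=
  col_mx x (col_mx e (col_mx z t)).

Lemma col4P (X : 'cV[R]_dimX) : exists x e z t, X = col4 x e z t.
Proof.
rewrite -[X]vsubmxK -[dsubmx X]vsubmxK -[dsubmx (dsubmx X)]vsubmxK.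
by do 4 eexists.
Qed.

Lemma Fmx_mul x e z t : F *m col4 x e z t =
  col4 ((A0 + B0 *m K) *m x + ((C0 *m e) 0 0 + (C1 *m t) 0 0) *: L)
       ((A0 - L *m C0) *m e - (C1 *m t) 0 0 *: L)
       ((K *m x) 0 0 *: B1 + A1 *m z) (A1 *m t).
Proof.
rewrite /Fmx /col4 !mul_col_mx !mul_row_col !mul0mx !add0r !addr0.
rewrite -!mulmxA mulNmx -!mulmxA !mul_scalar1 scalerDl.
by [].
Qed.

Lemma Kmx_mul x e z t : Kmx N K *m col4 x e z t = K *m x.
Proof. by rewrite /Kmx /col4 !mul_row_col !mul0mx !addr0. Qed.

Lemma Emx_mul x e z t (s : 'M[R]_1) : E *m col_mx (col4 x e z t) s =
  K *m ((A0 + B0 *m K) *m x + ((C0 *m e) 0 0 + (C1 *m t) 0 0 + s 0 0) *: L).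
Proof.
rewrite /Emx /col4 -mulmxA !mul_row_col !mul0mx !add0r -!mulmxA !mul_scalar1.
by rewrite !scalerDl !addrA.
Qed.

Lemma Lmx_col4 : Lmx N L = col4 L (- L) 0 0.
Proof. by []. Qed.

Context (delta : R) (P : 'M[R]_dimX) (alpha beta gamma : R).

Lemma Theta1_form (X : 'cV[R]_dimX) (s : 'M[R]_1) : P^T = P ->
  bf (Theta1 p qt qc theta2 lam phi K L delta P alpha beta gamma) (col_mx X s) (col_mx X s) =
  2 * bf P (F *m X + s 0 0 *: Lmx N L) X + 2 * delta * bf P X X
  + alpha * gamma * L2norm (remainder phi N (afun p qt theta2)) ^+ 2 * (Kmx N K *m X) 0 0 ^+ 2
  - beta * s 0 0 ^+ 2
  + alpha * gamma * L2norm (remainder phi N (bfun theta2)) ^+ 2 * (E *m col_mx X s) 0 0 ^+ 2.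
Proof.
exact: theta_form.
Qed.

End Matrices.

Section Blocks.
Context {R : realType}.

Lemma bf_block_diag n m (a : 'M[R]_n) (d : 'M[R]_m) x s y u :
  bf (block_mx a 0 0 d) (col_mx x s) (col_mx y u) = bf a x y + bf d s u.
Proof. by rewrite bf_block !mulmx0 !mul0mx !mxE addr0 add0r. Qed.

Lemma posdef_block n m (a : 'M[R]_n) (d : 'M[R]_m) :
  posdef a -> posdef d -> posdef (block_mx a 0 0 d).
Proof.
move=> Pa Pd v v0; rewrite -/(bf _ v v) -[v]vsubmxK bf_block_diag.
have [u0|u0] := eqVneq (usubmx v) 0.
  have d0 : dsubmx v != 0.
    by apply: contra_neq v0 => d0; rewrite -[v]vsubmxK u0 d0 col_mx0.
  by rewrite u0 bf0l add0r; exact: Pd.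
by rewrite ltr_pwDl//; [exact: Pa|exact: posdef_ge0].
Qed.

Lemma posdef_scale n (a : 'M[R]_n) k : 0 < k -> posdef a -> posdef (k *: a).
Proof.
by move=> k0 Pa v v0; rewrite -/(bf _ v v) bf_scale mulr_gt0//; exact: Pa.
Qed.

Lemma bf_oppl n (M : 'M[R]_n) x y : bf M (- x) y = - bf M x y.
Proof. by rewrite /bf linearN/= !mulNmx mxE. Qed.

Lemma bf1 n (x : 'cV[R]_n) : bf 1%:M x x = sqn x.
Proof. by rewrite /bf mulmx1 mxE; apply: eq_bigr => i _; rewrite mxE expr2. Qed.

Lemma posdef1 n : posdef (1%:M : 'M[R]_n).
Proof.
move=> v v0; rewrite -/(bf _ v v) bf1 lt_neqAle sqn_ge0 andbT eq_sym; apply: contra_neq v0.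
move=> /psumr_eq0P H; apply/matrixP => i j; rewrite ord1 mxE; apply/eqP.
by rewrite -sqrf_eq0; apply/eqP; apply: H => // k _; exact: sqr_ge0.
Qed.

Lemma row_cauchy n (r : 'rV[R]_n) (v : 'cV[R]_n) : (r *m v) 0 0 ^+ 2 <= sqn r^T * sqn v.
Proof.
have := bf_cauchy r^T v (trmx1 _ _) (@posdef1 n).
by rewrite !bf1 {1}/bf trmxK mulmx1.
Qed.

(** Nonnegativity of the form at [x - (2 k / m) l]. The weight is chosen to spend half of a decay
    rate [m]. *)
Lemma bf_young n (M : 'M[R]_n) (x l : 'cV[R]_n) (k m : R) : M^T = M -> posdef M -> 0 < m ->
  2 * k * bf M l x <= m / 2 * bf M x x + 2 / m * bf M l l * k ^+ 2.
Proof.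
move=> MT PM m0.
have := posdef_ge0 (x + (- (2 * k / m)) *: l) PM.
rewrite !(bfDl, bfDr, bfZl, bfZr) [bf M x l]bf_sym//.
move: (bf M x x) (bf M l x) (bf M l l) => a b c H.
rewrite -subr_ge0.
have -> : m / 2 * a + 2 / m * c * k ^+ 2 - 2 * k * b =
  m / 2 * (a + - (2 * k / m) * b + (- (2 * k / m) * b + - (2 * k / m) * (- (2 * k / m) * c))).
  by field; rewrite gt_eqF.
by rewrite mulr_ge0// divr_ge0// ltW.
Qed.

Lemma sqr3_le (a b c : R) : (a + b + c) ^+ 2 <= 3 * (a ^+ 2 + b ^+ 2 + c ^+ 2).
Proof.
have := sqr_ge0 (a - b); have := sqr_ge0 (b - c); have := sqr_ge0 (a - c); lra.
Qed.

Lemma sqr2_le (a b : R) : (a + b) ^+ 2 <= 2 * (a ^+ 2 + b ^+ 2).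
Proof. have := sqr_ge0 (a - b); lra. Qed.

End Blocks.

(** * A Lyapunov matrix for F with constants uniform in N *)

Section UniformLyapunov.
Context {R : realType} (p qt : R -> R) (qc theta2 : R).
Context (lam : nat -> R) (phi : nat -> R -> R).
Context (N0 : nat) (K : 'rV[R]_N0) (L : 'cV[R]_N0) (delta : R).
Local Notation A0 := (A0mx qc lam N0).
Local Notation B0 := (B0mx p qt qc theta2 lam phi N0).
Local Notation C0 := (C0mx phi N0).
Local Notation B1 N := (B1tmx p qt qc theta2 lam phi N0 N).
Local Notation C1 N := (C1tmx lam phi N0 N).

Hypothesis hN0 : (0 < N0)%N.
Hypothesis hlam : - lam N0 + qc < - delta.
Hypothesis lam_le : forall m n, (m <= n)%N -> lam m <= lam n.
Hypothesis hK : hurwitz_lt delta (A0 + B0 *m K).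
Hypothesis hL : hurwitz_lt delta (A0 - L *m C0).
Variables (Bb Bc : R).
Hypothesis (Bb0 : 0 < Bb) (Bc0 : 0 < Bc).
Hypothesis HBb : forall N, sqn (B1 N) <= Bb.
Hypothesis HBc : forall N, sqn (C1 N)^T <= Bc.

(* The constants [b] and [c] do not depend on [N]: [P] is block diagonal, and the
   weights of its blocks absorb the couplings of the cascade of [F]. *)
Lemma uniform_lyapunov : exists b c : R, [/\ 0 < b, 0 < c & forall N,
  exists P : 'M[R]_(N0 + (N0 + ((N - N0) + (N - N0)))), [/\ P^T = P, posdef P &
  forall X (s : 'M[R]_1), exists2 w, 0 <= w &
    [/\ 2 * bf P (Fmx p qt qc theta2 lam phi N K L *m X + s 0 0 *: Lmx N L) X
          + 2 * delta * bf P X X <= - w + b * s 0 0 ^+ 2,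
        (Kmx N K *m X) 0 0 ^+ 2 <= c * w &
        (Emx p qt qc theta2 lam phi N K L *m col_mx X s) 0 0 ^+ 2 <= c * (w + s 0 0 ^+ 2)]]].
Proof.
have [P1 [m1 [P1T P1P m10 HP1]]] := lyapunov hN0 hK.
have [P2 [m2 [P2T P2P m20 HP2]]] := lyapunov hN0 hL.
have [d1 d10 Hd1] := posdef_sqn P1T P1P.
have [d2 d20 Hd2] := posdef_sqn P2T P2P.
(* Spectral margin of the uncontrolled modes: every diagonal entry of [A1mx] is at most
   [- (delta + eps)], whatever [N]. *)
pose eps := lam N0 - qc - delta; have eps0 : 0 < eps by rewrite /eps; move: hlam; lra.
have l1 := posdef_ge0 L P1P; have l2 := posdef_ge0 L P2P.
pose k0 := sqn C0^T * d2; have k00 : 0 <= k0 by rewrite mulr_ge0 ?sqn_ge0 ?(ltW d20).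
pose kK := sqn K^T * d1; have kK0 : 0 <= kK by rewrite mulr_ge0 ?sqn_ge0 ?(ltW d10).
pose G := K *m (A0 + B0 *m K).
pose kG := sqn G^T * d1; have kG0 : 0 <= kG by rewrite mulr_ge0 ?sqn_ge0 ?(ltW d10).
pose kL := (K *m L) 0 0 ^+ 2; have kL0 : 0 <= kL by exact: sqr_ge0.
have kBc : 0 <= k0 + Bc + 1 by rewrite !addr_ge0// ltW.
(* [a1] and [a2] are the costs, after Young's inequality, of the injection through [L] into the
   first and second blocks; [a3] is the cost of the coupling [B1t K] into the third. *)
pose a1 := 2 / m1 * bf P1 L L * 3 * (k0 + Bc + 1).
have a10 : 0 <= a1.
  by rewrite !mulr_ge0 ?divr_ge0 ?invr_ge0 ?(ltW m10)// !addr_ge0// ltW.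
pose a2 := 2 / m2 * bf P2 L L * 2 * (Bc + 1).
have a20 : 0 <= a2.
  by rewrite !mulr_ge0 ?divr_ge0 ?invr_ge0 ?(ltW m20)// !addr_ge0// ltW.
pose a3 := Bb * kK / eps.
have a30 : 0 <= a3 by apply: divr_ge0; [apply: mulr_ge0 => //|]; exact: ltW.
(* The weights follow the cascade backwards, the third block having weight 1. [pZ] pays for [a3],
   then [pE] for what the error block injects into the first one, then [pe] for what the last block
   injects into both. Each leaves one unit of decay to spare. *)
pose pZ := 2 / m1 * (a3 + 1); have pZ0 : 0 < pZ by rewrite mulr_gt0 ?divr_gt0// ltr_wpDl.
pose pE := 2 / m2 * (pZ * a1 + 1).
have pE0 : 0 < pE by rewrite mulr_gt0 ?divr_gt0// ltr_wpDl// mulr_ge0// ltW.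
pose b := pZ * a1 + pE * a2 + 1.
have b0 : 0 < b by apply: ltr_wpDl => //; apply: addr_ge0; apply: mulr_ge0 => //; exact: ltW.
pose pe := b / (2 * eps); have pe0 : 0 < pe by rewrite divr_gt0// mulr_gt0.
pose c := kK + 2 * kG + 6 * kL * (k0 + Bc + 1) + 1.
have c0 : 0 < c.
  apply: ltr_wpDl => //; apply: addr_ge0; first by rewrite addr_ge0// mulr_ge0.
  by apply: mulr_ge0; [exact: mulr_ge0|rewrite !addr_ge0// ltW].
exists b, c; split=> // N.
pose P := block_mx (pZ *: P1) 0 0 (block_mx (pE *: P2) 0 0
  (block_mx (1%:M : 'M[R]_(N - N0)) 0 0 (pe *: (1%:M : 'M[R]_(N - N0))))).
exists P; split.
- by rewrite /P !tr_block_mx !trmx0 !linearZ/= P1T P2T trmx1.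
- apply: posdef_block; first exact: posdef_scale.
  apply: posdef_block; first exact: posdef_scale.
  by apply: posdef_block; [|apply: posdef_scale => //]; exact: posdef1.
move=> X s; have [x [e [z [t ->]]]] := col4P X.
set V1 := bf P1 x x; set V2 := bf P2 e e.
have V10 : 0 <= V1 by exact: posdef_ge0.
have V20 : 0 <= V2 by exact: posdef_ge0.
have S30 := sqn_ge0 z; have S40 := sqn_ge0 t.
(* The third block is left out: [Kmx] and [Emx] vanish on it, and its own decay only absorbs the
   coupling from [x]. *)
exists (V1 + V2 + sqn t); first by rewrite !addr_ge0.
rewrite Kmx_mul Emx_mul Lmx_col4 Fmx_mul.
set y := s 0 0.
set g0 := (C0 *m e) 0 0; set g1 := (C1 N *m t) 0 0; set g2 := (K *m x) 0 0.
have G0 : g0 ^+ 2 <= k0 * V2.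
  by rewrite (le_trans (row_cauchy _ _))// -mulrA ler_wpM2l ?sqn_ge0.
have G1 : g1 ^+ 2 <= Bc * sqn t.
  by rewrite (le_trans (row_cauchy _ _))// ler_wpM2r.
have G2 : g2 ^+ 2 <= kK * V1.
  by rewrite (le_trans (row_cauchy _ _))// -mulrA ler_wpM2l ?sqn_ge0.
have Q : (g0 + g1 + y) ^+ 2 <= 3 * (k0 + Bc + 1) * (V2 + sqn t + y ^+ 2).
  apply: (le_trans (sqr3_le _ _ _)); rewrite -mulrA ler_pM2l//.
  have := sqr_ge0 y; move: (sqn t) S40 G1 => S4 S40 G1 y0.
  have : 0 <= k0 * S4 by rewrite mulr_ge0.
  have : 0 <= Bc * V2 by rewrite mulr_ge0// ltW.
  have : 0 <= Bc * y ^+ 2 by rewrite mulr_ge0// ltW.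
  have : 0 <= k0 * y ^+ 2 by rewrite mulr_ge0.
  lra.
have Q2 : (g1 + y) ^+ 2 <= 2 * (Bc + 1) * (sqn t + y ^+ 2).
  apply: (le_trans (sqr2_le _ _)); rewrite -mulrA ler_pM2l//.
  have := sqr_ge0 y; move: (sqn t) S40 G1 => S4 S40 G1 y0.
  have : 0 <= Bc * y ^+ 2 by rewrite mulr_ge0// ltW.
  lra.
split; last 2 first.
- apply: (le_trans G2); apply: (@le_trans _ _ (kK * (V1 + V2 + sqn t))).
    by rewrite ler_wpM2l// -addrA lerDl addr_ge0.
  apply: ler_wpM2r; first by rewrite !addr_ge0.
  have h1 : 0 <= 2 * kG by exact: mulr_ge0.
  have h2 : 0 <= 6 * kL * (k0 + Bc + 1) by apply: mulr_ge0 => //; exact: mulr_ge0.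
  rewrite /c; move: h1 h2; move: (2 * kG) (6 * kL * _) => h h'; lra.
- rewrite mulmxDr mxE mulmxA -/G -scalemxAr [X in _ + X]mxE.
  apply: (le_trans (sqr2_le _ _)); rewrite [X in 2 * (_ + X)]exprMn -/kL.
  have HG : (G *m x) 0 0 ^+ 2 <= kG * V1.
    by rewrite (le_trans (row_cauchy _ _))// -mulrA ler_wpM2l ?sqn_ge0.
  have HL : (g0 + g1 + y) ^+ 2 * kL <= 3 * (k0 + Bc + 1) * (V2 + sqn t + y ^+ 2) * kL.
    by rewrite ler_wpM2r.
  have y0 := sqr_ge0 y.
  move: HG HL; move: ((G *m x) 0 0) ((g0 + g1 + y) ^+ 2) (sqn t) S40 => h k S4 S40 HG HL.
  have p1 : 0 <= kK * (V1 + V2 + S4 + y ^+ 2) by apply: mulr_ge0 => //; rewrite !addr_ge0.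
  have p2 : 0 <= kG * (V2 + S4 + y ^+ 2) by apply: mulr_ge0 => //; rewrite !addr_ge0.
  have p3 : 0 <= kL * (k0 + Bc + 1) * V1 by apply: mulr_ge0 => //; exact: mulr_ge0.
  rewrite /c; lra.
have P4 (x' e' : 'cV_N0) (z' t' : 'cV_(N - N0)) : bf P (col4 x' e' z' t') (col4 x e z t) =
    pZ * bf P1 x' x + (pE * bf P2 e' e + (bf 1%:M z' z + pe * bf 1%:M t' t)).
  by rewrite /P /col4 !bf_block_diag !bf_scale.
rewrite bfDl bfZl !P4 !(bfDl, bfZl, bf_oppl) !bf0l !bf1.
have A1le (v : 'cV[R]_(N - N0)) : bf 1%:M (A1mx qc lam N0 N *m v) v <= - (delta + eps) * sqn v.
  rewrite -bf_mull mulmx1 tr_diag_mx bf_diag mulr_sumr; apply: ler_sum => i _.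
  rewrite mxE -expr2 ler_wpM2r ?sqr_ge0// /eps.
  by have := lam_le (leq_addr i N0); lra.
have D3 := A1le z; have D4 := A1le t.
have D1 := HP1 x; have D2 := HP2 e.
have Y1 := bf_young x L (g0 + g1 + y) P1T P1P m10.
have Y2 := bf_young e L (- (g1 + y)) P2T P2P m20.
(* The parameter [2 * eps] spends half of the decay [2 eps sqn z] of this block. *)
have Y3 := bf_young z (B1 N) g2 (trmx1 _ _) (@posdef1 R (N - N0)) (mulr_gt0 (ltr0Sn _ 1) eps0).
move: D1 D2 D3 D4 Y1 Y2 Y3; rewrite !bf1 -/V1 -/V2.
have U1 : 2 / m1 * bf P1 L L * (g0 + g1 + y) ^+ 2 <= a1 * (V2 + sqn t + y ^+ 2).
  rewrite /a1 -[X in _ <= X * _]mulrA -[leRHS]mulrA; apply: ler_wpM2l => //.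
  by apply: mulr_ge0 => //; apply: divr_ge0 => //; exact: ltW.
have U2 : 2 / m2 * bf P2 L L * (- (g1 + y)) ^+ 2 <= a2 * (sqn t + y ^+ 2).
  rewrite sqrrN /a2 -[X in _ <= X * _]mulrA -[leRHS]mulrA; apply: ler_wpM2l => //.
  by apply: mulr_ge0 => //; apply: divr_ge0 => //; exact: ltW.
have U3 : 2 / (2 * eps) * sqn (B1 N) * g2 ^+ 2 <= a3 * V1.
  have -> : a3 * V1 = 2 / (2 * eps) * Bb * (kK * V1) by rewrite /a3; field; rewrite gt_eqF.
  apply: ler_pM => //; [|exact: sqr_ge0|].
    by rewrite mulr_ge0 ?sqn_ge0// divr_ge0// mulr_ge0// ltW.
  by apply: ler_wpM2l; rewrite ?HBb// divr_ge0// mulr_ge0// ltW.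
have e1 : pZ * (m1 / 2) = a3 + 1 by rewrite /pZ; field; rewrite gt_eqF.
have e2 : pE * (m2 / 2) = pZ * a1 + 1 by rewrite /pE; field; rewrite gt_eqF.
have e4 : pe * (2 * eps) = pZ * a1 + pE * a2 + 1 by rewrite /pe mulfVK// gt_eqF// mulr_gt0.
have -> : b = pZ * a1 + pE * a2 + 1 by [].
clearbody pe pE pZ a1 a2 a3.
move: U1 U2 U3 e1 e2 e4; clear -V10 V20 S30 S40 pZ0 pE0 pe0 eps0.
move: (bf P1 ((A0 + _) *m x) x) (bf P2 ((A0 - _) *m e) e) (bf 1%:M (_ *m z) z) (bf 1%:M (_ *m t) t).
move: (bf P1 L x) (bf P2 L e) (bf 1%:M _ z) (bf P1 L L) (bf P2 L L) (sqn (B1 N)).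
move: (sqn z) (sqn t) V1 V2 S30 S40 V10 V20 => S3 S4 V1 V2 S30 S40 V10 V20.
move: g0 g1 g2 y => g0 g1 g2 y u1 u2 u3 l1 l2 sB f1 f2 f3 f4.
move=> U1 U2 U3 e1 e2 e4 D1 D2 D3 D4 Y1 Y2 Y3.
have F1 : pZ * (2 * f1 + 2 * delta * V1 + 2 * (g0 + g1 + y) * u1) <=
    pZ * (- (m1 / 2 * V1) + a1 * (V2 + S4 + y ^+ 2)) by apply: ler_wpM2l; [exact: ltW|lra].
have F2 : pE * (2 * f2 + 2 * delta * V2 + 2 * - (g1 + y) * u2) <=
    pE * (- (m2 / 2 * V2) + a2 * (S4 + y ^+ 2)) by apply: ler_wpM2l; [exact: ltW|lra].
have F4 : pe * (2 * f4 + 2 * delta * S4) <= pe * (- (2 * eps * S4)) by apply: ler_wpM2l;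
  [exact: ltW|lra].
have E1 : pZ * (- (m1 / 2 * V1) + a1 * (V2 + S4 + y ^+ 2)) =
    - ((a3 + 1) * V1) + pZ * a1 * (V2 + S4 + y ^+ 2) by rewrite -e1; ring.
have E2 : pE * (- (m2 / 2 * V2) + a2 * (S4 + y ^+ 2)) =
    - ((pZ * a1 + 1) * V2) + pE * a2 * (S4 + y ^+ 2) by rewrite -e2; ring.
have E4 : pe * (- (2 * eps * S4)) = - ((pZ * a1 + pE * a2 + 1) * S4) by rewrite -e4; ring.
rewrite E1 in F1; rewrite E2 in F2; rewrite E4 in F4.
have y0 := sqr_ge0 y; have h3 : 0 <= eps * S3 by rewrite mulr_ge0// ltW.
lra.
Qed.

End UniformLyapunov.

(** * Feasibility *)

Section Coefficients.
Context {R : realType} (theta1 theta2 : R) (p qt q : R -> R) (qc : R).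
Context (lam : nat -> R) (phi : nat -> R -> R).
Hypothesis htheta1 : 0 < theta1 <= pi / 2.
Hypothesis htheta2 : 0 <= theta2 <= pi / 2.
Hypothesis hp : C1_01 p.
Hypothesis hp_gt0 : forall x, x \in `[0, 1] -> 0 < p x.
Hypothesis hqt : C0_01 qt.
Hypothesis hq : C0_01 q.
Hypothesis hqc : forall x, x \in `[0, 1] -> qt x = q x - qc.
Hypothesis hq_gt0 : forall x, x \in `[0, 1] -> 0 < q x.
Hypothesis heig : sl_eigensystem p q theta1 theta2 lam phi.
Local Notation D := (cos theta2 + 2 * sin theta2).
Local Notation afn := (afun p qt theta2).
Local Notation bfn := (bfun theta2).
Local Notation betac := (betacoef p qt qc theta2 lam phi).
Let hb := sl_phi_basis heig.

Lemma D_gt0 : 0 < D.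
Proof.
have [c0 s0] := cos_sin_ge0 htheta2; have := cos2Dsin2 theta2.
rewrite lt_neqAle addr_ge0 ?mulr_ge0// andbT eq_sym => e; apply/negP => /eqP D0.
have s1 : sin theta2 = 0 by lra.
have c1 : cos theta2 = 0 by lra.
by move: e; rewrite s1 c1 expr0n addr0 => /eqP; rewrite eq_sym oner_eq0.
Qed.

Lemma C0_id : C0_01 (fun x : R => x). Proof. exact: H1_C0 (@H1_id R). Qed.

Lemma afun_L2 : in_L2 afn.
Proof.
have L1 : in_L2 (fun x => 2 * p x) by apply: in_L2Z; exact: C0_L2 (C1_C0 hp).
have L2 : in_L2 (fun x => 2 * (x * der01 p x)).
  by apply: in_L2Z; apply: in_L2_mulC0 => //; [exact: C0_id|exact: C0_L2 (proj2 hp)].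
have L3 : in_L2 (fun x => x * (x * qt x)).
  by do 2 (apply: in_L2_mulC0; first exact: C0_id); exact: C0_L2.
apply: eq_in_L2 (in_L2Z D^-1 (in_L2B (in_L2D L1 L2) L3)) => x _.
by rewrite /afun [RHS]mulrC; congr (_ * _); ring.
Qed.

Definition bder (x : R) : R := - (2 / D) * x.

Lemma bfun_H1 : H1_deriv bfn bder.
Proof.
have := H1Z (- D^-1) (H1_mul (@H1_id R) (@H1_id R)).
by apply: eq_H1 => x _; rewrite /bfun /bder; ring.
Qed.

Lemma bfun_L2 : in_L2 bfn. Proof. exact: H1_L2 bfun_H1. Qed.

(** [bfun] lifts the boundary input: datum -1 at 1, and [(p b')' = qt b - a], which is where the
    formula for [a] comes from. *)
Lemma bfun_data :
  sl_data p q theta1 theta2 (-1) bfn bder (fun x => afn x + qc * bfn x).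
Proof.
have D0 := D_gt0; split.
- exact: bfun_H1.
- have := H1_mul (C1_H1 hp) (H1Z (- (2 / D)) (@H1_id R)).
  apply: eq_H1 => x Ix //; rewrite /afun /bfun hqc//; field; by rewrite gt_eqF.
- by rewrite /bfun /bder expr0n/= mul0r oppr0 !mulr0 subr0.
- by rewrite /bfun /bder expr1n; field; rewrite gt_eqF.
Qed.

(** Green's formula between [bfun] and [phi n]. It identifies the input coefficient defined through
    [a] and [b] with the boundary term met when the equation for [z] is projected. *)
Lemma betacoefE n : betac n = p 1 * kappa theta2 (phi n) (der01 (phi n)).
Proof.
have Lphi := basis_L2 hb n.
have := sl_lagrange hq bfun_data (eigen_data heig n).
rewrite ipDl//; last 2 first.
- exact: afun_L2.
- by apply: in_L2Z; exact: bfun_L2.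
rewrite ipZl//; last exact: bfun_L2.
rewrite ipZr//; last exact: bfun_L2.
rewrite /betacoef /acoef /bcoef; lra.
Qed.

(** [beta_n / lambda_n = a_n / lambda_n + (q_c / lambda_n - 1) b_n], and Bessel's inequality
    controls [a_n] and [b_n]. Division by [lambda_n] is what tames the unbounded factor in
    [beta_n]. *)
Lemma B1tmx_bound N0 : exists2 B, 0 < B & forall N, sqn (B1tmx p qt qc theta2 lam phi N0 N) <= B.
Proof.
have l0 := lam_gt0 heig 0.
pose u := 2 * (lam 0)^-1 ^+ 2; pose v := 2 * (1 + `|qc| / lam 0) ^+ 2.
have u0 : 0 <= u by rewrite mulr_ge0 ?sqr_ge0.
have v0 : 0 <= v by rewrite mulr_ge0 ?sqr_ge0.
exists (1 + (u * ip afn afn + v * ip bfn bfn)).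
  by rewrite ltr_pwDl// addr_ge0// mulr_ge0 ?ip_ge0.
move=> N; pose f n := (betac n / lam n) ^+ 2.
have fle n : f n <= u * ip afn (phi n) ^+ 2 + v * ip bfn (phi n) ^+ 2.
  have ln := lam_gt0 heig n.
  have lle : (lam n)^-1 <= (lam 0)^-1 by rewrite lef_pV2 ?posrE// (lam_le heig).
  have -> : f n = (ip afn (phi n) * (lam n)^-1 + (qc * (lam n)^-1 - 1) * ip bfn (phi n)) ^+ 2.
    by rewrite /f /betacoef /acoef /bcoef; congr (_ ^+ 2); field; rewrite gt_eqF.
  apply: (le_trans (sqr2_le _ _)); rewrite mulrDr; apply: lerD.
    rewrite exprMn /u -mulrA ler_pM2l// mulrC ler_wpM2r ?sqr_ge0// lerXn2r ?nnegrE ?invr_ge0//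
      ltW//.
  rewrite exprMn /v -mulrA ler_pM2l// ler_wpM2r ?sqr_ge0//.
  rewrite -real_normK ?num_real// lerXn2r ?nnegrE ?addr_ge0 ?divr_ge0// ?(ltW l0)//.
  rewrite (le_trans (ler_normB _ _))// normr1 addrC lerD2l normrM ler_wpM2l//.
  by rewrite gtr0_norm ?invr_gt0.
have f0 n : 0 <= f n by exact: sqr_ge0.
apply: (@le_trans _ _ (\sum_(n < N0 + (N - N0)) f n)).
  rewrite big_split_ord/= ler_wpDl ?sumr_ge0//; apply: ler_sum => i _; rewrite mxE.
  exact: lexx.
apply: (@le_trans _ _ (\sum_(n < N0 + (N - N0)) (u * ip afn (phi n) ^+ 2 +
  v * ip bfn (phi n) ^+ 2))).
  by apply: ler_sum.
rewrite big_split/= -!mulr_sumr ler_wpDl// lerD// ler_wpM2l//.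
  exact: (bessel hb _ afun_L2).
exact: (bessel hb _ bfun_L2).
Qed.

(** Each squared entry is a term of the M_phi series times [lambda_n^(-1/4)], and this factor is at
    most its value at index 0. *)
Lemma C1tmx_bound N0 : exists2 B, 0 < B & forall N, sqn (C1tmx lam phi N0 N)^T <= B.
Proof.
have [B B0 HB] := Mphi_le hq hp hp_gt0 hq_gt0 htheta1 htheta2 heig.
have l0 := lam_gt0 heig 0.
have r0 : 0 < lam 0 `^ (1 / 4) by exact: powR_gt0.
exists (B / lam 0 `^ (1 / 4)); first by rewrite divr_gt0.
move=> N; rewrite ler_pdivlMr//.
apply: le_trans (HB N0).
apply: le_trans (Mphi_ge_partial hq hp hp_gt0 hq_gt0 htheta1 htheta2 heig N0 (N0 + (N - N0))).
rewrite -[X in \sum_(X <= _ < _) _]add0n big_addn addKn big_mkord /sqn mulr_suml;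
  apply: ler_sum => i _.
rewrite !mxE addnC exprMn exprVn sqr_sqrtr; last exact/ltW/(lam_gt0 heig).
have := lam_le heig (leq0n (i + N0)).
move: (i + N0)%N => n l0n; have ln := lam_gt0 heig n.
have lE : lam n = lam n `^ (3 / 4) * lam n `^ (1 / 4).
  rewrite -powRD; last by rewrite (gt_eqF ln) implybT.
  have -> : 3 / 4 + 1 / 4 = 1 :> R by field.
  by rewrite powRr1// ltW.
have q1 : 0 < lam n `^ (1 / 4) by exact: powR_gt0.
have q3 : 0 < lam n `^ (3 / 4) by exact: powR_gt0.
rewrite -[leLHS]mulrA ler_wpM2l ?sqr_ge0//.
rewrite {1}lE invfM -mulrA; apply: ler_piMr; first by rewrite invr_ge0 ltW.
rewrite ler_pdivrMl// mulr1; by apply: ge0_ler_powR => //; rewrite nnegrE ltW.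
Qed.

Lemma L2norm_remainder_le f N : in_L2 f -> L2norm (remainder phi N f) ^+ 2 <= ip f f.
Proof.
move=> Lf; rewrite (L2norm_remainder hb)// gerBl sumr_ge0// => i _; exact: sqr_ge0.
Qed.

Lemma lam_eventually (T : R) : exists n0, forall n, (n0 <= n)%N -> T <= lam n.
Proof.
have /cvgryPge /(_ T) [n0 _ H] := sl_lam_pinfty heig.
by exists n0 => n n0n; exact: H.
Qed.

(** The spare terms [- w] and [- y^2], the latter from taking [b + 1] instead of [b], absorb the
    remainder terms as soon as [g c (Aa + Ab) <= 1]. *)
Lemma lmi_scalar (Aa Ab b c g ra rb f k e y w : R) :
  0 < b -> 0 < c -> 0 < g -> 0 <= Aa -> 0 <= Ab -> 0 <= w ->
  f <= - w + b * y ^+ 2 -> k ^+ 2 <= c * w -> e ^+ 2 <= c * (w + y ^+ 2) ->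
  ra <= Aa -> rb <= Ab -> g * (c * (Aa + Ab)) <= 1 ->
  f + g * ra * k ^+ 2 - (b + 1) * y ^+ 2 + g * rb * e ^+ 2 <= 0.
Proof.
move=> b0 c0 g0 Aa0 Ab0 w0; have := sqr_ge0 k; have := sqr_ge0 e; have := sqr_ge0 y.
move: (k ^+ 2) (e ^+ 2) (y ^+ 2) => {}k {}e {}y y0 e0 k0 H1 H2 H3 Ra Rb g1.
have gk : g * ra * k <= g * Aa * (c * w).
  apply: (@le_trans _ _ (g * Aa * k)).
    by apply: ler_wpM2r => //; apply: ler_wpM2l => //; exact: ltW.
  by apply: ler_wpM2l => //; apply: mulr_ge0 => //; exact: ltW.
have ge : g * rb * e <= g * Ab * (c * (w + y)).
  apply: (@le_trans _ _ (g * Ab * e)).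
    by apply: ler_wpM2r => //; apply: ler_wpM2l => //; exact: ltW.
  by apply: ler_wpM2l => //; apply: mulr_ge0 => //; exact: ltW.
have ga : 0 <= g * Aa * (c * y).
  by apply: mulr_ge0; apply: mulr_ge0 => //; exact: ltW.
have gw : g * (c * (Aa + Ab)) * (w + y) <= w + y.
  by apply: ler_piMl => //; exact: addr_ge0.
lra.
Qed.

Lemma lmi_feasible (delta : R) N0 (K : 'rV[R]_N0) (L : 'cV[R]_N0) :
  (0 < N0)%N -> - lam N0 + qc < - delta ->
  hurwitz_lt delta (A0mx qc lam N0 + B0mx p qt qc theta2 lam phi N0 *m K) ->
  hurwitz_lt delta (A0mx qc lam N0 - L *m C0mx phi N0) ->
  exists Nmin : nat, forall N : nat, (Nmin <= N)%N ->
    exists (P : 'M[R]_(N0 + (N0 + ((N - N0) + (N - N0))))) (alpha beta gamma : R),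
      lmi_constraints p qt qc theta2 lam phi K L delta P alpha beta gamma.
Proof.
move=> N00 hlam hK hL.
have [Bb Bb0 HBb] := B1tmx_bound N0; have [Bc Bc0 HBc] := C1tmx_bound N0.
have [b [c [b0 c0 Hbc]]] := uniform_lyapunov N00 hlam (lam_le heig) hK hL Bb0 Bc0 HBb HBc.
have [Bm Bm0 HBm] := Mphi_le hq hp hp_gt0 hq_gt0 htheta1 htheta2 heig.
pose Aa := ip afn afn; pose Ab := ip bfn bfn.
have Aa0 : 0 <= Aa by exact: ip_ge0.
have Ab0 : 0 <= Ab by exact: ip_ge0.
pose beta := b + 1; have beta0 : 0 < beta by rewrite addr_gt0.
(* Threshold for [lambda_(N+1)^(1/4)] beyond which [gamma c (Aa + Ab) <= 1]; hence the fourth power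
   in the choice of [n1]. *)
pose T := beta * (Bm + 1) * (c * (Aa + Ab) + 1).
have cA0 : 0 <= c * (Aa + Ab) by apply: mulr_ge0; [exact: ltW|exact: addr_ge0].
have T0 : 0 < T.
  by apply: mulr_gt0; [apply: mulr_gt0 => //; exact: addr_gt0|exact: ltr_wpDl].
have [n1 Hn1] := lam_eventually (T ^+ 4).
have [n2 Hn2] := lam_eventually (2 * (qc + delta + 1)).
exists (maxn n1 n2) => N; rewrite geq_max => /andP[/Hn1 lT /Hn2 lq].
have [P [PT Ppos HP]] := Hbc N.
have lN := lam_gt0 heig N.
set r := lam N `^ (1 / 4); have r0 : 0 < r by exact: powR_gt0.
have r4 : r ^+ 4 = lam N.
  by rewrite /r -powR_mulrn ?powR_ge0// -powRrM (_ : 1 / 4 * 4 = 1) ?powRr1 ?(ltW lN)//; field.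
have r3 : lam N `^ (3 / 4) = r ^+ 3.
  by rewrite /r -powR_mulrn ?powR_ge0// -powRrM; congr (_ `^ _); field.
have Tr : T <= r by rewrite -(@ler_pXn2r _ 4)// ?nnegrE ?(ltW r0) ?(ltW T0)// r4.
set M := Mphi lam phi N.
have M0 : 0 <= M by exact: Mphi_ge0.
have MB : M <= Bm by exact: HBm.
(* The summand 1 keeps [gamma] positive even if [M = 0]. *)
pose gamma := beta * (M + 1) / r.
have gamma0 : 0 < gamma by rewrite divr_gt0// mulr_gt0// ltr_wpDl.
exists P, 1, beta, gamma; split => //; split.
- move=> v; rewrite -/(bf _ v v) -[v]vsubmxK.
  move: (usubmx v) (dsubmx v) => X s {v}.
  rewrite Theta1_form// mul1r; have [w w0 [H1 H2 H3]] := HP X s.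
  have Ra := L2norm_remainder_le N afun_L2; have Rb := L2norm_remainder_le N bfun_L2.
  have g1 : gamma * (c * (Aa + Ab)) <= 1.
    rewrite /gamma mulrAC ler_pdivrMr// mul1r; apply: le_trans Tr.
    apply: ler_pM => //; first by apply: mulr_ge0; [exact: ltW|exact: addr_ge0].
      by rewrite ler_pM2l// lerD2r.
    by rewrite lerDl.
  exact: (lmi_scalar b0 c0 gamma0 Aa0 Ab0 w0 H1 H2 H3 Ra Rb g1).
- rewrite /Theta2 -/M r3 invr1.
  (* As [lam N] is at least [2 (qc + delta + 1)], the first part of [Theta2] is at most
     [- gamma lam N = - beta (M + 1) r^3], which outweighs [beta M r^3]. *)
  have gl : gamma * lam N = beta * (M + 1) * r ^+ 3.
    by rewrite -r4 /gamma; field; rewrite gt_eqF.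
  have g2 : gamma * (2 * (qc + delta + 1)) <= gamma * lam N by rewrite ler_pM2l.
  have g3 : 0 <= beta * r ^+ 3 by rewrite mulr_ge0 ?exprn_ge0 ?(ltW beta0) ?(ltW r0).
  lra.
- rewrite /Theta3 -/M -/r.
  have -> : 2 * gamma - beta * M / r = beta * (M + 2) / r by rewrite /gamma; field; rewrite gt_eqF.
  by rewrite divr_ge0 ?(ltW r0)// mulr_ge0 ?(ltW beta0)// addr_ge0.
Qed.

End Coefficients.

(** * Finite-dimensional state *)

Section State.
Context {R : realType} (p qt : R -> R) (qc theta2 : R).
Context (lam : nat -> R) (phi : nat -> R -> R).
Context (N0 N : nat) (K : 'rV[R]_N0) (L : 'cV[R]_N0).
Hypothesis lam_gt0 : forall n, 0 < lam n.
Hypothesis lam_le : forall m n, (m <= n)%N -> lam m <= lam n.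
Hypothesis hN : (N0 <= N)%N.
Local Notation betac := (betacoef p qt qc theta2 lam phi).
Implicit Types zh zn : nat -> R.

Lemma sum_split_nat (f : nat -> R) :
  \sum_(n < N) f n = \sum_(i < N0) f i + \sum_(i < N - N0) f (N0 + i)%N.
Proof.
have : \sum_(n < N0 + (N - N0)) f n = \sum_(i < N0) f i + \sum_(i < N - N0) f (N0 + i)%N.
  by rewrite big_split_ord.
by rewrite subnKC.
Qed.

(* [zh] are the observer modes and [zn] the coefficients of [z] itself; the last two
   blocks carry the scalings by [lam] built into [B1tmx] and [C1tmx]. *)
Definition state zh zn := col4 (\col_(i < N0) zh i) (\col_(i < N0) (zn i - zh i))
  (\col_(i < N - N0) (zh (N0 + i)%N / lam (N0 + i)%N))
  (\col_(i < N - N0) (Num.sqrt (lam (N0 + i)%N) * (zn (N0 + i)%N - zh (N0 + i)%N))).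

Definition innovation zh zn : R := \sum_(k < N) (zn k - zh k) * phi k 0.

Lemma innovationE zh zn : (C0mx phi N0 *m \col_(i < N0) (zn i - zh i)) 0 0 +
  (C1tmx lam phi N0 N *m
    \col_(i < N - N0) (Num.sqrt (lam (N0 + i)%N) * (zn (N0 + i)%N - zh (N0 + i)%N))) 0 0
  = innovation zh zn.
Proof.
rewrite /innovation (sum_split_nat (fun k => (zn k - zh k) * phi k 0)) !mxE; congr (_ + _).
  by apply: eq_bigr => i _; rewrite !mxE mulrC.
apply: eq_bigr => i _; rewrite !mxE.
have s0 : 0 < Num.sqrt (lam (N0 + i)%N) by rewrite sqrtr_gt0.
by field; rewrite gt_eqF.
Qed.

Definition feedback zh : R := \sum_(k < N0) K 0 k * zh k.

Lemma Kmx_state zh zn : (Kmx N K *m state zh zn) 0 0 = feedback zh.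
Proof. by rewrite Kmx_mul mxE; apply: eq_bigr => k _; rewrite mxE. Qed.

Lemma A0mx_mul (v : 'cV[R]_N0) : A0mx qc lam N0 *m v = \col_i ((- lam i + qc) * v i 0).
Proof. by rewrite mul_diag_mx; apply/matrixP => i j; rewrite ord1 !mxE. Qed.

Lemma A1mx_mul (v : 'cV[R]_(N - N0)) :
  A1mx qc lam N0 N *m v = \col_i ((- lam (N0 + i)%N + qc) * v i 0).
Proof. by rewrite mul_diag_mx; apply/matrixP => i j; rewrite ord1 !mxE. Qed.

Lemma feedbackE zh : (K *m \col_(i < N0) zh i) 0 0 = feedback zh.
Proof. by rewrite mxE; apply: eq_bigr => k _; rewrite mxE. Qed.

Section Dynamics.
Variables (zh zn zh' zn' : nat -> R) (zeta : R).
Hypothesis zh'_obs : forall i : 'I_N0, zh' i =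
  (- lam i + qc) * zh i + betac i * feedback zh + L i 0 * (innovation zh zn + zeta).
Hypothesis zh'_open : forall n, (N0 <= n < N)%N -> zh' n =
  (- lam n + qc) * zh n + betac n * feedback zh.
Hypothesis zn'_eq : forall n, (n < N)%N -> zn' n = (- lam n + qc) * zn n + betac n * feedback zh.

Lemma observer_row : (A0mx qc lam N0 + B0mx p qt qc theta2 lam phi N0 *m K) *m (\col_(i < N0) zh i)
    + (innovation zh zn + zeta) *: L = \col_(i < N0) zh' i.
Proof.
rewrite mulmxDl A0mx_mul -mulmxA mul_scalar1 feedbackE.
by apply/matrixP => i j; rewrite ord1 !mxE zh'_obs; ring.
Qed.

(** [Emx] is [K] applied to the first block of the dynamics, that is, to the derivative of the
    controlled observer modes; so it computes [u']. *)
Lemma Emx_state (s : 'M[R]_1) : s 0 0 = zeta ->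
  (Emx p qt qc theta2 lam phi N K L *m col_mx (state zh zn) s) 0 0 = feedback zh'.
Proof.
move=> sz; rewrite Emx_mul innovationE sz observer_row mxE.
by apply: eq_bigr => k _; rewrite mxE.
Qed.

(** The input cancels in the errors, since plant and observer modes share [betac]. The scalings are
    diagonal, so they commute with [A1mx] and appear only in the couplings. *)
Lemma Fmx_state :
  Fmx p qt qc theta2 lam phi N K L *m state zh zn + zeta *: Lmx N L = state zh' zn'.
Proof.
rewrite Lmx_col4 Fmx_mul innovationE /col4 !scale_col_mx !add_col_mx !scaler0 !addr0.
have lN0 (i : 'I_N0) : (i < N)%N by rewrite (leq_trans (ltn_ord i)).
have lN1 (i : 'I_(N - N0)) : (N0 + i < N)%N by rewrite -ltn_subRL.
congr col_mx.
  by rewrite -addrA -scalerDl observer_row.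
congr col_mx; last congr col_mx.
- rewrite mulmxBl A0mx_mul -mulmxA mul_scalar1; move: (innovationE zh zn).
  move: ((C0mx phi N0 *m _) 0 0) ((C1tmx lam phi N0 N *m _) 0 0) => g0 g1 innE.
  by apply/matrixP => i j; rewrite ord1 !mxE (zn'_eq (lN0 i)) zh'_obs -innE; ring.
- rewrite feedbackE A1mx_mul; apply/matrixP => i j; rewrite ord1 !mxE zh'_open ?leq_addr ?lN1//.
  by field; rewrite gt_eqF.
- rewrite A1mx_mul; apply/matrixP => i j; rewrite ord1 !mxE zh'_open ?leq_addr ?lN1// zn'_eq//.
  by ring.
Qed.

End Dynamics.

Lemma sqn_col_mx m n (x : 'cV[R]_m) (y : 'cV[R]_n) : sqn (col_mx x y) = sqn x + sqn y.
Proof.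
rewrite /sqn big_split_ord/=; congr (_ + _); apply: eq_bigr => i _.
  by rewrite col_mxEu.
by rewrite col_mxEd.
Qed.

Lemma sqn_state zh zn : sqn (state zh zn) =
  \sum_(i < N0) zh i ^+ 2 + \sum_(i < N0) (zn i - zh i) ^+ 2 +
  \sum_(i < N - N0) (zh (N0 + i)%N / lam (N0 + i)%N) ^+ 2 +
  \sum_(i < N - N0) lam (N0 + i)%N * (zn (N0 + i)%N - zh (N0 + i)%N) ^+ 2.
Proof.
rewrite /state /col4 !sqn_col_mx !addrA; congr (_ + _ + _ + _); apply: eq_bigr => i _;
  rewrite mxE//.
by rewrite exprMn sqr_sqrtr// ltW.
Qed.

Let sum_sqr_ge0 n (f : 'I_n -> R) : 0 <= \sum_(i < n) f i ^+ 2.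
Proof. by apply: sumr_ge0 => i _; exact: sqr_ge0. Qed.

(** The scalings of the state make this constant depend on [N]; that is harmless, because [N] is
    fixed in the decay estimate. *)
Lemma state_observer_le zh zn :
  \sum_(n < N) zh n ^+ 2 <= (1 + lam N ^+ 2) * sqn (state zh zn).
Proof.
rewrite (sum_split_nat (fun n => zh n ^+ 2)) sqn_state.
have H : \sum_(i < N - N0) zh (N0 + i)%N ^+ 2 <=
    lam N ^+ 2 * \sum_(i < N - N0) (zh (N0 + i)%N / lam (N0 + i)%N) ^+ 2.
  rewrite mulr_sumr; apply: ler_sum => i _.
  have l0 := lam_gt0 (N0 + i).
  have lN : lam (N0 + i)%N <= lam N.
    by apply: lam_le; rewrite -leq_subRL// ltnW.
  rewrite exprMn mulrCA ler_peMr ?sqr_ge0// exprVn ler_pdivlMr ?exprn_gt0// mul1r.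
  by rewrite lerXn2r ?nnegrE ?(ltW (lam_gt0 _))//.
move: H; set s3 := \sum_(i < _) (_ / _) ^+ 2; set s4 := \sum_(i < _) lam _ * _ => H.
have s40 : 0 <= s4 by apply: sumr_ge0 => i _; rewrite mulr_ge0 ?sqr_ge0// ltW.
have s30 : 0 <= s3 := sum_sqr_ge0 _.
have s20 := sum_sqr_ge0 (fun i : 'I_N0 => zn i - zh i).
have s10 := sum_sqr_ge0 (fun i : 'I_N0 => zh i).
have l0 := sqr_ge0 (lam N).
move: H s30 s40 s20 s10; move: s3 s4 (\sum_(i < N0) _) (\sum_(i < N0) _) (\sum_(i < N - N0) _) =>
  s3 s4 s2 s1 s5 H s30 s40 s20 s10.
have h1 : 0 <= lam N ^+ 2 * (s1 + s2 + s4) by rewrite mulr_ge0// !addr_ge0.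
lra.
Qed.

Lemma state_error_le zh zn :
  \sum_(n < N) (zn n - zh n) ^+ 2 <= (1 + (lam 0)^-1) * sqn (state zh zn).
Proof.
rewrite (sum_split_nat (fun n => (zn n - zh n) ^+ 2)) sqn_state.
have H : \sum_(i < N - N0) (zn (N0 + i)%N - zh (N0 + i)%N) ^+ 2 <=
    (lam 0)^-1 * \sum_(i < N - N0) lam (N0 + i)%N * (zn (N0 + i)%N - zh (N0 + i)%N) ^+ 2.
  rewrite mulr_sumr; apply: ler_sum => i _.
  by rewrite mulrA ler_peMl ?sqr_ge0// ler_pdivlMl// mulr1 lam_le.
move: H; set s4 := \sum_(i < _) lam _ * _ => H.
have s40 : 0 <= s4 by apply: sumr_ge0 => i _; rewrite mulr_ge0 ?sqr_ge0// ltW.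
have s30 := sum_sqr_ge0 (fun i : 'I_(N - N0) => zh (N0 + i)%N / lam (N0 + i)%N).
have s20 := sum_sqr_ge0 (fun i : 'I_N0 => zn i - zh i).
have s10 := sum_sqr_ge0 (fun i : 'I_N0 => zh i).
have l0 : 0 <= (lam 0)^-1 by rewrite invr_ge0 ltW.
move: H s30 s40 s20 s10.
move: (lam 0)^-1 l0 s4 (\sum_(i < N0) _) (\sum_(i < N0) _) (\sum_(i < N - N0) _ ^+ 2)
  (\sum_(i < N - N0) _ ^+ 2).
move=> l l0 s4 s2 s1 s3 s5 H s30 s40 s20 s10.
have h1 : 0 <= l * (s1 + s2 + s3) by rewrite mulr_ge0// !addr_ge0.
lra.
Qed.

Lemma state_le : exists2 C, 0 < C & forall zh zn,
  sqn (state zh zn) <= C * (\sum_(n < N) zh n ^+ 2 + \sum_(n < N) zn n ^+ 2).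
Proof.
pose u := (lam 0)^-1 ^+ 2; pose v := lam N.
have u0 : 0 <= u by exact: sqr_ge0.
have v0 : 0 <= v by exact/ltW/lam_gt0.
exists (1 + u + 2 * (1 + v)).
  by rewrite ltr_wpDl ?addr_ge0// mulr_gt0// ltr_wpDr.
move=> zh zn; rewrite sqn_state.
have H1 : \sum_(i < N - N0) (zh (N0 + i)%N / lam (N0 + i)%N) ^+ 2 <=
  u * \sum_(i < N - N0) zh (N0 + i)%N ^+ 2.
  rewrite mulr_sumr; apply: ler_sum => i _; rewrite exprMn mulrC ler_wpM2r ?sqr_ge0//.
  by rewrite lerXn2r ?nnegrE ?invr_ge0 ?(ltW (lam_gt0 _))// lef_pV2 ?posrE// lam_le.
have H2 : \sum_(i < N - N0) lam (N0 + i)%N * (zn (N0 + i)%N - zh (N0 + i)%N) ^+ 2 <=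
    v * \sum_(i < N - N0) (zn (N0 + i)%N - zh (N0 + i)%N) ^+ 2.
  rewrite mulr_sumr; apply: ler_sum => i _; rewrite ler_wpM2r ?sqr_ge0//.
  by apply: lam_le; rewrite -leq_subRL// ltnW.
have H3 : \sum_(n < N) (zn n - zh n) ^+ 2 <= 2 * (\sum_(n < N) zh n ^+ 2 + \sum_(n < N) zn n ^+ 2).
  rewrite -big_split mulr_sumr; apply: ler_sum => n _ /=.
  by have := sqr_ge0 (zn n + zh n); lra.
have n0 : 0 <= \sum_(n < N) zn n ^+ 2 by apply: sumr_ge0 => i _; exact: sqr_ge0.
move: H1 H2 H3 n0; rewrite (sum_split_nat (fun n => (zn n - zh n) ^+ 2))
  (sum_split_nat (fun n => zh n ^+ 2)).
have := sum_sqr_ge0 (fun i : 'I_(N - N0) => zh (N0 + i)%N).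
have := sum_sqr_ge0 (fun i : 'I_(N - N0) => zn (N0 + i)%N - zh (N0 + i)%N).
have := sum_sqr_ge0 (fun i : 'I_N0 => zn i - zh i).
have := sum_sqr_ge0 (fun i : 'I_N0 => zh i).
move: (\sum_(i < N0) zh i ^+ 2) (\sum_(i < N0) (zn i - zh i) ^+ 2)
  (\sum_(i < N - N0) (zn (N0 + i)%N - zh (N0 + i)%N) ^+ 2) (\sum_(i < N - N0) zh (N0 + i)%N ^+ 2)
  (\sum_(i < N - N0) (zh (N0 + i)%N / lam (N0 + i)%N) ^+ 2)
  (\sum_(i < N - N0) lam (N0 + i)%N * (zn (N0 + i)%N - zh (N0 + i)%N) ^+ 2)
    (\sum_(n < N) zn n ^+ 2).
move=> s1 s2 s3 s4 s5 s6 s7 p1 p2 p3 p4 H1 H2 H3 n0.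
have h1 : 0 <= u * (s1 + s7) by rewrite mulr_ge0// addr_ge0.
have h2 : v * (s2 + s3) <= v * (2 * (s1 + s4 + s7)) by rewrite ler_wpM2l.
have h3 : 0 <= v * s2 by rewrite mulr_ge0.
lra.
Qed.

Lemma sqr_feedback_le zh : feedback zh ^+ 2 <= sqn K^T * \sum_(n < N) zh n ^+ 2.
Proof.
rewrite -feedbackE (le_trans (row_cauchy _ _))// ler_wpM2l ?sqn_ge0//.
rewrite (sum_split_nat (fun n => zh n ^+ 2)) /sqn; under eq_bigr do rewrite mxE.
by rewrite lerDl.
Qed.

End State.

(** * Limits and time derivatives of L^2 products *)

Section L2Limits.
Context {R : realType}.
Implicit Types f g : R -> R.

Lemma L2_cvg_ip (T : Type) (F : set_system T) {FF : Filter F} (v : T -> R -> R) f g :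
  (\forall s \near F, in_L2 (v s)) -> in_L2 f -> in_L2 g ->
  L2norm (fun x => v s x - f x) @[s --> F] --> (0 : R) ->
  ip (v s) g @[s --> F] --> ip f g.
Proof.
move=> nv Lf Lg cv; apply/cvgrPdist_le => e e0.
have g0 : 0 < L2norm g + 1 by rewrite ltr_wpDl ?L2norm_ge0.
have /cvgrPdist_lt /(_ _ (divr_gt0 e0 g0)) := cv; move: nv.
apply: filterS2 => s Lv; rewrite sub0r normrN ger0_norm ?L2norm_ge0// => H.
rewrite distrC -ipBl//; apply: (le_trans (normr_ip_le (in_L2B Lv Lf) Lg)).
apply: (@le_trans _ _ (e / (L2norm g + 1) * (L2norm g + 1))).
  by apply: ler_pM; rewrite ?L2norm_ge0 ?(ltW H)// lerDl.
by rewrite divfK ?gt_eqF.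
Qed.

(** Expand [|v|^2 = |v - f|^2 + 2 <v, f> - |f|^2]; the middle term converges by weak continuity. *)
Lemma L2_cvg_sqr (T : Type) (F : set_system T) {FF : Filter F} (v : T -> R -> R) f :
  (\forall s \near F, in_L2 (v s)) -> in_L2 f ->
  L2norm (fun x => v s x - f x) @[s --> F] --> (0 : R) ->
  ip (v s) (v s) @[s --> F] --> ip f f.
Proof.
move=> nv Lf cv.
have H := L2_cvg_ip (FF := FF) nv Lf Lf cv.
have -> : ip f f = 0 * 0 + (2 * ip f f - ip f f) by ring.
have : (L2norm (fun x => v s x - f x) * L2norm (fun x => v s x - f x)
    + (2 * ip (v s) f - ip f f)) @[s --> F] --> 0 * 0 + (2 * ip f f - ip f f).
  apply: cvgD; first exact: cvgM.
  by apply: cvgB; [apply: cvgM; [exact: cvg_cst|exact: H]|exact: cvg_cst].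
apply: cvg_trans; apply: near_eq_cvg; apply: filterS nv => s Lv.
rewrite -expr2 sqr_L2norm ipBl//; last exact: in_L2B.
rewrite ![ip _ (fun x => v s x - f x)]ipC !ipBl// [ip f (v s)]ipC; ring.
Qed.

Lemma near_addl (t : R) (Q : R -> Prop) :
  (\forall s \near t, Q s) -> \forall h \near (0 : R)^', Q (t + h).
Proof.
move=> nQ; have H : (t + h) @[h --> (0 : R)] --> t.
  by rewrite -[X in _ --> X]addr0; apply: cvgD; [exact: cvg_cst|exact: cvg_id].
have {H} := H _ nQ; rewrite nbhs_simpl/= => H.
by apply: nbhs_dnbhs.
Qed.

Lemma L2_quotient (v : R -> R -> R) (t h : R) : in_L2 (v t) -> in_L2 (v (t + h)) ->
  in_L2 (fun x => (v (t + h) x - v t x) / h).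
Proof.
move=> Lt Lh; have := in_L2Z h^-1 (in_L2B Lh Lt).
by apply: eq_in_L2 => x _; rewrite mulrC.
Qed.

Lemma ip_quotient (v : R -> R -> R) (t h : R) g : in_L2 (v t) -> in_L2 (v (t + h)) -> in_L2 g ->
  ip (fun x => (v (t + h) x - v t x) / h) g = h^-1 * (ip (v (t + h)) g - ip (v t) g).
Proof.
move=> Lt Lh Lg; rewrite -ipBl// -ipZl//; last exact: in_L2B.
by congr (ip _ g); apply/funext => x; rewrite mulrC.
Qed.

Lemma near_cvg_congr (T : Type) (F : set_system T) {FF : Filter F} (f g : T -> R) (l : R) :
  (\forall s \near F, f s = g s) -> f s @[s --> F] --> l -> g s @[s --> F] --> l.
Proof. by move=> fg; apply: cvg_trans; exact: near_eq_cvg. Qed.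

Lemma is_derive_quotient (f : R -> R) (t l : R) :
  (h^-1 * (f (t + h) - f t)) @[h --> (0 : R)^'] --> l -> is_derive t 1 f l.
Proof.
move=> H; suff K : (h^-1 *: ((f \o shift t) (h *: 1) - f t)) @[h --> (0 : R)^'] --> l.
  by apply: DeriveDef; [exact: cvgP K|exact: cvg_lim K].
suff -> : (fun h : R => h^-1 *: ((f \o shift t) (h *: 1) - f t)) =
  (fun h : R => h^-1 * (f (t + h) - f t)) by [].
by apply/funext => h; rewrite /= [h *: 1]mulr1 [h + t]addrC.
Qed.

Lemma L2_deriv_ip (v : R -> R -> R) (t : R) v' g : L2_is_deriv v t v' ->
  (\forall s \near t, in_L2 (v s)) -> in_L2 g ->
  is_derive t 1 (fun s => ip (v s) g) (ip v' g).
Proof.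
move=> [Lv' dv] nv Lg; have Lvt : in_L2 (v t) by exact: nbhs_singleton nv.
have nv' := near_addl nv.
have nq : \forall h \near (0 : R)^', in_L2 (fun x => (v (t + h) x - v t x) / h).
  by apply: filterS nv' => h Lh; exact: L2_quotient.
have H := L2_cvg_ip (FF := dnbhs_filter _) nq Lv' Lg dv.
apply: is_derive_quotient; apply: near_cvg_congr H.
by apply: filterS nv' => h Lh; rewrite ip_quotient.
Qed.

Lemma L2_deriv_sqr (v : R -> R -> R) (t : R) v' : L2_is_deriv v t v' ->
  (\forall s \near t, in_L2 (v s)) ->
  is_derive t 1 (fun s => ip (v s) (v s)) (2 * ip v' (v t)).
Proof.
move=> [Lv' dv] nv; have Lvt : in_L2 (v t) by exact: nbhs_singleton nv.
have nv' := near_addl nv.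
have nq : \forall h \near (0 : R)^', in_L2 (fun x => (v (t + h) x - v t x) / h).
  by apply: filterS nv' => h Lh; exact: L2_quotient.
have H1 := L2_cvg_ip (FF := dnbhs_filter _) nq Lv' Lvt dv.
have H2 := L2_cvg_sqr (FF := dnbhs_filter _) nq Lv' dv.
have h0 : h @[h --> (0 : R)^'] --> (0 : R) by move=> B; exact: nbhs_dnbhs.
(* With [d] the difference quotient of [v], that of the squared norm is [2 <d, v t> + h |d|^2], and
   [|d|^2] has a finite limit. *)
have K : 2 * ip (fun x => (v (t + h) x - v t x) / h) (v t) +
    h * ip (fun x => (v (t + h) x - v t x) / h) (fun x => (v (t + h) x - v t x) / h)
    @[h --> 0^'] --> 2 * ip v' (v t) + 0 * ip v' v'.
  apply: cvgD; last exact: cvgM.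
  by apply: cvgM => //; exact: cvg_cst.
rewrite mul0r addr0 in K.
apply: is_derive_quotient; apply: near_cvg_congr K; near=> h.
have hn0 : h != 0 by near: h; exact: nbhs_dnbhs_neq.
have Lh : in_L2 (v (t + h)) by near: h.
have Lq := L2_quotient Lvt Lh.
rewrite [ip _ (fun x => _ / _)]ip_quotient// ![ip _ (fun x => _ / _)]ipC !ip_quotient//.
by rewrite [ip (v t) (v (t + h))]ipC; field.
Unshelve. all: by end_near. Qed.

End L2Limits.

(** * The Lyapunov inequality *)

Section StaticInequality.
Context {R : realType} (theta1 theta2 : R) (p qt q : R -> R) (qc : R).
Context (lam : nat -> R) (phi : nat -> R -> R).
Hypothesis htheta1 : 0 < theta1 <= pi / 2.
Hypothesis htheta2 : 0 <= theta2 <= pi / 2.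
Hypothesis hp : C1_01 p.
Hypothesis hp_gt0 : forall x, x \in `[0, 1] -> 0 < p x.
Hypothesis hqt : C0_01 qt.
Hypothesis hq : C0_01 q.
Hypothesis hq_gt0 : forall x, x \in `[0, 1] -> 0 < q x.
Hypothesis heig : sl_eigensystem p q theta1 theta2 lam phi.
Local Notation afn := (afun p qt theta2).
Local Notation bfn := (bfun theta2).
Let hb := sl_phi_basis heig.

Lemma sum_cauchy (I : Type) (r : seq I) (x y : I -> R) :
  (\sum_(i <- r) x i * y i) ^+ 2 <= (\sum_(i <- r) x i ^+ 2) * (\sum_(i <- r) y i ^+ 2).
Proof.
elim: r => [|i r ih]; first by rewrite !big_nil mul0r expr0n.
rewrite !big_cons.
have a0 : 0 <= \sum_(j <- r) x j ^+ 2 by apply: sumr_ge0 => j _; exact: sqr_ge0.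
have b0 : 0 <= \sum_(j <- r) y j ^+ 2 by apply: sumr_ge0 => j _; exact: sqr_ge0.
move: ih a0 b0; move: (\sum_(j <- r) _) (\sum_(j <- r) _) (\sum_(j <- r) _) (x i) (y i) =>
  {x y} b a s x y ih a0 b0.
(* [2 x y s <= x^2 b + y^2 a] because [s^2 <= a b] *)
suff : 2 * (x * y * s) <= x ^+ 2 * b + y ^+ 2 * a by lra.
have w0 : 0 <= x ^+ 2 * b + y ^+ 2 * a by rewrite addr_ge0// mulr_ge0 ?sqr_ge0.
have h1 : 0 <= (x * y) ^+ 2 * (a * b - s ^+ 2) by rewrite mulr_ge0 ?sqr_ge0// subr_ge0.
have h2 := sqr_ge0 (x ^+ 2 * b - y ^+ 2 * a).
have : `|2 * (x * y * s)| ^+ 2 <= (x ^+ 2 * b + y ^+ 2 * a) ^+ 2.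
  by rewrite real_normK ?num_real//; lra.
by rewrite ler_pXn2r ?nnegrE//; apply: le_trans; exact: ler_norm.
Qed.

Lemma sum_tail (F : nat -> R) (N m : nat) : (N <= m)%N ->
  \sum_(n < m) F n - \sum_(n < N) F n = \sum_(N <= n < m) F n.
Proof.
move=> Nm; rewrite -!(big_mkord xpredT F) (big_cat_nat (leq0n N) Nm)//=.
by rewrite addrAC subrr add0r.
Qed.

(** Let [s] and [r] be the fourth roots of [lam N] and [lam n], and [B = beta M_phi]. [Theta3] says
    [B <= 2 gamma s], so from [N] to [n] the positive term grows by
    [B (r^3 - s^3) <= 2 gamma (r^4 - s^4)], no more than the negative one drops. *)
Lemma Gamma_le (N n : nat) (delta alpha beta gamma : R) : (N <= n)%N -> 0 < beta ->
  Theta2 qc lam phi N delta alpha beta gamma <= 0 ->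
  0 <= Theta3 lam phi N beta gamma ->
  2 * gamma * (- lam n + qc + delta + alpha^-1) + beta * Mphi lam phi N * lam n `^ (3 / 4) <= 0.
Proof.
move=> Nn beta0 H2 H3; apply: le_trans H2; rewrite /Theta2 -subr_ge0.
have lN := lam_gt0 heig N; have ln := lam_gt0 heig n; have lNn := lam_le heig Nn.
have M0 : 0 <= beta * Mphi lam phi N.
  by apply: mulr_ge0; [exact: ltW|exact: Mphi_ge0].
move: H3; rewrite /Theta3.
have pw (x : R) : 0 < x ->
    [/\ 0 < x `^ (1 / 4), x `^ (3 / 4) = (x `^ (1 / 4)) ^+ 3 & x = (x `^ (1 / 4)) ^+ 4].
  move=> x0; split; first exact: powR_gt0.
    by rewrite -powR_mulrn ?powR_ge0// -powRrM; congr (_ `^ _); field.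
  rewrite -powR_mulrn ?powR_ge0// -powRrM (_ : 1 / 4 * 4 = 1) ?powRr1 ?(ltW x0)//; by field.
have rs : lam N `^ (1 / 4) <= lam n `^ (1 / 4).
  by apply: ge0_ler_powR => //; rewrite nnegrE ltW.
have [s0 s3 s4] := pw _ lN; have [r0 r3 r4] := pw _ ln.
rewrite s3 r3; move: rs s0 s4 r0 r4.
move: (lam N `^ (1 / 4)) (lam n `^ (1 / 4)) => s r rs s0 s4 r0 r4.
rewrite s4 r4; move: (beta * Mphi lam phi N) M0 => B B0 H.
have H1 : B <= 2 * gamma * s.
  by move: H; rewrite subr_ge0 ler_pdivrMr.
have r34 : s * r ^+ 3 <= r ^+ 4 by rewrite [leRHS]exprS ler_wpM2r// exprn_ge0// ltW.
have sr3 : 0 <= r ^+ 3 - s ^+ 3.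
  by rewrite subr_ge0; apply: lerXn2r => //; rewrite nnegrE ltW.
have H2 : B * (r ^+ 3 - s ^+ 3) <= 2 * gamma * s * (r ^+ 3 - s ^+ 3) by rewrite ler_wpM2r.
have g0 : 0 <= gamma.
  have : 0 <= 2 * gamma * s := le_trans B0 H1.
  by rewrite pmulr_lge0// pmulr_rge0.
have H3 : gamma * (s * r ^+ 3) <= gamma * r ^+ 4 by rewrite ler_wpM2l.
have E4 : s ^+ 4 = s * s ^+ 3 by rewrite exprS.
rewrite E4; lra.
Qed.

(** Stated at a frozen instant: [f] stands for [w t] and [wt] for its time derivative, and the
    dynamics enter only through the coefficients of [wt]. *)
Lemma lyapunov_ineq (N0 N : nat) (K : 'rV[R]_N0) (L : 'cV[R]_N0) (delta : R)
    (P : 'M[R]_(N0 + (N0 + ((N - N0) + (N - N0))))) (alpha beta gamma : R)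
    (X : 'cV[R]_(N0 + (N0 + ((N - N0) + (N - N0))))) f f' g wt u u' :
  lmi_constraints p qt qc theta2 lam phi K L delta P alpha beta gamma ->
  sl_data p q theta1 theta2 0 f f' g -> in_L2 wt ->
  (forall n, ip wt (phi n) = (- lam n + qc) * ip f (phi n) + ip afn (phi n) * u +
    ip bfn (phi n) * u') ->
  let zeta := f 0 - \sum_(n < N) ip f (phi n) * phi n 0 in
  u = (Kmx N K *m X) 0 0 ->
  u' = (Emx p qt qc theta2 lam phi N K L *m col_mx X zeta%:M) 0 0 ->
  2 * bf P (Fmx p qt qc theta2 lam phi N K L *m X + zeta *: Lmx N L) X
    + gamma * (2 * ip wt f - 2 * \sum_(n < N) ip f (phi n) * ip wt (phi n))
    + 2 * delta * (bf P X X + gamma * (ip f f - \sum_(n < N) ip f (phi n) ^+ 2)) <= 0.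
Proof.
move=> [PT Ppos [alpha0 beta0 gamma0] [HT1 HT2 HT3]] Df Lwt wtE zeta uE u'E.
have Lf : in_L2 f by case: Df => H _ _ _; exact: H1_L2 H.
have La := afun_L2 theta2 hp hqt; have Lb := bfun_L2 theta2.
pose Ra := ip afn afn - \sum_(n < N) ip afn (phi n) ^+ 2.
pose Rb := ip bfn bfn - \sum_(n < N) ip bfn (phi n) ^+ 2.
have RaE : L2norm (remainder phi N afn) ^+ 2 = Ra := L2norm_remainder hb N La.
have RbE : L2norm (remainder phi N bfn) ^+ 2 = Rb := L2norm_remainder hb N Lb.
pose Q ra rb := 2 * bf P (Fmx p qt qc theta2 lam phi N K L *m X + zeta *: Lmx N L) X
  + 2 * delta * bf P X X + alpha * gamma * ra * u ^+ 2 - beta * zeta ^+ 2 +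
    alpha * gamma * rb * u' ^+ 2.
have HQ : Q (L2norm (remainder phi N afn) ^+ 2) (L2norm (remainder phi N bfn) ^+ 2) <= 0.
  have := HT1 (col_mx X zeta%:M); rewrite -/(bf _ _ _) Theta1_form// -uE -u'E.
  by have -> : (zeta%:M : 'M[R]_1) 0 0 = zeta by rewrite mxE eqxx mulr1n.
have : Q Ra Rb <= 0.
  exact: (eq_ind _ (fun r => Q Ra r <= 0)
    (eq_ind _ (fun r => Q r (L2norm (remainder phi N bfn) ^+ 2) <= 0) HQ _ RaE) _ RbE).
rewrite {HQ RaE RbE}/Q.
move: (bf P (_ + _) X) (bf P X X) => PFX PXX HT.
pose c n := ip f (phi n); pose d n := ip wt (phi n).
(* [T m] and [Z m] truncate at [m] the tail part of [V' + 2 delta V] and zeta. The inequality [TZ]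
   between them involves finite sums only; Parseval and [trace_cvg] then pass to the limit. *)
pose T m := gamma * (2 * (\sum_(n < m) c n * d n - \sum_(n < N) c n * d n)
   + 2 * delta * (\sum_(n < m) c n ^+ 2 - \sum_(n < N) c n ^+ 2)).
pose Z m := \sum_(n < m) c n * phi n 0 - \sum_(n < N) c n * phi n 0.
have Tcvg : T @ \oo --> gamma *
  (2 * (ip wt f - \sum_(n < N) c n * d n) + 2 * delta * (ip f f - \sum_(n < N) c n ^+ 2)).
  apply: cvgM; first exact: cvg_cst.
  apply: cvgD; (apply: cvgM; first exact: cvg_cst); apply: cvgB; try exact: cvg_cst.
    by rewrite ipC; exact: (parseval hb Lf Lwt).
  exact: (parseval_sqr hb Lf).
have Zcvg : Z @ \oo --> zeta.
  apply: cvgB; last exact: cvg_cst.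
  exact: (trace_cvg hq hp hp_gt0 hq_gt0 htheta1 htheta2 heig Df).
have TZ m : (N <= m)%N -> T m <=
  alpha * gamma * Ra * u ^+ 2 + alpha * gamma * Rb * u' ^+ 2 - beta * Z m ^+ 2.
  move=> Nm; rewrite /T /Z (sum_tail (fun n => c n * d n) Nm) (sum_tail (fun n => c n ^+ 2) Nm)
    (sum_tail (fun n => c n * phi n 0) Nm).
  have M0 := Mphi_ge0 lam phi N.
  have l34 n : 0 < lam n `^ (3 / 4) by apply: powR_gt0; exact: (lam_gt0 heig).
  set Z' := \sum_(N <= n < m) c n * phi n 0.
  set S := \sum_(N <= n < m) lam n `^ (3 / 4) * c n ^+ 2.
  have ZS : Z' ^+ 2 <= Mphi lam phi N * S.
    have -> : Z' = \sum_(N <= n < m) (phi n 0 / Num.sqrt (lam n `^ (3 / 4))) *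
      (Num.sqrt (lam n `^ (3 / 4)) * c n).
      by apply: eq_bigr => n _; field; rewrite gt_eqF// sqrtr_gt0.
    apply: (le_trans (sum_cauchy _ _ _)).
    have -> : \sum_(N <= n < m) (Num.sqrt (lam n `^ (3 / 4)) * c n) ^+ 2 = S.
      by apply: eq_bigr => n _; rewrite exprMn sqr_sqrtr// ltW.
    have S0 : 0 <= S by apply: sumr_ge0 => n _; rewrite mulr_ge0 ?sqr_ge0// ltW.
    apply: ler_wpM2r => //.
    apply: le_trans (Mphi_ge_partial hq hp hp_gt0 hq_gt0 htheta1 htheta2 heig N m).
    by apply: ler_sum => n _; rewrite exprMn exprVn sqr_sqrtr// ltW.
  have Ra_ge : \sum_(N <= n < m) ip afn (phi n) ^+ 2 <= Ra.
    by rewrite -(sum_tail (fun n => ip afn (phi n) ^+ 2) Nm) lerD2r; exact: (bessel hb _ La).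
  have Rb_ge : \sum_(N <= n < m) ip bfn (phi n) ^+ 2 <= Rb.
    by rewrite -(sum_tail (fun n => ip bfn (phi n) ^+ 2) Nm) lerD2r; exact: (bessel hb _ Lb).
  have H1 : alpha * gamma * u ^+ 2 * \sum_(N <= n < m) ip afn (phi n) ^+ 2 <=
    alpha * gamma * u ^+ 2 * Ra.
    by apply: ler_wpM2l => //; apply: mulr_ge0; [apply: mulr_ge0; exact: ltW|exact: sqr_ge0].
  have H2 : alpha * gamma * u' ^+ 2 * \sum_(N <= n < m) ip bfn (phi n) ^+ 2 <=
    alpha * gamma * u' ^+ 2 * Rb.
    by apply: ler_wpM2l => //; apply: mulr_ge0; [apply: mulr_ge0; exact: ltW|exact: sqr_ge0].
  have H3 : beta * Z' ^+ 2 <= beta * Mphi lam phi N * S by rewrite -mulrA ler_pM2l.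
  have H4 : gamma * (2 * \sum_(N <= n < m) c n * d n + 2 * delta * \sum_(N <= n < m) c n ^+ 2) <=
     alpha * gamma * u ^+ 2 * \sum_(N <= n < m) ip afn (phi n) ^+ 2
     + alpha * gamma * u' ^+ 2 * \sum_(N <= n < m) ip bfn (phi n) ^+ 2
     - beta * Mphi lam phi N * S.
    rewrite /S !mulr_sumr -big_split mulr_sumr -big_split -sumrB !big_nat;
      apply: ler_sum => n /= /andP[Nn _].
    have G := Gamma_le Nn beta0 HT2 HT3.
    rewrite /d wtE -/(c n); move: G (c n) (ip afn (phi n)) (ip bfn (phi n)).
    move: (lam n) (lam n `^ (3 / 4)) (beta * Mphi lam phi N) => l l3 B G x y w.
    (* Young's inequality is used once for [a u] and once for [b u']. Each costs [gamma / alpha]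
       times the squared coefficient, which together is the [2 gamma alpha^-1] of Gamma_n. *)
    have ga : 0 <= gamma * alpha^-1 by apply: mulr_ge0; [exact: ltW|rewrite invr_ge0 ltW].
    have h1 := mulr_ge0 ga (sqr_ge0 (x - alpha * (y * u))).
    have h2 := mulr_ge0 ga (sqr_ge0 (x - alpha * (w * u'))).
    have e1 : gamma / alpha * (x - alpha * (y * u)) ^+ 2 =
      gamma / alpha * x ^+ 2 - 2 * gamma * (x * (y * u)) + alpha * gamma * (y * u) ^+ 2.
      by field; rewrite gt_eqF.
    have e2 : gamma / alpha * (x - alpha * (w * u')) ^+ 2 =
      gamma / alpha * x ^+ 2 - 2 * gamma * (x * (w * u')) + alpha * gamma * (w * u') ^+ 2.
      by field; rewrite gt_eqF.
    rewrite e1 in h1; rewrite e2 in h2.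
    have h3 := mulr_le0_ge0 G (sqr_ge0 x); lra.
  move: H1 H2 H3 H4.
  move: (\sum_(N <= n < m) c n * d n) (\sum_(N <= n < m) c n ^+ 2)
    (\sum_(N <= n < m) ip afn (phi n) ^+ 2) (\sum_(N <= n < m) ip bfn (phi n) ^+ 2).
  by move=> s1 s2 s3 s4; lra.
have Ucvg : (fun m => alpha * gamma * Ra * u ^+ 2 + alpha * gamma * Rb * u' ^+ 2 -
  beta * Z m ^+ 2) @ \oo -->
   alpha * gamma * Ra * u ^+ 2 + alpha * gamma * Rb * u' ^+ 2 - beta * zeta ^+ 2.
  apply: cvgB; first exact: cvg_cst.
  apply: cvgM; first exact: cvg_cst.
  by rewrite expr2; under eq_fun do rewrite expr2; exact: cvgM.
have := ler_cvg_to Tcvg Ucvg; rewrite -/(d _) => H.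
have {}H : gamma * (2 * (ip wt f - \sum_(n < N) c n * d n) +
  2 * delta * (ip f f - \sum_(n < N) c n ^+ 2)) <=
   alpha * gamma * Ra * u ^+ 2 + alpha * gamma * Rb * u' ^+ 2 - beta * zeta ^+ 2.
  by apply: H; near=> m; apply: TZ; near: m; exact: nbhs_infty_ge.
move: H HT; rewrite -/(c _).
move: (\sum_(n < N) c n * d n) (\sum_(n < N) c n ^+ 2) (ip wt f) (ip f f) => s1 s2 s3 s4; lra.
Unshelve. all: by end_near. Qed.

End StaticInequality.

(** * Exponential decay along trajectories *)

Section Calculus.
Context {R : realType}.
Implicit Types (f g : R -> R) (t : R).

Lemma is_derive_add f g t df dg : is_derive t 1 f df -> is_derive t 1 g dg ->
  is_derive t 1 (fun s => f s + g s) (df + dg).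
Proof. by move=> Hf Hg; exact: is_deriveD. Qed.

Lemma is_derive_mul f g t df dg : is_derive t 1 f df -> is_derive t 1 g dg ->
  is_derive t 1 (fun s => f s * g s) (f t * dg + g t * df).
Proof. by move=> Hf Hg; exact: is_deriveM. Qed.

Lemma is_derive_scale f t df c : is_derive t 1 f df -> is_derive t 1 (fun s => c * f s) (c * df).
Proof. by move=> Hf; exact: is_deriveZ. Qed.

Lemma is_derive_const c t : is_derive t 1 (fun=> c : R) 0.
Proof. exact: is_derive_cst. Qed.

Lemma is_derive_bigsum (I : Type) (r : seq I) (f : I -> R -> R) t (df : I -> R) :
  (forall i, is_derive t 1 (f i) (df i)) ->
  is_derive t 1 (fun s => \sum_(i <- r) f i s) (\sum_(i <- r) df i).
Proof.
move=> H; elim: r => [|i r ih].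
  rewrite big_nil; under eq_fun do rewrite big_nil; exact: is_derive_const.
rewrite big_cons; under eq_fun do rewrite big_cons; exact: is_derive_add.
Qed.

Lemma is_derive_near f g t df : (\forall s \near t, f s = g s) ->
  is_derive t 1 f df -> is_derive t 1 g df.
Proof.
move=> fg [dvf <-]; apply: DeriveDef.
  by apply: near_eq_derivable fg dvf; rewrite oner_neq0.
by apply/esym/near_eq_derive => //; rewrite oner_neq0.
Qed.

Lemma is_derive_inj f t d1 d2 : is_derive t 1 f d1 -> is_derive t 1 f d2 -> d1 = d2.
Proof. by move=> [_ <-] [_ <-]. Qed.

Definition vderiv n t (X : R -> 'cV[R]_n) (X' : 'cV[R]_n) :=
  forall i, is_derive t 1 (fun s => X s i 0) (X' i 0).

Lemma vderiv_col_mx m n t (X : R -> 'cV[R]_m) X' (Y : R -> 'cV[R]_n) Y' :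
  vderiv t X X' -> vderiv t Y Y' -> vderiv t (fun s => col_mx (X s) (Y s)) (col_mx X' Y').
Proof.
move=> HX HY i; case: (split_ordP i) => j ->.
  by rewrite col_mxEu; under eq_fun do rewrite col_mxEu; exact: HX.
by rewrite col_mxEd; under eq_fun do rewrite col_mxEd; exact: HY.
Qed.

Lemma is_derive_bf n (P : 'M[R]_n) t X X' : P^T = P -> vderiv t X X' ->
  is_derive t 1 (fun s => bf P (X s) (X s)) (2 * bf P X' (X t)).
Proof.
move=> PT HX; have -> : 2 * bf P X' (X t) = bf P (X t) X' + bf P X' (X t).
  by rewrite [bf P (X t) X']bf_sym//; ring.
rewrite !bfE; under eq_fun do rewrite bfE.
rewrite -big_split; apply: is_derive_bigsum => i /=.
rewrite -big_split; apply: is_derive_bigsum => j /=.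
have := is_derive_scale (P i j) (is_derive_mul (HX i) (HX j)).
under eq_fun do rewrite mulrCA mulrA.
by congr is_derive; ring.
Qed.

Let D0 : set R := [set t | 0 <= t].

(** Continuity relative to the half-line, hence only from the right at 0: trajectories are
    differentiable for positive times only. *)
Definition cont0 f := forall t, 0 <= t -> f s @[s --> within D0 (nbhs t)] --> f t.

Lemma cont0_within f : cont0 f <-> {within D0, continuous f}.
Proof. by split=> [H|/subspace_continuousP H]; [apply/subspace_continuousP|move=> t /H]. Qed.

Lemma eq_cont0 f g : (forall t, 0 <= t -> f t = g t) -> cont0 f -> cont0 g.
Proof.
move=> fg cf t t0; rewrite -fg//; apply: near_cvg_congr (cf t t0).
by rewrite near_withinE; apply: nearW => s; exact: fg.
Qed.

Lemma cont0D f g : cont0 f -> cont0 g -> cont0 (fun s => f s + g s).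
Proof. by move=> cf cg t t0; apply: cvgD; [exact: cf|exact: cg]. Qed.
Lemma cont0M f g : cont0 f -> cont0 g -> cont0 (fun s => f s * g s).
Proof. by move=> cf cg t t0; apply: cvgM; [exact: cf|exact: cg]. Qed.
Lemma cont0_cst c : cont0 (fun=> c).
Proof. by move=> t t0; exact: cvg_cst. Qed.
Lemma cont0Z c f : cont0 f -> cont0 (fun s => c * f s).
Proof. by move=> cf; apply: cont0M => //; exact: cont0_cst. Qed.
Lemma cont0B f g : cont0 f -> cont0 g -> cont0 (fun s => f s - g s).
Proof. by move=> cf cg t t0; apply: cvgB; [exact: cf|exact: cg]. Qed.
Lemma cont0_sum (I : Type) (r : seq I) (f : I -> R -> R) : (forall i, cont0 (f i)) ->
  cont0 (fun s => \sum_(i <- r) f i s).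
Proof.
move=> H; elim: r => [|i r ih].
  under eq_fun do rewrite big_nil; exact: cont0_cst.
under eq_fun do rewrite big_cons; exact: cont0D.
Qed.

Lemma cont0_bf n (P : 'M[R]_n) (X : R -> 'cV[R]_n) : (forall i, cont0 (fun s => X s i 0)) ->
  cont0 (fun s => bf P (X s) (X s)).
Proof.
move=> HX; under eq_fun do rewrite bfE.
by do 2 (apply: cont0_sum => ?); apply: cont0M => //; apply: cont0M => //; exact: cont0_cst.
Qed.

Lemma cont0_col_mx m n (X : R -> 'cV[R]_m) (Y : R -> 'cV[R]_n) :
  (forall i, cont0 (fun s => X s i 0)) -> (forall i, cont0 (fun s => Y s i 0)) ->
  forall i, cont0 (fun s => col_mx (X s) (Y s) i 0).
Proof.
move=> HX HY i; case: (split_ordP i) => j ->.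
  by under eq_fun do rewrite col_mxEu; exact: HX.
by under eq_fun do rewrite col_mxEd; exact: HY.
Qed.

Lemma cont0_ip (w : R -> R -> R) g : L2_continuous D0 w -> in_L2 g -> cont0 (fun s => ip (w s) g).
Proof.
move=> cw Lg t t0; have [Lw dw] := cw t t0; apply: L2_cvg_ip => //.
by rewrite near_withinE; apply: nearW => s /cw[].
Qed.

Lemma cont0_ip_sqr (w : R -> R -> R) : L2_continuous D0 w -> cont0 (fun s => ip (w s) (w s)).
Proof.
move=> cw t t0; have [Lw dw] := cw t t0; apply: L2_cvg_sqr => //.
by rewrite near_withinE; apply: nearW => s /cw[].
Qed.

(** [expR (2 delta s) V s] has nonpositive derivative for [s > 0]; continuity at 0 brings the
    comparison down to the initial time. *)
Lemma exp_decay (V : R -> R) (delta : R) : cont0 V ->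
  (forall t, 0 < t -> exists2 dV, is_derive t 1 V dV & dV + 2 * delta * V t <= 0) ->
  forall t, 0 <= t -> V t <= expR (- 2 * delta * t) * V 0.
Proof.
move=> cV dV t t0.
pose f s := expR (2 * delta * s) * V s.
have df (s : R) : 0 < s -> exists2 df, is_derive s 1 f df & df <= 0.
  move=> s0; have [dVs dVsP le0] := dV s s0.
  have dl := is_derive_scale (2 * delta) (is_derive_id s (1 : R)).
  have de := is_derive1_comp (is_derive_expR (2 * delta * s)) dl.
  exists (expR (2 * delta * s) * (dVs + 2 * delta * V s)).
    have := is_derive_mul de dVsP.
    by congr is_derive; rewrite mulr1 /=; ring.
  by rewrite mulr_ge0_le0// expR_ge0.
have cf : {within `[0, +oo[, continuous f}.
  rewrite (_ : `[0, +oo[%classic = D0); last first.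
    by apply/seteqP; split=> s /=; rewrite in_itv/= andbT.
  apply/cont0_within; apply: cont0M => //.
  apply/cont0_within; apply: continuous_subspaceT => s.
  apply: (@continuous_comp _ _ _ (fun s => 2 * delta * s) expR); last exact: continuous_expR.
  by apply: cvgM; [exact: cvg_cst|exact: cvg_id].
have H : f t <= f 0.
  apply: (@ler0_derive1_nincry _ f 0) => //.
  - by move=> x; rewrite in_itv/= andbT => /df[? []].
  - move=> x; rewrite in_itv/= andbT => /df[l dfx l0]; rewrite derive1E.
    by have [_ ->] := dfx.
move: H; rewrite /f mulr0 expR0 mul1r => H.
have e0 := expR_gt0 (2 * delta * t).
rewrite mulNr mulNr expRN.
by rewrite -ler_pdivrMl ?invr_gt0// invrK.
Qed.

End Calculus.

(** * Comparison of the Lyapunov function with the energy of z and of the observer *)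

Section Bounds.
Context {R : realType} (theta2 : R) (lam : nat -> R) (phi : nat -> R -> R).
Hypothesis hb : hilbert_basis phi.
Hypothesis lam_gt0 : forall n, 0 < lam n.
Hypothesis lam_le : forall m n, (m <= n)%N -> lam m <= lam n.
Context (N0 N : nat) (K : 'rV[R]_N0).
Hypothesis hN : (N0 <= N)%N.
Local Notation bfn := (bfun theta2).
Implicit Types (f g : R -> R) (zh : nat -> R).

Lemma ip_add_le f g : in_L2 f -> in_L2 g ->
  ip (fun x => f x + g x) (fun x => f x + g x) <= 2 * ip f f + 2 * ip g g.
Proof.
move=> Lf Lg; have := ip_ge0 (fun x => f x - g x).
rewrite ipBl//; last exact: in_L2B.
rewrite ![ip _ (fun x => f x - g x)]ipC !ipBl// ipDl//; last exact: in_L2D.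
rewrite ![ip _ (fun x => f x + g x)]ipC !ipDl// [ip g f]ipC; lra.
Qed.

Definition lifted f u : R -> R := fun x => f x + u * bfn x.

Lemma lifted_L2 f u : in_L2 f -> in_L2 (lifted f u).
Proof. by move=> Lf; apply: in_L2D => //; apply: in_L2Z; exact: bfun_L2. Qed.

Lemma ip_lifted f u g : in_L2 f -> in_L2 g -> ip (lifted f u) g = ip f g + u * ip bfn g.
Proof.
move=> Lf Lg; have Lb := bfun_L2 theta2; rewrite ipDl//; last exact: in_L2Z.
by rewrite ipZl.
Qed.

(** By Parseval this is the squared norm of the remainder of [f] after [N] modes, in a form that
    involves no series. *)
Definition tail_energy f := ip f f - \sum_(n < N) ip f (phi n) ^+ 2.

Lemma tail_energy_ge0 f : in_L2 f -> 0 <= tail_energy f.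
Proof. by move=> Lf; rewrite subr_ge0; exact: (bessel hb _ Lf). Qed.

Local Notation X zh f := (state lam N0 N zh (fun n => ip f (phi n))).

Lemma ip_lifted_le f u : in_L2 f -> ip (lifted f u) (lifted f u) <=
  2 * ip f f + 2 * (u ^+ 2 * ip bfn bfn).
Proof.
move=> Lf; have Lb := bfun_L2 theta2; have Lub := in_L2Z u Lb.
have e : ip (fun x => u * bfn x) (fun x => u * bfn x) = u ^+ 2 * ip bfn bfn.
  by rewrite ipZl// ipZr// mulrA.
by apply: (le_trans (ip_add_le Lf Lub)); rewrite e.
Qed.

Lemma state_lower : exists2 C, 0 < C & forall zh f, in_L2 f ->
  ip f f + \sum_(n < N) zh n ^+ 2 <=
  2 * tail_energy (lifted f (feedback K zh)) + C * sqn (X zh f).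
Proof.
pose E := 1 + lam N ^+ 2; pose F := 1 + (lam 0)^-1; pose k := sqn K^T; pose B := ip bfn bfn.
have E0 : 0 < E by rewrite ltr_pwDl ?sqr_ge0//.
have F0 : 0 < F by rewrite ltr_pwDl// invr_ge0 ltW.
have k0 : 0 <= k by exact: sqn_ge0.
have B0 : 0 <= B by exact: ip_ge0.
have kEB : 0 <= k * E * B by apply: mulr_ge0 => //; apply: mulr_ge0 => //; exact: ltW.
(* [|z|^2 <= 2 |w|^2 + 2 u^2 B] and [|w|^2] is its tail plus [\sum w_n^2 <= 2 \sum z_n^2 + 2 u^2 B],
   so [|z|^2] is at most twice the tail plus [4 \sum z_n^2 + 6 u^2 B]. Then
   [\sum z_n^2 <= 2 (E + F) S] and [u^2 B <= k E B S]; the last [E] is for the observer. *)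
exists (8 * (E + F) + 6 * (k * E * B) + E); first by move: kEB; move: (k * E * B) => kEB; lra.
move=> zh f Lf; have Lb := bfun_L2 theta2.
set u := feedback K zh; set S := sqn _.
have S0 : 0 <= S by exact: sqn_ge0.
have H1 : \sum_(n < N) zh n ^+ 2 <= E * S := state_observer_le lam_gt0 lam_le hN _ _.
have H2 : \sum_(n < N) (ip f (phi n) - zh n) ^+ 2 <= F * S := state_error_le lam_gt0 lam_le hN _ _.
have H3 : \sum_(n < N) ip f (phi n) ^+ 2 <=
  2 * \sum_(n < N) (ip f (phi n) - zh n) ^+ 2 + 2 * \sum_(n < N) zh n ^+ 2.
  rewrite !mulr_sumr -big_split; apply: ler_sum => n _ /=.
  by have := sqr_ge0 (ip f (phi n) - 2 * zh n); lra.
have H4 : u ^+ 2 <= k * \sum_(n < N) zh n ^+ 2 := sqr_feedback_le K hN zh.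
have H5 : u ^+ 2 <= k * (E * S) by rewrite (le_trans H4)// ler_wpM2l.
have H6 : u ^+ 2 * B <= k * E * B * S.
  by rewrite (le_trans (ler_wpM2r B0 H5))//; lra.
have H7 : \sum_(n < N) ip (lifted f u) (phi n) ^+ 2 <=
  2 * \sum_(n < N) ip f (phi n) ^+ 2 + 2 * (u ^+ 2 * B).
  apply: (@le_trans _ _ (2 * \sum_(n < N) ip f (phi n) ^+ 2 +
    2 * (u ^+ 2 * \sum_(n < N) ip bfn (phi n) ^+ 2))).
    rewrite !mulr_sumr -big_split; apply: ler_sum => n _ /=.
    rewrite ip_lifted//; last exact: (basis_L2 hb).
    by rewrite -exprMn; apply: (le_trans (sqr2_le _ _)); rewrite mulrDr.
  rewrite lerD2l ler_pM2l// ler_wpM2l ?sqr_ge0//; exact: (bessel hb _ Lb).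
have H8 : ip f f <= 2 * ip (lifted f u) (lifted f u) + 2 * (u ^+ 2 * B).
  have Lw := lifted_L2 u Lf.
  have e : ip (fun x => - u * bfn x) (fun x => - u * bfn x) = u ^+ 2 * B.
    by rewrite ipZl//; [rewrite ipZr// mulrA mulrNN|exact: in_L2Z].
  have := ip_add_le Lw (in_L2Z (- u) Lb); rewrite e.
  suff -> : (fun x => lifted f u x + - u * bfn x) = f by [].
  by apply/funext => x; rewrite /lifted; ring.
move: H1 H2 H3 H6 H7 H8; rewrite /tail_energy.
move: (ip (lifted f u) (lifted f u)) (\sum_(n < N) ip (lifted f u) _ ^+ 2) (ip f f).
move: (\sum_(n < N) (_ - _) ^+ 2) (\sum_(n < N) ip f _ ^+ 2) (\sum_(n < N) zh n ^+ 2) (u ^+ 2 * B)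
  (k * E * B).
move=> a1 a2 a3 a4 a5 a6 a7 a8; lra.
Qed.

Lemma state_upper : exists2 C, 0 < C & forall zh f, in_L2 f ->
  sqn (X zh f) + tail_energy (lifted f (feedback K zh)) <= C * (ip f f + \sum_(n < N) zh n ^+ 2).
Proof.
have [Cs Cs0 HCs] := state_le lam_gt0 lam_le hN.
pose k := sqn K^T; pose B := ip bfn bfn.
have k0 : 0 <= k by exact: sqn_ge0.
have B0 : 0 <= B by exact: ip_ge0.
have kB := mulr_ge0 k0 B0.
exists (Cs + 2 + 2 * (k * B)); first by move: kB; move: (k * B) => kB; lra.
move=> zh f Lf; set u := feedback K zh.
have H1 := HCs zh (fun n => ip f (phi n)).
have H2 := bessel hb N Lf.
have H4 : u ^+ 2 <= k * \sum_(n < N) zh n ^+ 2 := sqr_feedback_le K hN zh.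
have H3 := ip_lifted_le u Lf.
have H5 : 0 <= \sum_(n < N) ip (lifted f u) (phi n) ^+ 2 by apply: sumr_ge0 => n _; exact: sqr_ge0.
have H6 := ler_wpM2r B0 H4; have f0 := ip_ge0 f.
have H7 : 0 <= \sum_(n < N) zh n ^+ 2 by apply: sumr_ge0 => n _; exact: sqr_ge0.
have H8 : 0 <= k * B * ip f f by rewrite mulr_ge0.
have H9 : Cs * \sum_(n < N) ip f (phi n) ^+ 2 <= Cs * ip f f by rewrite ler_pM2l.
move: H1 H2 H3 H5 H6 H7 H9; rewrite /tail_energy -/B.
move: (sqn _) (\sum_(n < N) ip f _ ^+ 2) (\sum_(n < N) zh n ^+ 2)
  (\sum_(n < N) ip (lifted f u) _ ^+ 2) (ip (lifted f u) (lifted f u)).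
move=> a1 a2 a3 a4 a5 H1 H2 H3 H5 H6 H7 H9; lra.
Qed.

End Bounds.

(** * Decay of the Lyapunov function along closed-loop trajectories *)

Section Trajectory.
Context {R : realType} (theta1 theta2 : R) (p qt q : R -> R) (qc : R).
Context (lam : nat -> R) (phi : nat -> R -> R).
Hypothesis htheta1 : 0 < theta1 <= pi / 2.
Hypothesis htheta2 : 0 <= theta2 <= pi / 2.
Hypothesis hp : C1_01 p.
Hypothesis hp_gt0 : forall x, x \in `[0, 1] -> 0 < p x.
Hypothesis hqt : C0_01 qt.
Hypothesis hq : C0_01 q.
Hypothesis hqc : forall x, x \in `[0, 1] -> qt x = q x - qc.
Hypothesis hq_gt0 : forall x, x \in `[0, 1] -> 0 < q x.
Hypothesis heig : sl_eigensystem p q theta1 theta2 lam phi.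
Context (N0 N : nat) (K : 'rV[R]_N0) (L : 'cV[R]_N0) (delta : R).
Hypothesis hN : (N0 <= N)%N.
Context (P : 'M[R]_(N0 + (N0 + ((N - N0) + (N - N0))))) (alpha beta gamma : R).
Hypothesis lmi : lmi_constraints p qt qc theta2 lam phi K L delta P alpha beta gamma.
Context (z : R -> R -> R) (zhat : nat -> R -> R) (u y : R -> R) (z0 : R -> R) (zhat0 : nat -> R).
Hypothesis hplant : plant p qt theta1 theta2 z u y z0.
Hypothesis hctrl : controller p qt qc theta2 lam phi N K L zhat u y zhat0.
Hypothesis hclass : classical p q theta1 theta2 lam phi N (wfun theta2 z u) zhat.
Local Notation bfn := (bfun theta2).
Local Notation afn := (afun p qt theta2).
Local Notation betac := (betacoef p qt qc theta2 lam phi).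
Let hb := sl_phi_basis heig.
Local Notation w := (wfun theta2 z u).

Lemma wfunE t : w t = lifted theta2 (z t) (u t).
Proof. by apply/funext => x; rewrite /wfun /lifted mulrC. Qed.

Lemma w_L2 t : 0 <= t -> in_L2 (w t).
Proof. by move=> t0; have [] := classical_C0 hclass t0. Qed.

Lemma z_L2 t : 0 <= t -> in_L2 (z t).
Proof.
move=> t0; have := in_L2B (w_L2 t0) (in_L2Z (u t) (bfun_L2 theta2)).
by apply: eq_in_L2 => x _; rewrite /wfun; ring.
Qed.

Lemma w_coef t g : 0 <= t -> in_L2 g -> ip (w t) g = ip (z t) g + u t * ip bfn g.
Proof. by move=> t0 Lg; rewrite wfunE ip_lifted//; exact: z_L2. Qed.

Lemma u_feedback t : 0 <= t -> u t = feedback K (zhat^~ t).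
Proof. by move=> t0; rewrite (controller_input hctrl t0). Qed.

Let zn t n := ip (z t) (phi n).
Let X t := state lam N0 N (zhat^~ t) (zn t).
Let V t := bf P (X t) (X t) + gamma * tail_energy phi N (w t).

Lemma near_pos (t : R) (Q : R -> Prop) :
  0 < t -> (forall s, 0 <= s -> Q s) -> \forall s \near t, Q s.
Proof.
by move=> t0 H; apply: filterS (lt_nbhsr t0) => s s0; apply: H; exact: ltW.
Qed.

Lemma V_cont : cont0 V.
Proof.
have cw := classical_C0 hclass.
have czh n : (n < N)%N -> cont0 (zhat n).
  by move=> nN; apply/cont0_within; exact: (classical_zhat_C0 hclass nN).
have cu : cont0 u.
  apply: (@eq_cont0 _ (fun t => feedback K (zhat^~ t))); first by move=> t /u_feedback.
  by apply: cont0_sum => k; apply: cont0Z; apply: czh; rewrite (leq_trans _ hN).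
have czn n : cont0 (zn^~ n).
  apply: (@eq_cont0 _ (fun t => ip (w t) (phi n) - u t * ip bfn (phi n))).
    by move=> t t0; rewrite (w_coef t0 (basis_L2 hb n)) addrK.
  apply: cont0B; first exact: (cont0_ip cw (basis_L2 hb n)).
  by apply: cont0M => //; exact: cont0_cst.
have lN0 (i : 'I_N0) : (i < N)%N by rewrite (leq_trans (ltn_ord i)).
have lN1 (i : 'I_(N - N0)) : (N0 + i < N)%N by rewrite -ltn_subRL.
apply: cont0D; last first.
  apply: cont0Z; apply: cont0B; first exact: cont0_ip_sqr.
  apply: cont0_sum => n; apply: cont0M; exact: (cont0_ip cw (basis_L2 hb n)).
apply: cont0_bf; apply: cont0_col_mx; [|apply: cont0_col_mx; [|apply: cont0_col_mx]]; move=> i;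
  under eq_fun do rewrite mxE.
- exact: czh.
- by apply: cont0B; [exact: czn|exact: czh].
- by apply: cont0M; [exact: czh|exact: cont0_cst].
- by apply: cont0Z; apply: cont0B; [exact: czn|exact: czh].
Qed.

Section Instant.
Variable t : R.
Hypothesis t0 : 0 < t.

Let zh' n : R := 'D_1 (zhat n) t.
Let u' := feedback K zh'.
Let zeta := w t 0 - \sum_(n < N) ip (w t) (phi n) * phi n 0.

Lemma zhat_deriv n : (n < N)%N -> is_derive t 1 (zhat n) (zh' n).
Proof. by move=> nN; have [H _] := classical_zhat_C1 hclass nN t0; apply: DeriveDef. Qed.

Lemma zh'_openE n : (N0 <= n < N)%N -> zh' n =
  (- lam n + qc) * zhat n t + betac n * feedback K (zhat^~ t).
Proof.
move=> H; have nN : (n < N)%N by case/andP: H.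
by rewrite -(u_feedback (ltW t0));
  exact: is_derive_inj (zhat_deriv nN) (controller_open hctrl t0 H).
Qed.

(** The lifting terms [b_n u] cancel between the modes of [w] and their estimates. What remains are
    the errors of the first [N] modes and the tail zeta. *)
Lemma innovation_eq :
  \sum_(k < N) (zhat k t + bcoef theta2 phi k * u t) * phi k 0 - y t =
  - (innovation phi N (zhat^~ t) (zn t) + zeta).
Proof.
(* The lifting vanishes at 0, so the measurement of [z] is also one of [w]. *)
have -> : y t = w t 0.
  by rewrite (plant_output hplant (ltW t0)) /wfun /bfun expr0n/= mul0r oppr0 mul0r addr0.
rewrite /innovation /zeta.
have -> : \sum_(n < N) ip (w t) (phi n) * phi n 0 =
   \sum_(k < N) (zn t k - zhat k t) * phi k 0 +
     \sum_(k < N) (zhat k t + bcoef theta2 phi k * u t) * phi k 0.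
  rewrite -big_split; apply: eq_bigr => k _ /=.
  by rewrite (w_coef (ltW t0) (basis_L2 hb k)) /bcoef /zn; ring.
ring.
Qed.

Lemma zh'_obsE (i : 'I_N0) : zh' i = (- lam i + qc) * zhat i t + betac i * feedback K (zhat^~ t)
  + L i 0 * (innovation phi N (zhat^~ t) (zn t) + zeta).
Proof.
have iN : (i < N)%N by rewrite (leq_trans (ltn_ord i)).
rewrite (is_derive_inj (zhat_deriv iN) (controller_obs hctrl i t0)) innovation_eq.
by rewrite (u_feedback (ltW t0)); ring.
Qed.

Lemma u_deriv : is_derive t 1 u u'.
Proof.
apply: (@is_derive_near _ (fun s => feedback K (zhat^~ s))).
  by apply: near_pos => // s /u_feedback.
apply: is_derive_bigsum => k; apply: is_derive_scale; apply: zhat_deriv.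
by rewrite (leq_trans _ hN).
Qed.

(** Green's formula applied directly to [z], with boundary datum [u t]: the boundary term is
    [betac n * u t], and [u] is not differentiated. *)
Lemma zn_deriv n : is_derive t 1 (zn^~ n)
  ((- lam n + qc) * zn t n + betac n * feedback K (zhat^~ t)).
Proof.
have Lphi := basis_L2 hb n; have Lz := z_L2 (ltW t0).
have [H2 [zt [dz Hpz]]] := plant_pde hplant t0; have [Lzt _] := dz.
have Dz : sl_data p q theta1 theta2 (u t) (z t) (der01 (z t)) (fun x => qc * z t x - zt x).
  case: H2 => h [Hz _]; split => //.
  - apply: eq_H1 Hpz => x Ix //; rewrite hqc//; ring.
  - exact: (plant_left hplant t0).
  - exact: (plant_right hplant t0).
have := sl_lagrange hq Dz (eigen_data heig n).
rewrite -(betacoefE htheta2 hp hqt hq hqc heig) ipBl//; last exact: in_L2Z.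
rewrite ipZl// ipZr// => E.
have := L2_deriv_ip dz (near_pos t0 (@z_L2)) Lphi.
congr is_derive; rewrite -(u_feedback (ltW t0)) /zn; lra.
Qed.

(** Obtained by differentiating [w_n = z_n + u b_n]; the terms in [u] regroup into [a_n u] by the
    definition of [betacoef]. *)
Lemma wt_coef wt n : L2_is_deriv w t wt -> ip wt (phi n) =
  (- lam n + qc) * ip (w t) (phi n) + ip afn (phi n) * u t + ip bfn (phi n) * u'.
Proof.
move=> dw; have Lphi := basis_L2 hb n.
have H1 := L2_deriv_ip dw (near_pos t0 (@w_L2)) Lphi.
have H2 : is_derive t 1 (fun s => ip (w s) (phi n))
  ((- lam n + qc) * zn t n + betac n * feedback K (zhat^~ t) + (u t * 0 + ip bfn (phi n) * u')).
  apply: (@is_derive_near _ (fun s => zn s n + u s * ip bfn (phi n))).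
    by apply: near_pos => // s s0; rewrite w_coef.
  apply: is_derive_add; first exact: zn_deriv.
  exact: is_derive_mul u_deriv (is_derive_const _ _).
rewrite (is_derive_inj H1 H2) (w_coef (ltW t0) Lphi) -(u_feedback (ltW t0)).
rewrite /betacoef /acoef /bcoef /zn; ring.
Qed.

Lemma V_deriv : exists2 V', is_derive t 1 V V' & V' + 2 * delta * V t <= 0.
Proof.
have [wt dw] : exists wt, L2_is_deriv w t wt.
  by have [wts [/(_ t t0) dw _]] := classical_C1 hclass; exists (wts t).
have [Aw [/(_ t t0) Dw _]] := classical_dom hclass.
have [PT _ _ _] := lmi.
have [Lwt _] := dw.
pose zn' n := (- lam n + qc) * zn t n + betac n * feedback K (zhat^~ t).
have lN0 (i : 'I_N0) : (i < N)%N by rewrite (leq_trans (ltn_ord i)).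
have lN1 (i : 'I_(N - N0)) : (N0 + i < N)%N by rewrite -ltn_subRL.
have dX : vderiv t X (state lam N0 N zh' zn').
  have dB n : (n < N)%N -> is_derive t 1 (fun s => zn s n - zhat n s) (zn' n - zh' n).
    move=> nN; have := is_derive_add (zn_deriv n) (is_derive_scale (-1) (zhat_deriv nN)).
    by under eq_fun do rewrite mulN1r; rewrite mulN1r.
  apply: vderiv_col_mx; [|apply: vderiv_col_mx; [|apply: vderiv_col_mx]]; move=> i; rewrite mxE;
    under eq_fun do rewrite mxE.
  - exact: zhat_deriv.
  - exact: dB.
  - have := is_derive_scale (lam (N0 + i)%N)^-1 (zhat_deriv (lN1 i)).
    by under eq_fun do rewrite mulrC; rewrite mulrC.
  - by apply: is_derive_scale; exact: dB.
have dV : is_derive t 1 V (2 * bf P (state lam N0 N zh' zn') (X t) +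
   gamma * (2 * ip wt (w t) + -1 * \sum_(n < N) (ip (w t) (phi n) * ip wt (phi n) +
     ip (w t) (phi n) * ip wt (phi n)))).
  apply: is_derive_add; first exact: is_derive_bf.
  apply: is_derive_scale.
  (* Put in the shape of sums, scalings and products, for which derivative rules are available. *)
  have -> : (fun s => tail_energy phi N (w s)) =
      (fun s => ip (w s) (w s) + -1 * \sum_(n < N) (ip (w s) (phi n) * ip (w s) (phi n))).
    by apply/funext => s; rewrite /tail_energy mulN1r; congr (_ - _).
  apply: is_derive_add; first exact: L2_deriv_sqr dw (near_pos t0 (@w_L2)).
  apply: is_derive_scale; apply: is_derive_bigsum => n.
  have d := L2_deriv_ip dw (near_pos t0 (@w_L2)) (basis_L2 hb n).
  exact: is_derive_mul.
exists (2 * bf P (state lam N0 N zh' zn') (X t) +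
   gamma * (2 * ip wt (w t) + -1 * \sum_(n < N) (ip (w t) (phi n) * ip wt (phi n) +
     ip (w t) (phi n) * ip wt (phi n)))) => //.
have FX := Fmx_state (lam_gt0 heig) hN zh'_obsE zh'_openE (fun n _ => erefl (zn' n)).
rewrite -FX.
have uE : u t = (Kmx N K *m X t) 0 0 by rewrite Kmx_state; exact: u_feedback (ltW t0).
have u'E : u' = (Emx p qt qc theta2 lam phi N K L *m col_mx (X t) zeta%:M) 0 0.
  rewrite (Emx_state (lam_gt0 heig) hN zh'_obsE)//; by rewrite mxE eqxx mulr1n.
have := lyapunov_ineq htheta1 htheta2 hp hp_gt0 hqt hq hq_gt0 heig lmi (sl_op_data Dw) Lwt
  (fun n => wt_coef n dw) uE u'E.
rewrite -/zeta big_split /= /V /tail_energy -/(X t).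
move: (bf P (_ + _) (X t)) (bf P (X t) (X t)) (ip (w t) (w t)) (ip wt (w t)) (\sum_(n < N) _ ^+ 2)
  (\sum_(n < N) _ * _).
move=> a1 a2 a3 a4 a5 a6; lra.
Qed.

End Instant.

Lemma V_decay t : 0 <= t -> V t <= expR (- 2 * delta * t) * V 0.
Proof.
by apply: exp_decay; [exact: V_cont|exact: V_deriv].
Qed.

End Trajectory.

(** Index 0 is the initial time and 1 the current one. [S] is the squared norm of the state, [b] its
    form under [P], [r] the tail energy, [E] the energy of the statement, and [e] the exponential
    factor. *)
Lemma energy_comparison (R : realType) (Cp Cq C1 C3 g S0 S1 b0 b1 r0 r1 E0 E1 e : R) :
  0 < Cp -> 0 < Cq -> 0 < C1 -> 0 < g -> 0 < e ->
  S1 <= Cp * b1 -> b0 <= Cq * S0 -> 0 <= S0 -> 0 <= b1 ->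
  E1 <= 2 * r1 + C1 * S1 -> S0 + r0 <= C3 * E0 ->
  b1 + g * r1 <= e * (b0 + g * r0) -> 0 <= r1 -> 0 <= r0 ->
  E1 <= (2 / g + C1 * Cp) * ((Cq + g) * C3) * e * E0.
Proof.
move=> Cp0 Cq0 C10 g0 e0 hS1 hb0 S00 b10 hE1 hE0 dec r10 r00.
have A0 : 0 <= 2 / g + C1 * Cp by apply: addr_ge0; [apply: divr_ge0 => //|apply: mulr_ge0];
  exact: ltW.
apply: (@le_trans _ _ ((2 / g + C1 * Cp) * (b1 + g * r1))).
  have h1 : C1 * S1 <= C1 * (Cp * b1) by rewrite ler_pM2l.
  have h2 : 0 <= 2 / g * b1 by rewrite mulr_ge0// divr_ge0// ltW.
  have h3 : 0 <= C1 * Cp * (g * r1) by apply: mulr_ge0; apply: mulr_ge0 => //; exact: ltW.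
  have -> : (2 / g + C1 * Cp) * (b1 + g * r1) =
    2 / g * b1 + 2 * r1 + C1 * Cp * b1 + C1 * Cp * (g * r1).
    by field; rewrite gt_eqF.
  lra.
rewrite -!mulrA; apply: ler_wpM2l => //; apply: (le_trans dec).
have h4 : b0 + g * r0 <= (Cq + g) * (S0 + r0).
  have : 0 <= g * S0 by rewrite mulr_ge0// ltW.
  have : 0 <= Cq * r0 by rewrite mulr_ge0// ltW.
  lra.
have h5 : (Cq + g) * (S0 + r0) <= (Cq + g) * (C3 * E0) by rewrite ler_pM2l// addr_gt0.
have -> : (Cq + g) * (C3 * (e * E0)) = e * ((Cq + g) * (C3 * E0)) by ring.
by rewrite ler_pM2l// (le_trans h4).
Qed.

Theorem theorem2 (R : realType) (theta1 theta2 : R) (p qt q : R -> R) (qc : R)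
    (lam : nat -> R) (phi : nat -> R -> R)
    (delta : R) (N0 : nat) (K : 'rV[R]_N0) (L : 'cV[R]_N0)
    (htheta1 : 0 < theta1 <= pi / 2)
    (htheta2 : 0 <= theta2 <= pi / 2)
    (hp : C2_01 p)
    (hp_gt0 : forall x, x \in `[0, 1] -> 0 < p x)
    (hqt : C0_01 qt)
    (hq : C0_01 q)
    (hqc : forall x, x \in `[0, 1] -> qt x = q x - qc)
    (hq_gt0 : forall x, x \in `[0, 1] -> 0 < q x)
    (heig : sl_eigensystem p q theta1 theta2 lam phi)
    (hdelta : 0 < delta)
    (hN0 : (1 <= N0)%N)
    (hlam : forall n, (N0 <= n)%N -> - lam n + qc < - delta)
    (hK : hurwitz_lt delta (A0mx qc lam N0 + B0mx p qt qc theta2 lam phi N0 *m K))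
    (hL : hurwitz_lt delta (A0mx qc lam N0 - L *m C0mx phi N0)) :
  (forall N : nat, (N0 + 1 <= N)%N -> (Mphi_ereal lam phi N < +oo)%E) /\
  (forall (N : nat) (P : 'M[R]_(N0 + (N0 + ((N - N0) + (N - N0)))))
      (alpha beta gamma : R),
    (N0 + 1 <= N)%N ->
    lmi_constraints p qt qc theta2 lam phi K L delta P alpha beta gamma ->
    exists M : R, 0 < M /\
      forall (z0 : R -> R) (zhat0 : nat -> R),
        in_H2 z0 ->
        left_bc theta1 z0 = 0 ->
        right_bc theta2 z0 = \sum_(k < N0) K 0 k * zhat0 k ->
        forall (z : R -> R -> R) (zhat : nat -> R -> R),
          closed_loop_trajectory p q qt qc theta1 theta2 lam phi N K L
            z0 zhat0 z zhat ->
          forall t : R, 0 <= t ->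
            L2norm (z t) ^+ 2 + \sum_(n < N) zhat n t ^+ 2 <=
              M * expR (- 2 * delta * t)
                * (L2norm z0 ^+ 2 + \sum_(n < N) zhat0 n ^+ 2)) /\
  (exists Nmin : nat, forall N : nat, (N0 + 1 <= N)%N -> (Nmin <= N)%N ->
    exists (P : 'M[R]_(N0 + (N0 + ((N - N0) + (N - N0)))))
      (alpha beta gamma : R),
      lmi_constraints p qt qc theta2 lam phi K L delta P alpha beta gamma).
Proof.
have hp1 : C1_01 p by case: hp.
have hlamN0 := hlam N0 (leqnn N0).
split; [|split].
- move=> N _; exact: (Mphi_ereal_lty hq hp1 hp_gt0 hq_gt0 htheta1 htheta2 heig).
- move=> N P alpha beta gamma hN1 lmi.
  have hN : (N0 <= N)%N by apply: leq_trans hN1; rewrite leq_addr.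
  have [PT Ppos [_ _ gamma0] _] := lmi.
  have hb := sl_phi_basis heig.
  have [Cp Cp0 HCp] := posdef_sqn PT Ppos.
  have [Cq Cq0 HCq] := bf_le_sqn P.
  have [C1 C10 HC1] := state_lower theta2 hb (lam_gt0 heig) (lam_le heig) K hN.
  have [C3 C30 HC3] := state_upper theta2 hb (lam_gt0 heig) (lam_le heig) K hN.
  (* [A] bounds the current energy by the current [V], and [B] the initial [V] by the initial
     energy. *)
  pose A := 2 / gamma + C1 * Cp; pose B := (Cq + gamma) * C3.
  have A0 : 0 < A by apply: addr_gt0; [exact: divr_gt0|exact: mulr_gt0].
  have B0 : 0 < B by apply: mulr_gt0 => //; exact: addr_gt0.
  exists (A * B); split; first exact: mulr_gt0.
  move=> z0 zhat0 _ _ _ z zhat [u [y [hplant hctrl hclass]]] t t0.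
  have decay := V_decay htheta1 htheta2 hp1 hp_gt0 hqt hq hqc hq_gt0 heig hN lmi hplant hctrl hclass t0.
  have zL2 s : 0 <= s -> in_L2 (z s) := z_L2 hclass (t := s).
  have wE s : 0 <= s -> wfun theta2 z u s = lifted theta2 (z s) (feedback K (zhat^~ s)).
    by move=> s0; rewrite wfunE (u_feedback hctrl s0).
  have low := HC1 (zhat^~ t) (z t) (zL2 t t0).
  have up := HC3 (zhat^~ 0) (z 0) (zL2 0 (lexx 0)).
  have tail_ge s : 0 <= s -> 0 <= tail_energy phi N (lifted theta2 (z s) (feedback K (zhat^~ s))).
    by move=> s0; apply: (tail_energy_ge0 hb); apply: lifted_L2; exact: zL2.
  rewrite !wE// in decay.
  have z0E : ip (z 0) (z 0) = ip z0 z0.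
    by apply: eq_ip => x Ix; rewrite (plant_init hplant Ix).
  have zh0E : \sum_(n < N) zhat n 0 ^+ 2 = \sum_(n < N) zhat0 n ^+ 2.
    by apply: eq_bigr => n _; rewrite (controller_init hctrl (ltn_ord n)).
  rewrite !sqr_L2norm -z0E -zh0E.
  exact: (energy_comparison Cp0 Cq0 C10 gamma0 (expR_gt0 _) (HCp _) (HCq _) (sqn_ge0 _)
    (posdef_ge0 _ Ppos) low up decay (tail_ge t t0) (tail_ge 0 (lexx 0))).
- have [Nmin H] := lmi_feasible htheta1 htheta2 hp1 hp_gt0 hqt hq hq_gt0 heig hN0 hlamN0 hK hL.
  by exists Nmin => N _; exact: H.
Qed.
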